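(* Let $\gamma$ be a singular graphon with edge density $p>0$, let $K_2$ be the graph consisting of a single edge on two vertices, and let $Y_\infty$ be the limit in distribution, as $n\to\infty$, of $n\,(t(K_2,G_n(\gamma))-\mathbb{E}[t(K_2,G_n(\gamma))])$. The following assertions are equivalent: (1) The graphon $\gamma$ is the constant graphon $\gamma_p$. (2) $Y_\infty$ has a Gaussian distribution. (3) The fourth cumulant of $Y_\infty$ vanishes.
   Context: Graphs are finite, simple and undirected. A graph function is a measurable symmetric $g:[0,1]^2\to[0,1]$ (up to null sets); a graphon $\gamma=[g]$ is an equivalence class of graph functions for the relation $\delta_\square=0$, where $\delta_\square$ is the cut-metric $\inf_\sigma \sup_{S,T}|\int_{S\times T}(g_1(\sigma(x),\sigma(y))-g_2(x,y))\,dx\,dy|$, $\sigma$ running over measure-preserving measurable bijections of $[0,1]$ and $S,T$ over measurable subsets. For a graph $F$ on $\{1,\dots,k\}$, $t(F,\gamma)=\int_{[0,1]^k}\prod_{\{i,j\}\in E_F}g(x_i,x_j)\,dx_1\cdots dx_k$; for a graph $G$, $t(F,G)=|\hom(F,G)|/|V_G|^{|V_F|}$, where $\hom(F,G)$ is the set of maps $V_F\to V_G$ sending edges to edges. The edge density of $\gamma$ is $p=t(K_2,\gamma)=\int_{[0,1]^2}g$, and $\gamma_p$ is the class of the constant graph function $p$. For graphs $F_1,F_2$ on $k_1,k_2\ge1$ vertices, $F_1F_2$ is their disjoint union and $(F_1\bowtie F_2)(i_1,i_2)$ is the graph obtained from it by identifying vertex $i_1$ of $F_1$ with vertex $i_2$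 of $F_2$. The graphon $\gamma$ is singular if for all finite graphs $F_1,F_2$, $t(F_1F_2,\gamma)=\frac1{k_1k_2}\sum_{i_1=1}^{k_1}\sum_{i_2=1}^{k_2}t((F_1\bowtie F_2)(i_1,i_2),\gamma)$. The $W$-random graph $G_n(\gamma)$ has vertex set $\{1,\dots,n\}$; with $(X_i)$ and $(U_{ij})_{i<j}$ independent uniform on $[0,1]$, $i<j$ are connected iff $U_{ij}\le g(X_i,X_j)$. For singular $\gamma$ the limit in distribution $Y_\infty$ exists and its law is determined by its moments. Gaussian distributions are allowed to be degenerate (zero variance). The $r$-th cumulant of a random variable $Y$ is $r!$ times the coefficient of $t^r$ in $\log\mathbb{E}[e^{tY}]$. *)

(* Defs.v *)
From HB Require Import structures.
From mathcomp Require Import all_boot all_order all_algebra.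
From mathcomp Require Import all_classical all_reals all_analysis.
Set Implicit Arguments.
Unset Strict Implicit.
Unset Printing Implicit Defensive.
Import Order.TTheory GRing.Theory Num.Theory.
Import numFieldNormedType.Exports.
Local Open Scope classical_set_scope.
Local Open Scope ring_scope.

Record sgraph (n : nat) := SGraph {
  edge :> rel 'I_n;
  edge_sym : symmetric edge;
  edge_irr : irreflexive edge }.

Lemma K2_sym : symmetric (fun i j : 'I_2 => i != j).
Proof. by move=> i j; rewrite eq_sym. Qed.

Lemma K2_irr : irreflexive (fun i j : 'I_2 => i != j).
Proof. by move=> i; rewrite eqxx. Qed.

Definition K2 : sgraph 2 := SGraph K2_sym K2_irr.

(* The union, inside 'I_m, of the images of F1 and F2 under two maps. *)
Definition union_rel (k1 k2 m : nat) (F1 : sgraph k1) (F2 : sgraph k2)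
    (f1 : 'I_k1 -> 'I_m) (f2 : 'I_k2 -> 'I_m) : rel 'I_m := fun u v =>
  [exists a, exists b, [&& F1 a b, f1 a == u & f1 b == v]] ||
  [exists a, exists b, [&& F2 a b, f2 a == u & f2 b == v]].

Lemma union_rel_sym (k1 k2 m : nat) (F1 : sgraph k1) (F2 : sgraph k2)
    (f1 : 'I_k1 -> 'I_m) (f2 : 'I_k2 -> 'I_m) :
  symmetric (union_rel F1 F2 f1 f2).
Proof.
suff H k (F : sgraph k) (f : 'I_k -> 'I_m) u v :
    [exists a, exists b, [&& F a b, f a == u & f b == v]] ->
    [exists a, exists b, [&& F a b, f a == v & f b == u]].
  by move=> u v; rewrite /union_rel; congr (_ || _); apply/idP/idP; apply: H.
case/existsP => a; case/existsP => b /and3P[Fab fa fb].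
by apply/existsP; exists b; apply/existsP; exists a; rewrite edge_sym Fab fa fb.
Qed.

Lemma union_rel_irr (k1 k2 m : nat) (F1 : sgraph k1) (F2 : sgraph k2)
    (f1 : 'I_k1 -> 'I_m) (f2 : 'I_k2 -> 'I_m) :
  injective f1 -> injective f2 -> irreflexive (union_rel F1 F2 f1 f2).
Proof.
suff H k (F : sgraph k) (f : 'I_k -> 'I_m) u : injective f ->
    [exists a, exists b, [&& F a b, f a == u & f b == u]] = false.
  by move=> i1 i2 u; rewrite /union_rel !H.
move=> fi; apply/negbTE/negP; case/existsP => a; case/existsP => b.
case/and3P => Fab /eqP fa /eqP fb.
have ab : a = b by apply: fi; rewrite fa fb.
by rewrite ab edge_irr in Fab.
Qed.

Definition graph_disjoint_union (k1 k2 : nat) (F1 : sgraph k1)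
    (F2 : sgraph k2) : sgraph (k1 + k2) :=
  SGraph (@union_rel_sym _ _ _ F1 F2 (@lshift k1 k2) (@rshift k1 k2))
    (union_rel_irr F1 F2 (@lshift_inj k1 k2) (@rshift_inj k1 k2)).

(* The vertices of the graph obtained from the disjoint union of F1 and F2 by
   identifying i1 and i2 are those of F1, followed by those of F2 other than
   i2; identify_vertex sends each vertex of F2 to its place among them. *)
Definition identify_vertex (k1 k2 : nat) (i1 : 'I_k1) (i2 : 'I_k2)
    (j : 'I_k2) : 'I_(k1 + k2.-1) :=
  if unlift i2 j is Some j' then rshift k1 j' else lshift k2.-1 i1.

Lemma identify_vertex_inj (k1 k2 : nat) (i1 : 'I_k1) (i2 : 'I_k2) :
  injective (identify_vertex i1 i2).
Proof.
move=> a b; rewrite /identify_vertex.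
case: unliftP => [a' ->|->]; case: unliftP => [b' ->|->] //.
- by move=> /rshift_inj ->.
- by move/eqP; rewrite eq_rlshift.
- by move/eqP; rewrite eq_lrshift.
Qed.

Definition graph_bowtie (k1 k2 : nat) (F1 : sgraph k1) (F2 : sgraph k2)
    (i1 : 'I_k1) (i2 : 'I_k2) : sgraph (k1 + k2.-1) :=
  SGraph
    (@union_rel_sym _ _ _ F1 F2 (@lshift k1 k2.-1) (identify_vertex i1 i2))
    (union_rel_irr F1 F2 (@lshift_inj k1 k2.-1) (@identify_vertex_inj _ _ i1 i2)).

Definition hom_set (k n : nat) (F : sgraph k) (G : sgraph n) :
    {set {ffun 'I_k -> 'I_n}} :=
  [set f : {ffun 'I_k -> 'I_n} | [forall i, forall j, F i j ==> G (f i) (f j)]]%SET.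

Definition graph_density (R : realType) (k n : nat) (F : sgraph k)
    (G : sgraph n) : R :=
  #|hom_set F G|%:R / (n ^ k)%:R.

(* A function on [0,1]^2 is represented by an extension of it to the plane; the
   values off the unit square play no role. *)
Record graph_function (R : realType) (g : R * R -> R) : Prop := {
  graphfun_measurable : measurable_fun [set: R * R] g;
  graphfun_sym : forall x y : R, 0 <= x <= 1 -> 0 <= y <= 1 ->
    g (x, y) = g (y, x);
  graphfun_range : forall x y : R, 0 <= x <= 1 -> 0 <= y <= 1 ->
    0 <= g (x, y) <= 1 }.

(* The integral of f over [0,1]^k, as an iterated integral. *)
Fixpoint cube_integral (R : realType) (k : nat) : (k.-tuple R -> R) -> R :=
  match k return (k.-tuple R -> R) -> R with
  | 0 => fun f => f [tuple]
  | k'.+1 => fun f => \int[lebesgue_measure]_(x in `[0%R, 1%R])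
      cube_integral (fun v : k'.-tuple R => f [tuple of x :: v])
  end.

Definition graphon_density (R : realType) (k : nat) (F : sgraph k)
    (g : R * R -> R) : R :=
  cube_integral (fun x : k.-tuple R =>
    \prod_(e : 'I_k * 'I_k | (e.1 < e.2)%N && F e.1 e.2)
      g (tnth x e.1, tnth x e.2)).

(* Measurability of the inverse of s is automatic for a Borel bijection. *)
Record measure_preserving_bij (R : realType) (s : R -> R) : Prop := {
  mpb_bij : set_bij `[0, 1] `[0, 1] s;
  mpb_measurable : measurable_fun (`[0, 1] : set R) s;
  mpb_preserving : forall A : set R, measurable A -> A `<=` `[0, 1] ->
    lebesgue_measure (`[0, 1] `&` s @^-1` A) = lebesgue_measure A }.

Definition cut_norm_diff (R : realType) (g1 g2 : R * R -> R) : \bar R :=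
  ereal_sup [set x | exists S T : set R,
    [/\ measurable S, measurable T, S `<=` `[0, 1], T `<=` `[0, 1] &
      x = `| \int[(lebesgue_measure \x lebesgue_measure)%E]_(z in S `*` T)
               (g1 z - g2 z)%:E |%E]].

Definition cut_distance (R : realType) (g1 g2 : R * R -> R) : \bar R :=
  ereal_inf [set x | exists2 s : R -> R, measure_preserving_bij s &
    x = cut_norm_diff (fun z => g1 (s z.1, s z.2)) g2].

(* The graphons represented by g1 and g2 are the same. *)
Definition same_graphon (R : realType) (g1 g2 : R * R -> R) : Prop :=
  cut_distance g1 g2 = 0%E.

Definition singular_graphon (R : realType) (g : R * R -> R) : Prop :=
  forall (k1 k2 : nat) (F1 : sgraph k1) (F2 : sgraph k2),
    (0 < k1)%N -> (0 < k2)%N ->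
    graphon_density (graph_disjoint_union F1 F2) g =
    (k1 * k2)%:R^-1 *
      \sum_(i1 < k1) \sum_(i2 < k2) graphon_density (graph_bowtie F1 F2 i1 i2) g.

Definition mutually_independent (d : measure_display) (T : measurableType d)
    (R : realType) (P : probability T R) (I : eqType) (X : I -> {RV P >-> R}) :
    Prop :=
  forall (s : seq I) (A : I -> set R), uniq s ->
    (forall i, measurable (A i)) ->
    P (\bigcap_(i in [set` s]) (X i @^-1` A i)) =
    (\prod_(i <- s) fine (P (X i @^-1` A i)))%:E.

Definition is_uniform01 (d : measure_display) (T : measurableType d)
    (R : realType) (P : probability T R) (X : {RV P >-> R}) : Prop :=
  forall A : set R, measurable A ->
    distribution P X A = uniform_prob (@ltr01 R) A.

(* Only the U i j with i < j are constrained. *)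
Definition iid_uniform01 (d : measure_display) (T : measurableType d)
    (R : realType) (P : probability T R)
    (X : nat -> {RV P >-> R}) (U : nat -> nat -> {RV P >-> R}) : Prop :=
  let W (k : nat + {ij : nat * nat | (ij.1 < ij.2)%N}) : {RV P >-> R} :=
    match k with inl i => X i | inr ij => U (val ij).1 (val ij).2 end in
  mutually_independent W /\ (forall k, is_uniform01 (W k)).

Section W_random_graph.
Variables (R : realType) (T : Type) (g : R * R -> R).
Variables (X : nat -> T -> R) (U : nat -> nat -> T -> R).

Definition W_random_rel (n : nat) (w : T) : rel 'I_n := fun i j =>
  (i != j) &&
  (U (minn i j) (maxn i j) w <= g (X (minn i j) w, X (maxn i j) w)).

Lemma W_random_sym (n : nat) (w : T) : symmetric (@W_random_rel n w).
Proof. by move=> i j; rewrite /W_random_rel eq_sym minnC maxnC. Qed.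

Lemma W_random_irr (n : nat) (w : T) : irreflexive (@W_random_rel n w).
Proof. by move=> i; rewrite /W_random_rel eqxx. Qed.

Definition W_random_graph (n : nat) (w : T) : sgraph n :=
  SGraph (@W_random_sym n w) (@W_random_irr n w).

End W_random_graph.

Definition edge_fluctuation (d : measure_display) (T : measurableType d)
    (R : realType) (P : probability T R) (g : R * R -> R)
    (X : nat -> {RV P >-> R}) (U : nat -> nat -> {RV P >-> R})
    (n : nat) : T -> R :=
  let t w : R := graph_density R K2 (W_random_graph g X U n w) in
  fun w => n%:R * (t w - fine ('E_P[t])%E).

Definition cvg_in_distribution (d d' : measure_display)
    (T : measurableType d) (T' : measurableType d') (R : realType)
    (P : probability T R) (P' : probability T' R)
    (Y_ : nat -> T -> R) (Y : T' -> R) : Prop :=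
  forall f : R -> R, continuous f -> bounded_fun f ->
    ('E_P[f \o Y_ n] @[n --> \oo] --> 'E_P'[f \o Y])%E.

(* normal_prob m 0 is not the Dirac mass, whence the separate degenerate case. *)
Definition is_gaussian (d : measure_display) (T : measurableType d)
    (R : realType) (P : probability T R) (Y : {RV P >-> R}) : Prop :=
  (exists m : R, forall A : set R, measurable A -> distribution P Y A = \d_m A)
  \/ (exists m s : R, 0 < s /\
       forall A : set R, measurable A -> distribution P Y A = normal_prob m s A).

(* kappa is r! times the coefficient of t^r in the power series expansion of
   log E[exp(tY)] about t = 0; the existence of the expansion is required. *)
Definition has_cumulant (d : measure_display) (T : measurableType d)
    (R : realType) (P : probability T R) (Y : T -> R) (r : nat) (kappa : R) :
    Prop :=
  exists c : nat -> R,
    (\forall t \near (0 : R), ('M_P Y t)%E \is a fin_num /\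
       pseries c t @ \oo --> ln (fine ('M_P Y t))) /\
    kappa = r`!%:R * c r.

(* Main.v *)
Require Import Defs.
From HB Require Import structures.
From mathcomp Require Import all_boot all_order all_algebra.
From mathcomp Require Import all_classical all_reals all_analysis.
From mathcomp Require Import measurable_realfun zify ring lra.

Set Implicit Arguments.
Unset Strict Implicit.
Unset Printing Implicit Defensive.
Import Order.TTheory GRing.Theory Num.Theory.
Import numFieldNormedType.Exports.

(** * Multigraphs without pendant vertices *)

Section edge_lists.
Variable V : eqType.
Implicit Types (e : V * V) (es : seq (V * V)).

Definition touches (v : V) e := (e.1 == v) || (e.2 == v).

Definition endpoints es : seq V := flatten [seq [:: e.1; e.2] | e <- es].

Definition no_pendant es := all (fun v => count (touches v) es != 1) (endpoints es).

Definition loopless es := all (fun e => e.1 != e.2) es.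

Definition same_edge e e' := (e == e') || (e == (e'.2, e'.1)).

Lemma mem_endpoints es v : (v \in endpoints es) = has (touches v) es.
Proof.
rewrite /endpoints; elim: es => //= e es ih.
by rewrite !inE ih /touches (eq_sym v) (eq_sym v) orbA.
Qed.

Lemma size_endpoints es : size (endpoints es) = (size es).*2.
Proof. by elim: es => //= e es /= ->; rewrite doubleS. Qed.

Lemma count_endpoints es v : loopless es ->
  count_mem v (endpoints es) = count (touches v) es.
Proof.
elim: es => //= e es ih /andP[e12 /ih ->]; rewrite addnA /touches; congr (_ + _).
by have [<-|] := eqVneq e.1 v; rewrite //= eq_sym (negbTE e12).
Qed.

Lemma size_undup_double (s : seq V) :
  (forall v, v \in s -> 1 < count_mem v s) -> (size (undup s)).*2 <= size s.
Proof.
move=> h; have -> : size s = \sum_(v <- undup s) count_mem v s.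
  elim: {h}s => [|x s ih]; first by rewrite big_nil.
  rewrite [RHS]/= [size _]/= ih.
  case: ifP => xs.
    rewrite [RHS](bigD1_seq x) ?mem_undup ?undup_uniq//= eqxx.
    rewrite (bigD1_seq x) ?mem_undup ?undup_uniq//= add1n addSn; congr (_ + _).+1.
    by apply: eq_bigr => v /negbTE; rewrite eq_sym => ->.
  rewrite big_cons eqxx (count_memPn (negbT xs)) add1n; congr _.+1.
  rewrite !big_seq; apply: eq_bigr => v; rewrite mem_undup => vs.
  by case: eqP => // xv; rewrite xv vs in xs.
rewrite -mul2n mulnC -sum1_size big_distrl/= !big_seq leq_sum// => v.
by rewrite mem_undup mul1n => /h.
Qed.

(** Counting incidences: without pendant vertices, there are at most as many
vertices as edges. *)
Lemma no_pendant_size es : loopless es -> no_pendant es ->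
  size (undup (endpoints es)) <= size es.
Proof.
move=> l /allP np; rewrite -leq_double -size_endpoints; apply: size_undup_double.
move=> v vs; have := np v vs; rewrite -count_endpoints//.
by rewrite -has_pred1 has_count in vs; lia.
Qed.

End edge_lists.

Section four_edges.

Definition K4_edges : seq (nat * nat) :=
  [:: (0, 1); (0, 2); (0, 3); (1, 2); (1, 3); (2, 3)].

Definition four_cycles : seq (seq (nat * nat)) :=
  [:: [:: (0, 1); (1, 2); (2, 3); (0, 3)]; [:: (0, 1); (1, 3); (2, 3); (0, 2)];
      [:: (0, 2); (1, 2); (1, 3); (0, 3)]].

Definition double_or_cycle (e0 e1 e2 e3 : nat * nat) :=
  [|| (e0 == e1) && (e2 == e3), (e0 == e2) && (e1 == e3), (e0 == e3) && (e1 == e2)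
    | has (perm_eq [:: e0; e1; e2; e3]) four_cycles].

Definition no_pendant_K4 (e0 e1 e2 e3 : nat * nat) :=
  all (fun v => 1 < count (touches v) [:: e0; e1; e2; e3]) [:: 0; 1; 2; 3].

Lemma K4_shapes :
  all (fun e0 => all (fun e1 => all (fun e2 => all (fun e3 =>
    no_pendant_K4 e0 e1 e2 e3 ==> double_or_cycle e0 e1 e2 e3)
  K4_edges) K4_edges) K4_edges) K4_edges.
Proof. by vm_compute. Qed.

Lemma four_edges_shape (V : eqType) (e0 e1 e2 e3 : V * V) :
  let es := [:: e0; e1; e2; e3] in
  loopless es -> no_pendant es -> 3 < size (undup (endpoints es)) ->
  [\/ same_edge e0 e1 /\ same_edge e2 e3, same_edge e0 e2 /\ same_edge e1 e3,
      same_edge e0 e3 /\ same_edge e1 e2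
   | exists a b c e, uniq [:: a; b; c; e] /\
     forall (R : comNzRingType) (F : V -> V -> R), (forall x y, F x y = F y x) ->
       (F e0.1 e0.2 * F e1.1 e1.2 * F e2.1 e2.2 * F e3.1 e3.2 =
       F a b * F b c * F c e * F e a)%R].
Proof.
move=> es les np s3.
have s4 : size (undup (endpoints es)) = 4.
  by apply/eqP; rewrite eqn_leq s3 andbT; exact: (no_pendant_size les np).
set vs := undup _ in s4.
have uvs : uniq vs by exact: undup_uniq.
pose lab (e : V * V) :=
  (minn (index e.1 vs) (index e.2 vs), maxn (index e.1 vs) (index e.2 vs)).
have inV e : e \in es -> (e.1 \in vs) /\ (e.2 \in vs).
  by move=> ees; rewrite !mem_undup !mem_endpoints; split; apply/hasP; exists e => //;
    rewrite /touches eqxx ?orbT.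
have labK e : e \in es -> lab e \in K4_edges.
  move=> ees; have [v1 v2] := inV e ees.
  have /allP/(_ e ees) e12 := les.
  have i1 : index e.1 vs < 4 by rewrite -s4 index_mem.
  have i2 : index e.2 vs < 4 by rewrite -s4 index_mem.
  have : index e.1 vs != index e.2 vs.
    by apply: contra e12 => /eqP ii; rewrite -(nth_index e.1 v1) ii nth_index.
  rewrite /lab; move: (index e.1 vs) (index e.2 vs) i1 i2 => i j.
  by case: i => [|[|[|[|//]]]]; case: j => [|[|[|[|//]]]].
have nthlab e : e \in es -> forall x,
    (e.1, e.2) = (nth x vs (lab e).1, nth x vs (lab e).2) \/
    (e.1, e.2) = (nth x vs (lab e).2, nth x vs (lab e).1).
  move=> ees x; have [v1 v2] := inV e ees; rewrite /lab/=.
  by case: leqP => _; rewrite !nth_index//; [left|right].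
have labI e e' : e \in es -> e' \in es -> lab e = lab e' -> same_edge e e'.
  move=> ees ees' ll; have x : V by exact: e.1.
  have := nthlab e' ees' x; have := nthlab e ees x.
  rewrite ll /same_edge -!surjective_pairing.
  by case: (lab e') => i j /= -[->|->] [->|->]; apply/orP; [left|right|right|left]; apply/eqP.
have touchlab v e x : v < 4 -> e \in es -> touches v (lab e) = touches (nth x vs v) e.
  move=> v4 ees; have [v1 v2] := inV e ees.
  have vnth : nth x vs v \in vs by rewrite mem_nth// s4.
  have iE y : y \in vs -> (index y vs == v) = (y == nth x vs v).
    move=> yvs; apply/eqP/eqP => [<-|->]; first by rewrite nth_index.
    by rewrite index_uniq// s4.
  rewrite /touches -!iE// /lab/=.
  by case: leqP => _; rewrite // orbC.
have np4 : no_pendant_K4 (lab e0) (lab e1) (lab e2) (lab e3).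
  apply/allP => v v4; have {}v4 : v < 4 by move: v v4; do 4 (case=> //).
  have x : V by exact: e0.1.
  have -> : count (touches v) [:: lab e0; lab e1; lab e2; lab e3] =
            count (touches (nth x vs v)) es.
    rewrite -[[:: lab e0; _; _; _]]/(map lab es) count_map.
    by apply: eq_in_count => e ees; rewrite /= (touchlab _ _ x).
  have vin : nth x vs v \in endpoints es by rewrite -mem_undup mem_nth// s4.
  have /allP/(_ _ vin) := np; move: vin; rewrite mem_endpoints has_count; lia.
have es0 : e0 \in es by rewrite inE eqxx.
have es1 : e1 \in es by rewrite !inE eqxx orbT.
have es2 : e2 \in es by rewrite !inE eqxx !orbT.
have es3 : e3 \in es by rewrite !inE eqxx !orbT.
have := K4_shapes.
move=> /allP/(_ _ (labK _ es0))/allP/(_ _ (labK _ es1))/allP/(_ _ (labK _ es2)).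
move=> /allP/(_ _ (labK _ es3))/implyP/(_ np4)/or4P[||| /hasP[cyc ccyc pc]].
- by move=> /andP[/eqP l1 /eqP l2]; apply: Or41; split; exact: labI.
- by move=> /andP[/eqP l1 /eqP l2]; apply: Or42; split; exact: labI.
- by move=> /andP[/eqP l1 /eqP l2]; apply: Or43; split; exact: labI.
apply: Or44; pose nv := nth e0.1 vs.
have prod_lab (R : comNzRingType) (F : V -> V -> R) : (forall x y, F x y = F y x) ->
    (F e0.1 e0.2 * F e1.1 e1.2 * F e2.1 e2.2 * F e3.1 e3.2 =
     \prod_(e <- cyc) F (nv e.1) (nv e.2))%R.
  move=> FC; rewrite -(perm_big _ pc)/= !big_cons big_nil GRing.mulr1 !GRing.mulrA.
  have Fl e : e \in es -> F e.1 e.2 = F (nv (lab e).1) (nv (lab e).2).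
    by move=> ees; have := nthlab e ees e0.1; case: (lab e) => i j /= [] -[-> ->] //; rewrite FC.
  by rewrite -!Fl.
have unv s : uniq s -> all (fun i => i < 4) s -> uniq (map nv s).
  move=> us /allP s4'; rewrite map_inj_in_uniq// => i j si sj /eqP.
  by rewrite nth_uniq ?s4 ?s4'// => /eqP.
move: ccyc; rewrite !inE => /or3P[] /eqP cE.
- exists (nv 0), (nv 1), (nv 2), (nv 3); split; first exact: (unv [:: 0; 1; 2; 3]).
  by move=> R F FC; rewrite prod_lab// cE !big_cons big_nil GRing.mulr1 !GRing.mulrA (FC (nv 3)).
- exists (nv 0), (nv 1), (nv 3), (nv 2); split; first exact: (unv [:: 0; 1; 3; 2]).
  by move=> R F FC; rewrite prod_lab// cE !big_cons big_nil GRing.mulr1 !GRing.mulrA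
    (FC (nv 3)) (FC (nv 2) (nv 0)).
- exists (nv 0), (nv 2), (nv 1), (nv 3); split; first exact: (unv [:: 0; 2; 1; 3]).
  by move=> R F FC; rewrite prod_lab// cE !big_cons big_nil GRing.mulr1 !GRing.mulrA
    (FC (nv 3)) (FC (nv 2) (nv 1)).
Qed.

End four_edges.

Local Open Scope classical_set_scope.
Local Open Scope ring_scope.

(** * Means of bounded measurable functions *)

Section bounded_functions.
Context {d : measure_display} {T : measurableType d} {R : realType}.
Implicit Types f g : T -> R.

Definition bfun f := measurable_fun setT f /\ exists M : R, forall x, `|f x| <= M.

Lemma eq_bfun f g : (forall x, f x = g x) -> bfun f -> bfun g.
Proof. by move=> /funext ->. Qed.

Lemma bfun_cst (c : R) : bfun (fun _ : T => c).
Proof. by split=> //; exists `|c|. Qed.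

Lemma bfunD f g : bfun f -> bfun g -> bfun (fun x => f x + g x).
Proof.
move=> [mf [M fM]] [mg [N gN]]; split; first exact: measurable_funD.
by exists (M + N) => x; rewrite (le_trans (ler_normD _ _))// lerD.
Qed.

Lemma bfunN f : bfun f -> bfun (fun x => - f x).
Proof.
move=> [mf [M fM]]; split; first exact: measurable_funN.
by exists M => x; rewrite normrN.
Qed.

Lemma bfunB f g : bfun f -> bfun g -> bfun (fun x => f x - g x).
Proof. by move=> bf bg; apply: bfunD => //; apply: bfunN. Qed.

Lemma bfunM f g : bfun f -> bfun g -> bfun (fun x => f x * g x).
Proof.
move=> [mf [M fM]] [mg [N gN]]; split; first exact: measurable_funM.
by exists (M * N) => x; rewrite normrM ler_pM.
Qed.

Lemma bfunX f n : bfun f -> bfun (fun x => f x ^+ n).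
Proof.
move=> bf; elim: n => [|n ih]; first exact: bfun_cst.
by apply: eq_bfun (bfunM bf ih) => x; rewrite exprS.
Qed.

Lemma bfun_norm f : bfun f -> bfun (fun x => `|f x|).
Proof.
move=> [mf [M fM]]; split; first exact: measurableT_comp.
by exists M => x; rewrite normr_id.
Qed.

Lemma bfun_sum (I : Type) (s : seq I) (P : pred I) (F : I -> T -> R) :
  (forall i, P i -> bfun (F i)) -> bfun (fun x => \sum_(i <- s | P i) F i x).
Proof.
move=> bF; elim: s => [|i s ih].
  by apply: eq_bfun (bfun_cst _) => x; rewrite big_nil.
have [Pi|Pi] := boolP (P i).
  by apply: eq_bfun (bfunD (bF i Pi) ih) => x; rewrite big_cons Pi.
by apply: eq_bfun ih => x; rewrite big_cons (negbTE Pi).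
Qed.

Lemma bfun_prod (I : Type) (s : seq I) (P : pred I) (F : I -> T -> R) :
  (forall i, P i -> bfun (F i)) -> bfun (fun x => \prod_(i <- s | P i) F i x).
Proof.
move=> bF; elim: s => [|i s ih].
  by apply: eq_bfun (bfun_cst _) => x; rewrite big_nil.
have [Pi|Pi] := boolP (P i).
  by apply: eq_bfun (bfunM (bF i Pi) ih) => x; rewrite big_cons Pi.
by apply: eq_bfun ih => x; rewrite big_cons (negbTE Pi).
Qed.

Lemma bfun_indic (A : set T) : measurable A -> bfun (\1_A : T -> R).
Proof.
by move=> mA; split=> //; exists 1 => x; rewrite indicE ger0_norm// lern1 leq_b1.
Qed.

End bounded_functions.

Lemma bfun_comp {d d' : measure_display} {T : measurableType d}
    {T' : measurableType d'} {R : realType} (f : T' -> R) (h : T -> T') :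
  bfun f -> measurable_fun setT h -> bfun (fun x => f (h x)).
Proof.
move=> [mf [M fM]] mh; split; first exact: measurableT_comp.
by exists M => x.
Qed.

Section mean.
Context {d : measure_display} {T : measurableType d} {R : realType}.
Variable P : probability T R.
Implicit Types f g : T -> R.

Definition mean f : R := \int[P]_x f x.

Lemma bfun_integrable f : bfun f -> P.-integrable setT (EFin \o f).
Proof.
move=> [mf [M fM]]; apply: measurable_bounded_integrable => //.
  by rewrite (le_lt_trans (probability_le1 _ _))// ltry.
by exists M; split=> [|N MN x _ /=]; [exact: num_real|]; rewrite (le_trans (fM x))// ltW.
Qed.

Lemma meanE f : bfun f -> (mean f)%:E = (\int[P]_x (f x)%:E)%E.
Proof.
move=> bf; rewrite /mean /Rintegral fineK//.
exact: (integrable_fin_num measurableT (bfun_integrable bf)).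
Qed.

Lemma expectationE f : bfun f -> 'E_P[f]%E = (mean f)%:E.
Proof. by move=> bf; rewrite meanE// unlock. Qed.

Lemma eq_mean f g : (forall x, f x = g x) -> mean f = mean g.
Proof. by move=> fg; congr mean; apply: funext. Qed.

Lemma meanD f g : bfun f -> bfun g -> mean (fun x => f x + g x) = mean f + mean g.
Proof. by move=> bf bg; rewrite /mean RintegralD//; exact: bfun_integrable. Qed.

Lemma meanB f g : bfun f -> bfun g -> mean (fun x => f x - g x) = mean f - mean g.
Proof. by move=> bf bg; rewrite /mean RintegralB//; exact: bfun_integrable. Qed.

Lemma meanZ (k : R) f : bfun f -> mean (fun x => k * f x) = k * mean f.
Proof. by move=> bf; rewrite /mean RintegralZl//; exact: bfun_integrable. Qed.

Lemma mean_cst (k : R) : mean (fun _ => k) = k.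
Proof.
rewrite /mean Rintegral_cst// [X in _ * fine X](_ : _ = 1%E) ?mulr1//.
exact: probability_setT.
Qed.

Lemma mean_sum (I : Type) (s : seq I) (Q : pred I) (F : I -> T -> R) :
  (forall i, Q i -> bfun (F i)) ->
  mean (fun x => \sum_(i <- s | Q i) F i x) = \sum_(i <- s | Q i) mean (F i).
Proof.
move=> bF; elim: s => [|i s ih].
  rewrite big_nil -[RHS](mean_cst 0); apply: eq_mean => x; exact: big_nil.
rewrite big_cons -ih; have [Qi|Qi] := boolP (Q i).
  rewrite -meanD; [|exact: bF|exact: bfun_sum].
  by apply: eq_mean => x; rewrite big_cons Qi.
by apply: eq_mean => x; rewrite big_cons (negbTE Qi).
Qed.

Lemma le_mean f g : bfun f -> bfun g -> (forall x, f x <= g x) -> mean f <= mean g.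
Proof. by move=> bf bg fg; apply: le_Rintegral => //; exact: bfun_integrable. Qed.

Lemma mean_ge0 f : (forall x, 0 <= f x) -> 0 <= mean f.
Proof. by move=> f0; apply: Rintegral_ge0. Qed.

Lemma le_norm_mean f : bfun f -> `|mean f| <= mean (fun x => `|f x|).
Proof. by move=> bf; apply: le_normr_Rintegral => //; exact: bfun_integrable. Qed.

Lemma norm_mean_le f (M : R) : bfun f -> (forall x, `|f x| <= M) -> `|mean f| <= M.
Proof.
move=> bf fM; rewrite (le_trans (le_norm_mean bf))// -[leRHS](mean_cst M).
by apply: le_mean => //; [exact: bfun_norm|exact: bfun_cst].
Qed.

Lemma mean_indic (A : set T) : measurable A -> mean \1_A = fine (P A).
Proof. by move=> mA; rewrite /mean /Rintegral integral_indic// setIT. Qed.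

(** Statements holding almost surely are expressed by the vanishing of a second
moment, which is stable under multiplication by a bounded function. *)
Lemma mean_sqr0_mul f g : bfun f -> bfun g -> mean (fun x => f x ^+ 2) = 0 ->
  mean (fun x => f x * g x) = 0.
Proof.
move=> bf bg f0.
have bf2 : bfun (fun x => f x ^+ 2) by exact: bfunX.
have bg2 : bfun (fun x => g x ^+ 2) by exact: bfunX.
have bfg : bfun (fun x => f x * g x) by exact: bfunM.
apply/eqP; rewrite -normr_eq0 eq_le normr_ge0 andbT.
apply/ler_addgt0Pl => e e0; rewrite addr0.
pose G := mean (fun x => g x ^+ 2).
have G0 : 0 <= G by apply: mean_ge0 => x; exact: sqr_ge0.
pose c := e / (G + 1).
have c0 : 0 < c by rewrite divr_gt0// ltr_wpDl.
apply: (@le_trans _ _ (mean (fun x => c^-1 * f x ^+ 2 + c * g x ^+ 2))).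
  apply: (le_trans (le_norm_mean bfg)); apply: le_mean.
  - exact: bfun_norm.
  - by apply: bfunD; apply: bfunM => //; exact: bfun_cst.
  move=> x; have hc : c^-1 * f x ^+ 2 + c * g x ^+ 2 - `|f x * g x| =
    c^-1 * ((`|f x| - c * `|g x| / 2) ^+ 2 + 3 / 4 * (c * `|g x|) ^+ 2).
    rewrite normrM -[f x ^+ 2]real_normK ?num_real// -[g x ^+ 2]real_normK ?num_real//.
    by field; rewrite gt_eqF.
  rewrite -subr_ge0 hc; apply: mulr_ge0; first by rewrite invr_ge0 ltW.
  by apply: addr_ge0; [exact: sqr_ge0|apply: mulr_ge0; [lra|exact: sqr_ge0]].
rewrite meanD; [|by apply: bfunM => //; exact: bfun_cst..].
rewrite !meanZ// f0 mulr0 add0r -/G /c -mulrA ger_pMr// mulrC ler_pdivrMr ?ltr_wpDl//.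
by rewrite mul1r lerDl.
Qed.

Lemma mean_ae_eq f g : bfun f -> bfun g -> mean (fun x => (f x - g x) ^+ 2) = 0 ->
  mean f = mean g.
Proof.
move=> bf bg fg0; apply/eqP; rewrite -subr_eq0 -meanB//.
rewrite -[X in _ == X](mean_sqr0_mul (bfunB bf bg) (bfun_cst 1) fg0).
by apply/eqP/eq_mean => x; rewrite mulr1.
Qed.

End mean.

Section fubini.
Context {d1 d2 : measure_display} {T1 : measurableType d1}
  {T2 : measurableType d2} {R : realType}.
Variables (P1 : probability T1 R) (P2 : probability T2 R).
Implicit Type F : T1 * T2 -> R.

Lemma bfun_sectionl F x : bfun F -> bfun (fun y => F (x, y)).
Proof. by move=> bF; apply: bfun_comp bF _; exact: measurable_pair1. Qed.

Lemma bfun_sectionr F y : bfun F -> bfun (fun x => F (x, y)).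
Proof. by move=> bF; apply: bfun_comp bF _; exact: measurable_pair2. Qed.

Lemma bfun_integrable_prod F :
  bfun F -> (P1 \x P2)%E.-integrable setT (EFin \o F).
Proof.
move=> [mf [M fM]]; apply: measurable_bounded_integrable => //.
  by apply: (@le_lt_trans _ _ 1%E); [exact: probability_le1|exact: ltry].
by exists M; split=> [|N MN x _ /=]; [exact: num_real|]; rewrite (le_trans (fM x))// ltW.
Qed.

Lemma bfun_meanl F : bfun F -> bfun (fun x => mean P2 (fun y => F (x, y))).
Proof.
move=> bF; split.
  have := measurable_fubini_F (bfun_integrable_prod bF).
  rewrite (_ : fubini_F _ _ = EFin \o (fun x => mean P2 (fun y => F (x, y)))).
    by move/measurable_EFinP.
  by apply/funext => x /=; rewrite meanE//; exact: bfun_sectionl.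
have [_ [M FM]] := bF; exists M => x; apply: norm_mean_le => //.
exact: bfun_sectionl.
Qed.

Lemma bfun_meanr F : bfun F -> bfun (fun y => mean P1 (fun x => F (x, y))).
Proof.
move=> bF; split.
  have := measurable_fubini_G (bfun_integrable_prod bF).
  rewrite (_ : fubini_G _ _ = EFin \o (fun y => mean P1 (fun x => F (x, y)))).
    by move/measurable_EFinP.
  by apply/funext => y /=; rewrite meanE//; exact: bfun_sectionr.
have [_ [M FM]] := bF; exists M => y; apply: norm_mean_le => //.
exact: bfun_sectionr.
Qed.

Lemma mean_fubini1 F : bfun F ->
  (\int[(P1 \x P2)%E]_z (F z)%:E =
   (mean P1 (fun x => mean P2 (fun y => F (x, y))))%:E)%E.
Proof.
move=> bF; rewrite meanE; last exact: bfun_meanl.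
rewrite -(integral12_prod_meas1 (bfun_integrable_prod bF)).
by apply: eq_integral => x _; rewrite /fubini_F meanE//; exact: bfun_sectionl.
Qed.

Lemma mean_fubini2 F : bfun F ->
  (\int[(P1 \x P2)%E]_z (F z)%:E =
   (mean P2 (fun y => mean P1 (fun x => F (x, y))))%:E)%E.
Proof.
move=> bF; rewrite meanE; last exact: bfun_meanr.
rewrite -(integral21_prod_meas1 (bfun_integrable_prod bF)).
by apply: eq_integral => x _; rewrite /fubini_G meanE//; exact: bfun_sectionr.
Qed.

Lemma mean_swap F : bfun F ->
  mean P1 (fun x => mean P2 (fun y => F (x, y))) =
  mean P2 (fun y => mean P1 (fun x => F (x, y))).
Proof. by move=> bF; apply: EFin_inj; rewrite -mean_fubini1// mean_fubini2. Qed.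

End fubini.

(** * Independence *)

Lemma mean_distribution {d d' : measure_display} {T : measurableType d}
    {T' : measurableType d'} {R : realType} (P : probability T R)
    (phi : {mfun T >-> T'}) (f : T' -> R) : bfun f ->
  mean (distribution P phi) f = mean P (fun w => f (phi w)).
Proof.
move=> bf; apply: EFin_inj; rewrite !meanE//; last exact: bfun_comp.
rewrite integral_distribution//; first by have [mf _] := bf; exact/measurable_EFinP.
exact: (@bfun_integrable _ _ _ _ (fun w => f (phi w)) (bfun_comp bf _)).
Qed.

Lemma mean_independent {d d1 d2 : measure_display} {T : measurableType d}
    {T1 : measurableType d1} {T2 : measurableType d2} {R : realType}
    (P : probability T R) (Q : probability T1 R) (V : T -> T1) (Z : T -> T2)
    (F : T1 * T2 -> R) :
  measurable_fun setT V -> measurable_fun setT Z ->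
  (forall A B, measurable A -> measurable B ->
    P (V @^-1` A `&` Z @^-1` B) = (Q A * P (Z @^-1` B))%E) ->
  bfun F ->
  mean P (fun w => F (V w, Z w)) = mean P (fun w => mean Q (fun v => F (v, Z w))).
Proof.
move=> mV mZ VZ bF.
pose Z' : {mfun T >-> T2} := HB.pack Z (isMeasurableFun.Build _ _ _ _ Z mZ).
have mVZ : measurable_fun setT (fun w => (V w, Z w)) by exact: measurable_fun_pair.
pose VZ' : {mfun T >-> (T1 * T2)%type} :=
  HB.pack (fun w => (V w, Z w)) (isMeasurableFun.Build _ _ _ _ _ mVZ).
have eqd : forall A, measurable A -> (Q \x distribution P Z')%E A = distribution P VZ' A.
  apply: product_measure_unique => A B mA mB; exact: VZ.
rewrite -[RHS](mean_distribution P Z' (bfun_meanr Q (distribution P Z') bF)).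
rewrite -(mean_distribution P VZ' bF) -mean_swap//.
apply: EFin_inj; rewrite meanE// -mean_fubini1//.
by apply: eq_measure_integral => A mA _; exact/esym/eqd.
Qed.

Section integrate_out.
Context {d : measure_display} {T : measurableType d} {R : realType}
  {P : probability T R} {I : eqType}.
Variable W : I -> {RV P >-> R}.
Hypothesis Wind : mutually_independent W.
Variables (Q : probability R R) (k0 : I).
Hypothesis WQ : forall A, measurable A -> distribution P (W k0) A = Q A.

(** Finite intersections of events about the variables other than the one of
index k0; they generate the sigma-algebra of those variables. *)
Definition other_cylinders : set (set T) :=
  [set B | exists (s : seq I) (A : I -> set R), [/\ k0 \notin s, uniq s,
    (forall i, measurable (A i)) & B = \bigcap_(i in [set` s]) (W i @^-1` A i)]].

Definition others := g_sigma_algebraType other_cylinders.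

Lemma other_cylinders_measurable : other_cylinders `<=` measurable.
Proof.
move=> B [s [A [_ _ mA ->]]]; apply: fin_bigcap_measurable => //.
by move=> i _; rewrite -[X in measurable X]setTI; exact: measurable_funPT.
Qed.

Lemma other_cylinders_setI : setI_closed other_cylinders.
Proof.
move=> B1 B2 [s1 [A1 [k1 u1 m1 ->]]] [s2 [A2 [k2 u2 m2 ->]]].
pose A i : set R := (if i \in s1 then A1 i else setT) `&`
                    (if i \in s2 then A2 i else setT).
exists (undup (s1 ++ s2)), A; split.
- by rewrite mem_undup mem_cat negb_or k1.
- exact: undup_uniq.
- by move=> i; apply: measurableI; case: ifP.
apply/seteqP; split=> w /=.
  move=> [h1 h2] i /= _; split => /=.
    by case: ifP => // i1; exact: h1.
  by case: ifP => // i2; exact: h2.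
move=> h; split=> i /= ii.
  have [|] := h i; first by rewrite /= mem_undup mem_cat ii.
  by rewrite ii.
have [|] := h i; first by rewrite /= mem_undup mem_cat ii orbT.
by rewrite ii.
Qed.

Lemma measurable_others_id : measurable_fun setT (id : T -> others).
Proof.
move=> _ B mB; rewrite setTI preimage_id.
by move: B mB; apply: smallest_sub;
  [exact: sigma_algebra_measurable|exact: other_cylinders_measurable].
Qed.

Lemma measurable_others (k : I) : k != k0 ->
  measurable_fun setT (W k : others -> R).
Proof.
move=> kk0 _ A mA; rewrite setTI; apply: sub_gen_smallest.
exists [:: k], (fun _ => A); split => //; first by rewrite inE eq_sym.
apply/seteqP; split=> w /=; first by move=> h i /=; rewrite inE => /eqP ->.
by move=> h; apply: (h k) => /=; rewrite inE.
Qed.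

Lemma others_independent (A B : set _) : measurable A ->
  measurable (B : set others) -> P (W k0 @^-1` A `&` B) = (Q A * P B)%E.
Proof.
move=> mA.
have mWA : measurable (W k0 @^-1` A).
  by rewrite -[X in measurable X]setTI; exact: measurable_funPT.
have PWA : P (W k0 @^-1` A) = Q A by rewrite -WQ.
have PWAfin : P (W k0 @^-1` A) \is a fin_num by exact: fin_num_measure.
have r0 : 0 <= fine (P (W k0 @^-1` A)) by rewrite fine_ge0.
pose m1 := mrestr P mWA.
pose m2 := mscale (NngNum r0) P.
move=> mB.
have m2E C : m2 C = (Q A * P C)%E.
  by rewrite -PWA -[X in (X * _)%E]fineK.
rewrite setIC -m2E; apply: (@g_sigma_algebra_measure_unique _ R T other_cylinders
  other_cylinders_measurable (fun _ => setT) _ _ m1 m2 other_cylinders_setI _ _ B mB).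
- by move=> _; exists [::], (fun _ => setT); split => //; apply/seteqP; split.
- by rewrite bigcup_const//; exists 0%N.
- move=> C [s [E [ks us mE ->]]]; rewrite [RHS]m2E /m1/= /mrestr.
  have := Wind (s := k0 :: s) (A := fun i => if i == k0 then A else E i).
  rewrite /= ks us => /(_ isT); rewrite big_cons eqxx.
  have -> : \bigcap_(i in [set` k0 :: s]) (W i @^-1` (if i == k0 then A else E i)) =
            \bigcap_(i in [set` s]) W i @^-1` E i `&` W k0 @^-1` A.
    apply/seteqP; split=> w /=.
      move=> h; split; last by have := h k0; rewrite /= inE eqxx; exact.
      move=> i /= si; have := h i; rewrite /= inE si orbT => /(_ isT).
      by case: eqP => // ik; move: ks; rewrite -ik si.
    move=> [h1 h2] i /=; case: (eqVneq i k0) => [->//|ik].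
    by rewrite inE (negbTE ik)/=; exact: h1.
  move=> ->; last by move=> i; case: ifP.
  rewrite EFinM fineK// PWA; congr (_ * _)%E.
  have := Wind us mE; move=> ->; congr EFin; rewrite !big_seq.
  apply: eq_bigr => i si; case: eqP => // ik.
  by move: ks; rewrite -ik si.
- by move=> _; apply: (@le_lt_trans _ _ 1%E); [apply: probability_le1; rewrite setTI|exact: ltry].
Qed.

(** The conditional expectation given all the other variables is computed by
integrating the variable of index k0 against its law. *)
Lemma integrate_out (F : R * others -> R) : bfun F ->
  mean P (fun w => F (W k0 w, w)) = mean P (fun w => mean Q (fun v => F (v, w))).
Proof.
move=> bF; apply: (mean_independent (Z := id : T -> others)) => //.
- exact: measurable_others_id.
- by move=> A B mA mB; exact: others_independent.
Qed.

End integrate_out.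

(** * The uniform law *)

Section uniform.
Context {R : realType}.
Implicit Types f g : R -> R.

(** The identity, which only changes the measurable structure that is attached
to the real line. *)
Definition to_R : measurableTypeR R -> R := fun x => x.

Lemma measurable_to_R : measurable_fun setT to_R.
Proof. by move=> _ A mA; rewrite setTI. Qed.

HB.instance Definition _ := isMeasurableFun.Build _ _ _ _ to_R measurable_to_R.

Definition unif : probability R R := distribution (uniform_prob (@ltr01 R)) to_R.

Lemma mean_unif f : bfun f -> mean unif f = \int[lebesgue_measure]_(x in `[0, 1]) f x.
Proof.
move=> bf; rewrite mean_distribution//.
pose u : probability (measurableTypeR R) R := uniform_prob (@ltr01 R).
have {}bf : bfun (f : measurableTypeR R -> R) by exact: bf.
have [mf [M fM]] := bf.
have M0 : 0 <= M by exact: le_trans (fM 0).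
have bM := bfun_cst (T := measurableTypeR R) M.
have bfM := bfunD bf bM.
have ifM : lebesgue_measure.-integrable `[0, 1] (EFin \o f).
  apply: measurable_bounded_integrable => //=.
  - by rewrite lebesgue_measure_itv/= lte_fin ltr01 ltry.
  - exact: measurable_funTS.
  by exists M; split=> [|N MN x _ /=]; [exact: num_real|rewrite (le_trans (fM x))// ltW].
have iM : lebesgue_measure.-integrable `[0, 1] (EFin \o (fun _ : R => M)).
  apply: measurable_bounded_integrable => //=.
  - by rewrite lebesgue_measure_itv/= lte_fin ltr01 ltry.
  by exists `|M|; split=> [|N MN x _ /=]; [exact: num_real|rewrite ltW].
have : mean u (fun x => f x + M) = \int[lebesgue_measure]_(x in `[0, 1]) (f x + M).
  rewrite /mean /Rintegral integral_uniform//=.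
  - by rewrite subr0 invr1 mul1e.
  - by have [m _] := bfM; exact/measurable_EFinP.
  by move=> x; rewrite lee_fin; have := fM x; rewrite ler_norml => /andP[]; lra.
rewrite meanD// mean_cst RintegralD// Rintegral_cst//.
have -> : fine (lebesgue_measure (`[0%R, 1%R]%classic : set R)) = 1.
  by rewrite lebesgue_measure_itv/= lte_fin ltr01/= subr0.
by rewrite mulr1 => /addIr.
Qed.

Lemma eq_mean_unif f g : bfun f -> bfun g ->
  (forall x, 0 <= x <= 1 -> f x = g x) -> mean unif f = mean unif g.
Proof.
move=> bf bg fg; rewrite !mean_unif//; apply: eq_Rintegral => x.
by rewrite inE/= in_itv/=; exact: fg.
Qed.

End uniform.

(** * Integrating out the randomness of a W-random graph *)

Lemma mean_unif_le (R : realType) (c : R) : 0 <= c <= 1 ->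
  mean unif (fun u => (u <= c)%R%:R : R) = c.
Proof.
move=> /andP[c0 c1].
transitivity (mean unif (\1_(`]-oo, c]%classic) : R -> R)).
  by apply: eq_mean => u; rewrite indicE/= mem_setE in_itv.
rewrite mean_indic// /unif/= /distribution /pushforward /uniform_prob/=.
rewrite integral_uniform_pdf (_ : _ `&` _ = `[0, c]%classic); last first.
  apply/seteqP; split=> x /=; rewrite !in_itv/=.
    by move=> [xc /andP[-> _]].
  by move=> /andP[x0 xc]; split => //; rewrite x0 (le_trans xc).
rewrite (eq_integral (cst 1%E)); last first.
  move=> x; rewrite inE/= in_itv/= => /andP[x0 xc].
  by rewrite /uniform_pdf x0 (le_trans xc)//= subr0 invr1.
rewrite integral_cst//= lebesgue_measure_itv/= lte_fin.
move: c0; rewrite le_eqVlt => /predU1P[<-|c0]; first by rewrite ltxx mule0.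
by rewrite c0 oppr0 adde0 mul1e.
Qed.

Section model.
Context {d : measure_display} {T : measurableType d} {R : realType}
  {P : probability T R}.
Variables (g : R * R -> R) (p : R).
Hypothesis mg : measurable_fun setT g.
Hypothesis gC : forall x y, g (x, y) = g (y, x).
Hypothesis g01 : forall z, 0 <= g z <= 1.
Hypothesis greg :
  mean unif (fun x => (mean unif (fun y => g (x, y)) - p) ^+ 2) = 0.
Variables (X : nat -> {RV P >-> R}) (U : nat -> nat -> {RV P >-> R}).
Hypothesis hXU : iid_uniform01 X U.

Notation index := (nat + {ij : nat * nat | (ij.1 < ij.2)%N})%type.

Definition source (k : index) : {RV P >-> R} :=
  match k with inl i => X i | inr ij => U (val ij).1 (val ij).2 end.

(** The index of the variable that decides the edge between i and j; the value
on the diagonal is junk. *)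
Definition edge_index (i j : nat) : index :=
  if insub (minn i j, maxn i j) is Some ij then inr ij else inl 0%N.

Notation without k := (others source k).

Lemma edge_indexE i j : i != j ->
  exists2 h : (minn i j < maxn i j)%N, edge_index i j = inr (exist _ (minn i j, maxn i j) h)
  & True.
Proof.
move=> ij; have h : (minn i j < maxn i j)%N by lia.
by exists h => //; rewrite /edge_index insubT.
Qed.

Lemma source_edge i j : i != j -> source (edge_index i j) = U (minn i j) (maxn i j).
Proof. by move=> /edge_indexE[h -> _]. Qed.

Lemma edge_index_inl i j v : i != j -> edge_index i j != inl v.
Proof. by move=> /edge_indexE[h -> _]. Qed.

Lemma edge_index_neq i j k l : i != j -> k != l ->
  ~~ ((i == k) && (j == l)) -> ~~ ((i == l) && (j == k)) ->
  edge_index i j != edge_index k l.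
Proof.
move=> /edge_indexE[h -> _] /edge_indexE[h' -> _] n1 n2.
apply/eqP => -[]; lia.
Qed.

Lemma source_independent : mutually_independent source.
Proof. by have [] := hXU. Qed.

Lemma source_unif k A : measurable A -> distribution P (source k) A = unif A.
Proof. by have [_] := hXU; move=> /(_ k A). Qed.

Lemma bfun_g : bfun g.
Proof. by split=> //; exists 1 => z; have /andP[g0 g1] := g01 z; rewrite ger0_norm. Qed.

Definition edge (i j : nat) (w : T) : bool :=
  (i != j) && (U (minn i j) (maxn i j) w <= g (X (minn i j) w, X (maxn i j) w)).

Definition xi (i j : nat) (w : T) : R := if i == j then 0 else (edge i j w)%:R - p.

Definition hX (i j : nat) (w : T) : R := g (X i w, X j w) - p.

Lemma edgeC i j : edge i j = edge j i.
Proof. by rewrite /edge eq_sym minnC maxnC. Qed.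

Lemma xiC i j : xi i j = xi j i.
Proof. by rewrite /xi eq_sym edgeC. Qed.

Lemma hXC i j : hX i j = hX j i.
Proof. by apply/funext => w; rewrite /hX gC. Qed.

Lemma g_minmax i j w : g (X (minn i j) w, X (maxn i j) w) = g (X i w, X j w).
Proof. by case: (leqP i j) => // _; rewrite gC. Qed.

Lemma bfun_gX d1 (T1 : measurableType d1) (x y : T1 -> R) :
  measurable_fun setT x -> measurable_fun setT y -> bfun (fun w => g (x w, y w)).
Proof. by move=> mx my; apply: (bfun_comp bfun_g); exact: measurable_fun_pair. Qed.

Lemma bfun_le_gX d1 (T1 : measurableType d1) (u x y : T1 -> R) :
  measurable_fun setT u -> measurable_fun setT x -> measurable_fun setT y ->
  bfun (fun w => (u w <= g (x w, y w))%R%:R : R).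
Proof.
move=> mu mx my.
have mA : measurable [set w | u w <= g (x w, y w)].
  rewrite -[X in measurable X]setTI; apply: (measurable_fun_ler mu) => //.
  by have [] := bfun_gX mx my.
by apply: eq_bfun (bfun_indic mA) => w; rewrite indicE mem_setE.
Qed.

Lemma measurable_sourceT k : measurable_fun setT (source k).
Proof. exact: measurable_funPT. Qed.

Lemma measurable_X_without k i : k != inl i -> measurable_fun setT (X i : without k -> R).
Proof. by move=> ki; apply: (measurable_others (W := source) (k := inl i)); rewrite eq_sym. Qed.

Lemma bfun_hX_without k i j : k != inl i -> k != inl j ->
  bfun (hX i j : without k -> R).
Proof.
by move=> ki kj; apply: bfunB (bfun_cst _); apply: bfun_gX; exact: measurable_X_without.
Qed.

Lemma bfun_hX i j : bfun (hX i j).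
Proof.
by apply: bfunB (bfun_cst _); apply: bfun_gX; exact: measurable_funPT.
Qed.

Lemma bfun_xi_gen d1 (T1 : measurableType d1) i j (s : T1 -> T) :
  (i != j -> measurable_fun setT (fun w => U (minn i j) (maxn i j) (s w))) ->
  measurable_fun setT (fun w => X i (s w)) ->
  measurable_fun setT (fun w => X j (s w)) -> bfun (fun w => xi i j (s w)).
Proof.
move=> mU mi mj; rewrite /xi; have [|ij] := eqVneq i j; first by move=> _; exact: bfun_cst.
apply: bfunB (bfun_cst _).
apply: eq_bfun (bfun_le_gX (mU ij) mi mj) => w.
by rewrite /edge ij/= g_minmax.
Qed.

Lemma bfun_xi_without k i j : (i != j -> k != edge_index i j) ->
  k != inl i -> k != inl j -> bfun (xi i j : without k -> R).
Proof.
move=> kij ki kj; apply: (@bfun_xi_gen _ (without k) i j id).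
- move=> ij; rewrite -source_edge//.
  by apply: (measurable_others (W := source)); rewrite eq_sym kij.
- exact: measurable_X_without.
- exact: measurable_X_without.
Qed.

Lemma bfun_xi i j : bfun (xi i j).
Proof. by apply: (@bfun_xi_gen _ T i j id) => *; exact: measurable_funPT. Qed.

(** Averaging over the uniform variable of an edge, everything else being fixed. *)
Lemma mean_edge i j (F : bool -> T -> R) : i != j ->
  (forall b, bfun (F b : without (edge_index i j) -> R)) ->
  mean P (fun w => F (edge i j w) w) =
  mean P (fun w => g (X i w, X j w) * F true w + (1 - g (X i w, X j w)) * F false w).
Proof.
move=> ij bF; set k := edge_index i j.
have ki : k != inl i by exact: edge_index_inl.
have kj : k != inl j by exact: edge_index_inl.
pose G (z : R * without k) : R :=
  (z.1 <= g (X i z.2, X j z.2))%R%:R * (F true z.2 - F false z.2) + F false z.2.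
have bFb b : bfun (fun z : R * without k => F b z.2).
  exact: (bfun_comp (bF b) measurable_snd).
have bG : bfun G.
  apply: bfunD => //; apply: bfunM; last exact: bfunB.
  apply: bfun_le_gX; first exact: measurable_fst.
    by apply: (measurableT_comp (measurable_X_without ki)); exact: measurable_snd.
  by apply: (measurableT_comp (measurable_X_without kj)); exact: measurable_snd.
transitivity (mean P (fun w => G (source k w, w))).
  apply: eq_mean => w; rewrite /G/= /edge ij/= g_minmax source_edge//.
  by case: (_ <= _); rewrite /= ?mul1r ?mul0r ?subrK ?add0r.
rewrite (integrate_out source_independent (Q := unif) (@source_unif k) bG).
apply: eq_mean => w; rewrite /G/=.
have ble (c : R) : bfun (fun v : R => (v <= c)%R%:R : R).
  by apply: eq_bfun (bfun_indic (measurable_itv `]-oo, c])) => v;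
    rewrite indicE mem_setE in_itv.
rewrite meanD; [|by apply: bfunM (bfun_cst _)|exact: bfun_cst].
rewrite mean_cst; under eq_mean do rewrite mulrC.
rewrite meanZ// mean_unif_le//; ring.
Qed.

Lemma bfun_without k (Z : without k -> R) : bfun Z -> bfun (Z : T -> R).
Proof. by move=> bZ; apply: (bfun_comp bZ); exact: measurable_others_id. Qed.

(** Averaging over the position of a vertex. *)
Lemma mean_vertex v (F : R * without (inl v) -> R) : bfun F ->
  mean P (fun w => F (X v w, w)) = mean P (fun w => mean unif (fun x => F (x, w))).
Proof.
exact: (integrate_out source_independent (Q := unif) (@source_unif (inl v))).
Qed.

Lemma mean_source k (f : R -> R) : bfun f ->
  mean P (fun w => f (source k w)) = mean unif f.
Proof.
move=> bf; rewrite -(mean_distribution P (source k) bf).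
apply: EFin_inj; rewrite !meanE//.
by apply: eq_measure_integral => A mA _; exact: source_unif.
Qed.

(** Regularity makes the centred kernel integrate to zero in each variable, so a
pendant vertex kills the expectation. *)
Lemma mean_hX_pendant a v (Z : without (inl v) -> R) : a != v -> bfun Z ->
  mean P (fun w => hX a v w * Z w) = 0.
Proof.
move=> av bZ.
have va : inl v != inl a :> index by apply/eqP => -[va]; rewrite va eqxx in av.
have mX := measurable_X_without va.
have bF : bfun (fun z : R * without (inl v) => (g (X a z.2, z.1) - p) * Z z.2).
  apply: bfunM; last exact: (bfun_comp bZ measurable_snd).
  apply: bfunB (bfun_cst _); apply: bfun_gX; last exact: measurable_fst.
  by apply: (measurableT_comp mX); exact: measurable_snd.
rewrite (mean_vertex bF).
have bD : bfun (fun x => mean unif (fun y => g (x, y)) - p).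
  by apply: bfunB (bfun_cst _); exact: (bfun_meanl unif unif bfun_g).
have bgx x : bfun (fun y => g (x, y)) by exact: bfun_sectionl bfun_g.
rewrite -[RHS](@mean_sqr0_mul _ _ _ P (fun w => mean unif (fun y => g (X a w, y)) - p) Z).
- apply: eq_mean => w /=; under eq_mean do rewrite mulrC.
  rewrite meanZ; last by apply: bfunB (bfun_cst _).
  by rewrite meanB// ?mean_cst; [rewrite mulrC|exact: bfun_cst].
- by apply: (bfun_comp bD); exact: measurable_funPT.
- exact: bfun_without.
by rewrite -greg (mean_source (inl a) (f := fun x => (mean unif (fun y => g (x, y)) - p) ^+ 2))//; exact: bfunX.
Qed.

Lemma mean_xi_mul i j (Z : without (edge_index i j) -> R) : i != j -> bfun Z ->
  mean P (fun w => xi i j w * Z w) = mean P (fun w => hX i j w * Z w).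
Proof.
move=> ij bZ; pose F (b : bool) (w : T) := (b%:R - p) * Z w.
transitivity (mean P (fun w => F (edge i j w) w)).
  by apply: eq_mean => w; rewrite /xi (negbTE ij).
rewrite (mean_edge ij); last by move=> b; apply: bfunM (bfun_cst _) bZ.
by apply: eq_mean => w; rewrite /F /hX/=; ring.
Qed.

Lemma mean_xi2_mul i j (Z : without (edge_index i j) -> R) : i != j -> bfun Z ->
  mean P (fun w => xi i j w ^+ 2 * Z w) =
  p * (1 - p) * mean P Z + (1 - 2 * p) * mean P (fun w => hX i j w * Z w).
Proof.
move=> ij bZ; pose F (b : bool) (w : T) := (b%:R - p) ^+ 2 * Z w.
have bZ' := bfun_without bZ.
transitivity (mean P (fun w => F (edge i j w) w)).
  by apply: eq_mean => w; rewrite /xi (negbTE ij).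
rewrite (mean_edge ij); last by move=> b; apply: bfunM (bfun_cst _) bZ.
rewrite -!meanZ//; last by apply: bfunM bZ'; exact: bfun_hX.
rewrite -meanD.
- by apply: eq_mean => w; rewrite /F /hX/=; ring.
- exact: bfunM (bfun_cst _) bZ'.
- by apply: bfunM (bfun_cst _) _; apply: bfunM bZ'; exact: bfun_hX.
Qed.

Lemma mean_xi_pendant i j (Z : T -> R) : i != j ->
  bfun (Z : without (edge_index i j) -> R) -> bfun (Z : without (inl j) -> R) ->
  mean P (fun w => xi i j w * Z w) = 0.
Proof. by move=> ij bZ bZj; rewrite mean_xi_mul// mean_hX_pendant. Qed.

Lemma mean_xi2_pendant i j (Z : T -> R) : i != j ->
  bfun (Z : without (edge_index i j) -> R) -> bfun (Z : without (inl j) -> R) ->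
  mean P (fun w => xi i j w ^+ 2 * Z w) = p * (1 - p) * mean P Z.
Proof. by move=> ij bZ bZj; rewrite mean_xi2_mul// mean_hX_pendant// mulr0 addr0. Qed.

Lemma mean_xi2 i j : i != j -> mean P (fun w => xi i j w ^+ 2) = p * (1 - p).
Proof.
move=> ij; have := mean_xi2_pendant ij (Z := fun=> 1) (bfun_cst _) (bfun_cst _).
by rewrite mean_cst mulr1 => <-; apply: eq_mean => w; rewrite mulr1.
Qed.

Lemma mean_xi2_xi2 i j k l : uniq [:: i; j; k; l] ->
  mean P (fun w => xi i j w ^+ 2 * xi k l w ^+ 2) = (p * (1 - p)) ^+ 2.
Proof.
rewrite /= !inE !negb_or -!andbA => /and5P[ij ik il jk /and3P[jl kl _]].
rewrite mean_xi2_pendant//; first by rewrite mean_xi2// expr2.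
- apply: bfunX; apply: bfun_xi_without => [_||]; last 2 first.
  + exact: edge_index_inl.
  + exact: edge_index_inl.
  by apply: edge_index_neq => //; rewrite ?(negbTE ik)// (negbTE il).
- apply: bfunX; apply: bfun_xi_without => [kl'||].
  + by rewrite eq_sym edge_index_inl.
  + by apply/eqP => -[e]; rewrite e eqxx in jk.
  + by apply/eqP => -[e]; rewrite e eqxx in jl.
Qed.

Definition codegree (z : R * R) : R :=
  mean unif (fun y => (g (z.1, y) - p) * (g (z.2, y) - p)).

(** The density of the four-cycle in the centred kernel. *)
Definition C4_density : R :=
  mean unif (fun x => mean unif (fun y => codegree (x, y) ^+ 2)).

Lemma bfun_codegree : bfun codegree.
Proof.
have h : bfun (fun z : (R * R) * R => (g (z.1.1, z.2) - p) * (g (z.1.2, z.2) - p)).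
  by apply: bfunM; apply: bfunB (bfun_cst _); apply: bfun_gX => //;
    apply: measurableT_comp.
exact: (bfun_meanl (unif \x unif)%E unif h).
Qed.

Lemma mean_codegree2 a c : a != c ->
  mean P (fun w => codegree (X a w, X c w) ^+ 2) = C4_density.
Proof.
move=> ac; have ca : inl c != inl a :> index.
  by apply/eqP => -[e]; rewrite e eqxx in ac.
have bc2 : bfun (fun z => codegree z ^+ 2) by exact: bfunX bfun_codegree.
have bF : bfun (fun z : R * without (inl c) => codegree (X a z.2, z.1) ^+ 2).
  apply: (bfun_comp bc2); apply: measurable_fun_pair; last exact: measurable_fst.
  by apply: (measurableT_comp (measurable_X_without ca)); exact: measurable_snd.
rewrite (mean_vertex bF).
by rewrite (mean_source (inl a) (bfun_meanl unif unif bc2)).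
Qed.

Lemma mean_C4 a b c e : uniq [:: a; b; c; e] ->
  mean P (fun w => xi a b w * xi b c w * xi c e w * xi e a w) = C4_density.
Proof.
rewrite /= !inE !negb_or -!andbA => /and5P[ab ac ae bc /and3P[be ce _]].
have ea : e != a by rewrite eq_sym.
have kv i j v : i != j -> edge_index i j != inl v by exact: edge_index_inl.
have vk i j v : i != j -> inl v != edge_index i j by move=> ij; rewrite eq_sym; exact: kv.
have vv i j : i != j -> inl i != inl j :> index by move=> ij; apply/eqP => -[]; lia.
have kk i j k l : i != j -> k != l -> [|| (i != k) && (i != l) | (j != k) && (j != l)] ->
    edge_index i j != edge_index k l.
  by move=> ij kl h; apply: edge_index_neq => //; lia.
have bX k i j : i != j -> k != edge_index i j -> k != inl i -> k != inl j ->
    bfun (xi i j : without k -> R) by move=> *; apply: bfun_xi_without.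
transitivity (mean P (fun w => xi a b w * (xi b c w * xi c e w * xi e a w))).
  by apply: eq_mean => w; ring.
rewrite (@mean_xi_mul a b (fun w => xi b c w * xi c e w * xi e a w)) //; last first.
  apply: bfunM; [apply: bfunM|]; apply: bX; auto; apply: kk => //; lia.
transitivity (mean P (fun w => xi b c w * (hX a b w * xi c e w * xi e a w))).
  by apply: eq_mean => w; ring.
rewrite (@mean_xi_mul b c (fun w => hX a b w * xi c e w * xi e a w)) //; last first.
  apply: bfunM; [apply: bfunM|]; [by apply: bfun_hX_without; auto|..];
    apply: bX; auto; apply: kk => //; lia.
transitivity (mean P (fun w => xi c e w * (hX a b w * hX b c w * xi e a w))).
  by apply: eq_mean => w; ring.
rewrite (@mean_xi_mul c e (fun w => hX a b w * hX b c w * xi e a w)) //; last first.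
  apply: bfunM; [apply: bfunM; by apply: bfun_hX_without; auto|];
    apply: bX; auto; apply: kk => //; lia.
transitivity (mean P (fun w => xi e a w * (hX a b w * hX b c w * hX c e w))).
  by apply: eq_mean => w; ring.
rewrite (@mean_xi_mul e a (fun w => hX a b w * hX b c w * hX c e w)) //; last first.
  by apply: bfunM; [apply: bfunM|]; apply: bfun_hX_without; auto.
have mX k i : k != i -> measurable_fun setT
    (fun z : R * without (inl k) => (X i : without (inl k) -> R) z.2).
  move=> ki; apply: (measurableT_comp (measurable_X_without (vv _ _ ki))).
  exact: measurable_snd.
(* The vertex b, then the vertex e are averaged out. *)
pose F (z : R * without (inl b)) :=
  (g (X a z.2, z.1) - p) * (g (X c z.2, z.1) - p) * (hX c e z.2 * hX e a z.2).
transitivity (mean P (fun w => F (X b w, w))).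
  by apply: eq_mean => w; rewrite /F/= -/(hX a b w) (gC (X c w)) -/(hX b c w); ring.
rewrite mean_vertex; last first.
  apply: bfunM.
    by apply: bfunM; apply: bfunB (bfun_cst _); apply: bfun_gX => //; apply: mX; lia.
  apply: (@bfun_comp _ _ _ _ _ (fun w : without (inl b) => hX c e w * hX e a w)) => //.
  by apply: bfunM; apply: bfun_hX_without; apply: vv; lia.
pose G (z : R * without (inl e)) := codegree (X a z.2, X c z.2) *
  ((g (X a z.2, z.1) - p) * (g (X c z.2, z.1) - p)).
have bgg x y : bfun (fun u => (g (x, u) - p) * (g (y, u) - p)).
  by apply: bfunM; apply: bfunB (bfun_cst _); exact: bfun_sectionl bfun_g.
transitivity (mean P (fun w => G (X e w, w))).
  apply: eq_mean => w; rewrite /F/=; under eq_mean do rewrite mulrC.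
  rewrite meanZ; last exact: bgg.
  by rewrite -/(codegree (X a w, X c w)) /G/= -/(hX c e w) -/(hX a e w) (hXC e a); ring.
rewrite mean_vertex; last first.
  apply: bfunM; last first.
    by apply: bfunM; apply: bfunB (bfun_cst _); apply: bfun_gX => //; apply: mX; lia.
  by apply: (bfun_comp bfun_codegree); apply: measurable_fun_pair; apply: mX; lia.
rewrite -(mean_codegree2 ac); apply: eq_mean => w; rewrite /G/=.
by rewrite meanZ; [rewrite expr2|exact: bgg].
Qed.

Lemma C4_density_ge0 : 0 <= C4_density.
Proof. by apply: mean_ge0 => x; apply: mean_ge0 => y; exact: sqr_ge0. Qed.

End model.

(** * Moments of the centred edge count *)

Lemma card_few_vertices n m r : (0 < n)%N -> (0 < r)%N ->
  (#|[set f : {ffun 'I_m -> 'I_n * 'I_n} | (size (undup (endpoints (codom f))) <= r)%N]%SET|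
   <= (r * r) ^ m * n ^ r)%N.
Proof.
case: n => // n _; case: r => // r _.
pose h (ab : {ffun 'I_r.+1 -> 'I_n.+1} * {ffun 'I_m -> 'I_r.+1 * 'I_r.+1}) :
    {ffun 'I_m -> 'I_n.+1 * 'I_n.+1} :=
  [ffun l => (ab.1 (ab.2 l).1, ab.1 (ab.2 l).2)].
have sub : [set f : {ffun 'I_m -> 'I_n.+1 * 'I_n.+1} |
    (size (undup (endpoints (codom f))) <= r.+1)%N]%SET \subset (h @: [set: _])%SET.
  apply/fintype.subsetP => f; rewrite inE => fr; set vs := undup _ in fr.
  apply/imsetP; exists ([ffun i : 'I_r.+1 => nth ord0 vs i],
    [ffun l => (inord (index (f l).1 vs), inord (index (f l).2 vs))]) => //.
  have vsP x l : touches x (f l) -> x \in vs.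
    move=> xl; rewrite mem_undup mem_endpoints; apply/hasP.
    by exists (f l) => //; exact: codom_f.
  apply/ffunP => l; rewrite !ffunE/=.
  have v1 : (f l).1 \in vs by apply: (vsP _ l); rewrite /touches eqxx.
  have v2 : (f l).2 \in vs by apply: (vsP _ l); rewrite /touches eqxx orbT.
  by rewrite !inordK ?nth_index// -?surjective_pairing//;
    rewrite (leq_trans _ fr)// index_mem.
apply: (leq_trans (subset_leq_card sub)); apply: (leq_trans (leq_imset_card _ _)).
by rewrite cardsT card_prod !card_ffun card_prod !card_ord mulnC.
Qed.

Section moments.
Context {d : measure_display} {T : measurableType d} {R : realType}
  {P : probability T R}.
Variables (g : R * R -> R) (p : R).
Hypothesis mg : measurable_fun setT g.
Hypothesis gC : forall x y, g (x, y) = g (y, x).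
Hypothesis g01 : forall z, 0 <= g z <= 1.
Hypothesis greg :
  mean unif (fun x => (mean unif (fun y => g (x, y)) - p) ^+ 2) = 0.
Hypothesis p01 : 0 <= p <= 1.
Variables (X : nat -> {RV P >-> R}) (U : nat -> nat -> {RV P >-> R}).
Hypothesis hXU : iid_uniform01 X U.

Local Notation xi := (xi g p X U).
Local Notation without k := (others (source X U) k).

Definition chi n (e : 'I_n * 'I_n) (w : T) : R :=
  if (e.1 < e.2)%N then xi e.1 e.2 w else 0.

Definition centred_count n (w : T) : R := \sum_(e : 'I_n * 'I_n) chi e w.

Lemma norm_xi i j w : `|xi i j w| <= 1.
Proof.
rewrite /xi; case: ifP => _; first by rewrite normr0.
by move: p01 => /andP[p0 p1]; rewrite ler_norml; case: (edge _ _ _ _ _ _);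
  apply/andP; split; rewrite /=; lra.
Qed.

Lemma norm_chi n (e : 'I_n * 'I_n) w : `|chi e w| <= 1.
Proof. by rewrite /chi; case: ifP => _; [exact: norm_xi|rewrite normr0]. Qed.

Lemma bfun_chi n (e : 'I_n * 'I_n) : bfun (chi e).
Proof.
rewrite /chi; case: (e.1 < e.2)%N; last exact: bfun_cst.
exact: bfun_xi.
Qed.

Lemma bfun_prod_seq d1 (T1 : measurableType d1) (I : eqType) (s : seq I) (F : I -> T1 -> R) :
  (forall i, i \in s -> bfun (F i)) -> bfun (fun x => \prod_(i <- s) F i x).
Proof.
move=> bF; apply: (@eq_bfun _ _ _ (fun x => \prod_(i <- s | i \in s) F i x)).
  by move=> x; rewrite -big_seq.
exact: bfun_prod.
Qed.

Lemma mean_prod_pendant n (es : seq ('I_n * 'I_n)) :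
  ~~ (loopless es && no_pendant es) ->
  mean P (fun w => \prod_(e <- es) chi e w) = 0.
Proof.
have chi0 (e : 'I_n * 'I_n) : ~~ (e.1 < e.2)%N -> e \in es ->
    mean P (fun w => \prod_(e <- es) chi e w) = 0.
  move=> e12 ees; rewrite -[RHS](mean_cst P 0); apply: eq_mean => w.
  by rewrite (big_rem e)//= /chi (negbTE e12) mul0r.
rewrite negb_and => /orP[/allPn[e ees]|/allPn[v]].
  by rewrite negbK => /eqP e12; apply: (chi0 e) => //; rewrite e12 ltnn.
rewrite mem_endpoints => /hasP[e ees ve]; rewrite negbK => /eqP c1.
have [e12|e12] := boolP (e.1 < e.2)%N; last exact: (chi0 e).
pose Z w := \prod_(e' <- rem e es) chi e' w.
have nov e' : e' \in rem e es -> (e'.1 != v) && (e'.2 != v).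
  move=> e'r; rewrite -negb_or; apply/negP => ve'.
  have := c1; rewrite (permP (perm_to_rem ees))/= ve => -[] /eqP.
  by rewrite -leqn0 leqNgt -has_count => /hasPn/(_ e' e'r); rewrite /touches ve'.
have bZ k : (forall e' : 'I_n * 'I_n, (e'.1 != v) && (e'.2 != v) -> (e'.1 < e'.2)%N ->
    [/\ k != edge_index e'.1 e'.2, k != inl (val e'.1) & k != inl (val e'.2)]) ->
    bfun (Z : without k -> R).
  move=> hk; apply: bfun_prod_seq => e' e'r; rewrite /chi.
  have [e'12|_] := boolP (e'.1 < e'.2)%N; last exact: bfun_cst.
  have [k1 k2 k3] := hk e' (nov e' e'r) e'12.
  by apply: bfun_xi_without.
have ne : val e.1 != val e.2 by rewrite neq_ltn e12.
have key (a b : nat) : (a != b) -> xi e.1 e.2 = xi a b -> (b = v) ->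
    edge_index e.1 e.2 = edge_index a b ->
    mean P (fun w => \prod_(e <- es) chi e w) = 0.
  move=> ab xe bv ee.
  transitivity (mean P (fun w => xi a b w * Z w)).
    by apply: eq_mean => w; rewrite (big_rem e)//= /chi e12 xe.
  apply: mean_xi_pendant => //.
    rewrite -ee; apply: bZ => e' /andP[v1 v2] e'12; split;
      [apply: edge_index_neq|exact: edge_index_inl|exact: edge_index_inl] => //;
      move: ve v1 v2; rewrite /touches -!val_eqE/=; lia.
  apply: bZ => e' /andP[]; rewrite -!val_eqE/= => v1 v2 e'12; split.
  - by rewrite eq_sym; apply: edge_index_inl; lia.
  - by apply/eqP => -[]; lia.
  - by apply/eqP => -[]; lia.
move: (ve) => /orP[] /eqP ev.
  apply: (key e.2 e.1) => //; first by rewrite eq_sym.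
  - exact: xiC.
  - by rewrite ev.
  - by rewrite /edge_index minnC maxnC.
by apply: (key e.1 e.2) => //; rewrite ev.
Qed.

Lemma centred_countX n m w :
  centred_count n w ^+ m =
  \sum_(f : {ffun 'I_m -> 'I_n * 'I_n}) \prod_(e <- codom f) chi e w.
Proof.
rewrite /centred_count -[in LHS](card_ord m) -prodr_const bigA_distr_bigA/=.
by apply: eq_bigr => f _; rewrite /codom /image_mem big_map big_enum.
Qed.

Lemma bfun_prod_chi n (es : seq ('I_n * 'I_n)) :
  bfun (fun w => \prod_(e <- es) chi e w).
Proof. by apply: bfun_prod => e _; exact: bfun_chi. Qed.

Lemma bfun_centred_count n : bfun (@centred_count n).
Proof. by apply: bfun_sum => e _; exact: bfun_chi. Qed.

Lemma norm_mean_prod_chi n (es : seq ('I_n * 'I_n)) :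
  `|mean P (fun w => \prod_(e <- es) chi e w)| <= 1.
Proof.
apply: norm_mean_le; first exact: bfun_prod_chi.
move=> w; rewrite normr_prod; apply: prodr_ile1 => e _.
by rewrite normr_ge0 norm_chi.
Qed.

Lemma mean_centred_countX n m :
  mean P (fun w => centred_count n w ^+ m) =
  \sum_(f : {ffun 'I_m -> 'I_n * 'I_n}) mean P (fun w => \prod_(e <- codom f) chi e w).
Proof.
rewrite -mean_sum; first by apply: eq_mean => w; exact: centred_countX.
by move=> f _; exact: bfun_prod_chi.
Qed.

(** Only the m-tuples of edges that span at most m vertices contribute. *)
Lemma norm_moment_le n m : (0 < n)%N -> (0 < m)%N ->
  `|mean P (fun w => centred_count n w ^+ m)| <= ((m * m) ^ m * n ^ m)%:R.
Proof.
move=> n0 m0; rewrite mean_centred_countX.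
apply: (le_trans (ler_norm_sum _ _ _)).
pose A := [set f : {ffun 'I_m -> 'I_n * 'I_n} |
  (size (undup (endpoints (codom f))) <= m)%N]%SET.
apply: (@le_trans _ _ (\sum_(f in A) 1)); last first.
  by rewrite sumr_const ler_nat; exact: card_few_vertices.
rewrite [leRHS]big_mkcond/=; apply: ler_sum => f _; case: ifPn => [_|].
  exact: norm_mean_prod_chi.
rewrite inE => fA; rewrite mean_prod_pendant ?normr0//.
apply: contra fA => /andP[lf nf]; rewrite (leq_trans (no_pendant_size lf nf))//.
by rewrite size_map -cardE card_ord.
Qed.

Definition ordered_pairs n := [set e : 'I_n * 'I_n | (e.1 < e.2)%N]%SET.

Lemma card_ordered_pairs n : (2 * #|ordered_pairs n| + n = n * n)%N.
Proof.
have -> : (n * n = #|[set: 'I_n * 'I_n]%SET|)%N by rewrite cardsT card_prod card_ord.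
pose D := [set e : 'I_n * 'I_n | e.1 == e.2]%SET.
have cD : #|D| = n.
  rewrite -[RHS](card_ord n) -(card_imset _ (f := fun i : 'I_n => (i, i))); last by move=> i j [].
  apply: eq_card => -[i j]; rewrite inE/=; apply/eqP/imsetP => [->|[k _ [-> ->]]//].
  by exists j.
pose B := [set e : 'I_n * 'I_n | (e.2 < e.1)%N]%SET.
have cB : #|B| = #|ordered_pairs n|.
  rewrite -(card_imset (ordered_pairs n) (f := fun e => (e.2, e.1))); last first.
    by move=> [i j] [k l] [-> ->].
  apply: eq_card => -[i j]; rewrite inE/=; apply/idP/imsetP => [ij|[[k l]] ].
    by exists (j, i) => //; rewrite inE.
  by rewrite inE => kl [-> ->].
have -> : [set: 'I_n * 'I_n]%SET = (ordered_pairs n :|: (B :|: D))%SET.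
  by apply/setP => -[i j]; rewrite !inE/= -val_eqE/=; case: ltngtP.
rewrite !cardsU cB cD.
have -> : (B :&: D = finset.set0)%SET.
  by apply/setP => -[i j]; rewrite !inE/= -val_eqE/=; case: ltngtP.
have -> : (ordered_pairs n :&: (B :|: D) = finset.set0)%SET.
  by apply/setP => -[i j]; rewrite !inE/= -val_eqE/=; case: ltngtP.
by rewrite cards0 !subn0 mul2n -addnn addnA.
Qed.

Lemma mean_centred_count n : mean P (@centred_count n) = 0.
Proof.
rewrite mean_sum; last by move=> e _; exact: bfun_chi.
rewrite big1// => e _; rewrite -[RHS](@mean_prod_pendant n [:: e]).
  by apply: eq_mean => w; rewrite big_seq1.
by apply/negP => /andP[l /(no_pendant_size l)]; move: l; rewrite /= andbT inE => /negbTE ->.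
Qed.

Lemma mean_centred_count2 n :
  mean P (fun w => centred_count n w ^+ 2) = #|ordered_pairs n|%:R * (p * (1 - p)).
Proof.
have -> : mean P (fun w => centred_count n w ^+ 2) =
    \sum_(e : 'I_n * 'I_n) \sum_(e' : 'I_n * 'I_n) mean P (fun w => chi e w * chi e' w).
  have bcc (e e' : 'I_n * 'I_n) : bfun (fun w => chi e w * chi e' w).
    by apply: bfunM; exact: bfun_chi.
  transitivity (mean P (fun w => \sum_(e : 'I_n * 'I_n) \sum_(e' : 'I_n * 'I_n) chi e w * chi e' w)).
    by apply: eq_mean => w; rewrite expr2 /centred_count big_distrlr.
  rewrite mean_sum; last by move=> e _; apply: bfun_sum.
  by apply: eq_bigr => e _; rewrite mean_sum.
rewrite -sum1_card natr_sum mulr_suml [RHS]big_mkcond/=; apply: eq_bigr => e _.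
rewrite inE; have [e12|e12] := boolP (e.1 < e.2)%N; last first.
  rewrite big1// => e' _; rewrite -[RHS](mean_cst P 0); apply: eq_mean => w.
  by rewrite /chi (negbTE e12) mul0r.
rewrite mul1r (bigD1 e)//= big1 ?addr0.
  rewrite -(@mean_xi2 _ _ _ P g p mg gC g01 greg X U hXU e.1 e.2) ?neq_ltn ?e12//.
  by apply: eq_mean => w; rewrite /chi e12.
move=> e' ee'; have [e'12|e'12] := boolP (e'.1 < e'.2)%N; last first.
  rewrite -[RHS](mean_cst P 0); apply: eq_mean => w.
  by rewrite /chi (negbTE e'12) mulr0.
rewrite -[RHS](@mean_prod_pendant n [:: e; e']).
  by apply: eq_mean => w; rewrite big_cons big_seq1.
apply/negP => /andP[l /(no_pendant_size l)] /= s2.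
have eV x : x \in [:: e'.1; e'.2] -> x \in [:: e.1; e.2].
  move=> xe'; apply/negPn/negP => xe.
  have /uniq_leq_size : uniq [:: x; e.1; e.2].
    by rewrite /= xe inE/= andbT neq_ltn e12.
  move=> /(_ (undup (endpoints [:: e; e']))) H.
  have : (3 <= size (undup (endpoints [:: e; e'])))%N.
    apply: H => y; rewrite mem_undup /endpoints/= !inE in xe' *.
    by case/or3P => /eqP ->; rewrite ?eqxx ?orbT//; case/orP: xe' => ->; rewrite ?orbT.
  by rewrite leqNgt ltnS => /negP; apply.
move: ee'; have := eV e'.1; have := eV e'.2; rewrite !inE !eqxx orbT/=.
move=> /(_ isT) h2 /(_ isT) h1; rewrite -pair_eqE /pair_eq -!val_eqE/= => ee'.
by move: h1 h2; rewrite -!val_eqE/=; lia.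
Qed.

End moments.

Section fourth_moment.
Context {d : measure_display} {T : measurableType d} {R : realType}
  {P : probability T R}.
Variables (g : R * R -> R) (p : R).
Hypothesis mg : measurable_fun setT g.
Hypothesis gC : forall x y, g (x, y) = g (y, x).
Hypothesis g01 : forall z, 0 <= g z <= 1.
Hypothesis greg :
  mean unif (fun x => (mean unif (fun y => g (x, y)) - p) ^+ 2) = 0.
Hypothesis p01 : 0 <= p <= 1.
Variables (X : nat -> {RV P >-> R}) (U : nat -> nat -> {RV P >-> R}).
Hypothesis hXU : iid_uniform01 X U.

Local Notation xi := (xi g p X U).
Local Notation without k := (others (source X U) k).

Local Notation mean_prod_pendant := (mean_prod_pendant mg gC g01 greg p01 hXU).
Local Notation chi := (chi g p X U).
Local Notation bfun_prod_chi := (bfun_prod_chi p mg gC g01 X U).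
Local Notation norm_mean_prod_chi := (norm_mean_prod_chi mg gC g01 p01 X U).
Local Notation centred_count := (centred_count g p X U).

Lemma norm_C4_density : `|C4_density g p| <= 1.
Proof.
have bc2 := bfunX 2 (bfun_codegree p mg g01).
have h1 z : `|g z - p| <= 1.
  by move: (g01 z) p01 => /andP[? ?] /andP[? ?]; rewrite ler_norml; apply/andP; split; lra.
have bg x : bfun (fun y => g (x, y) - p).
  by apply: bfunB (bfun_cst _); exact: bfun_sectionl (bfun_g mg g01).
have h2 z : `|codegree g p z| <= 1.
  apply: norm_mean_le => [|y]; first exact: bfunM.
  by rewrite normrM mulr_ile1.
apply: norm_mean_le; first exact: (bfun_meanl unif unif bc2).
move=> x; apply: norm_mean_le => [|y]; first exact: (bfun_sectionl x bc2).
by rewrite normrX exprn_ile1.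
Qed.

Lemma mean_double_edges n (a b : 'I_n * 'I_n) : (a.1 < a.2)%N -> (b.1 < b.2)%N ->
  uniq [:: a.1; a.2; b.1; b.2] ->
  mean P (fun w => chi a w ^+ 2 * chi b w ^+ 2) = (p * (1 - p)) ^+ 2.
Proof.
move=> a12 b12 u.
rewrite -(@mean_xi2_xi2 _ _ _ P g p mg gC g01 greg X U hXU a.1 a.2 b.1 b.2).
  by apply: eq_mean => w; rewrite /chi a12 b12.
by rewrite -(map_inj_uniq val_inj) in u.
Qed.

Lemma mean_cycle n (a b c e : 'I_n) :
  uniq [:: a; b; c; e] ->
  mean P (fun w => xi a b w * xi b c w * xi c e w * xi e a w) = C4_density g p.
Proof.
by move=> u; apply: mean_C4 => //; rewrite -(map_inj_uniq val_inj) in u.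
Qed.

(** Four edges that run once around a four-cycle whose vertices lie in four
prescribed consecutive blocks of q vertices. *)
Definition block_cycle n q (e0 e1 e2 e3 : 'I_n * 'I_n) : bool :=
  [&& (e0.1 < q)%N, (q <= e0.2 < 2 * q)%N, (e1.1 == e0.2 :> nat),
      (2 * q <= e1.2 < 3 * q)%N, (e2.1 == e1.2 :> nat), (3 * q <= e2.2)%N,
      (e3.1 == e0.1 :> nat) & (e3.2 == e2.2 :> nat)].

Definition doubled n (a b c e : 'I_n * 'I_n) : bool :=
  [&& a == b, c == e, (a.1 < a.2)%N & (c.1 < c.2)%N].

Lemma fourth_moment_pointwise n q (e0 e1 e2 e3 : 'I_n * 'I_n) :
  (p * (1 - p)) ^+ 2 *
    ((doubled e0 e1 e2 e3)%:R + (doubled e0 e2 e1 e3)%:R + (doubled e0 e3 e1 e2)%:R) +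
  C4_density g p * (block_cycle q e0 e1 e2 e3)%:R -
  5 * (size (undup (endpoints [:: e0; e1; e2; e3])) <= 3)%N%:R <=
  mean P (fun w => \prod_(e <- [:: e0; e1; e2; e3]) chi e w).
Proof.
set es := [:: e0; e1; e2; e3].
have C0 : 0 <= C4_density g p by exact: C4_density_ge0.
have C1 : C4_density g p <= 1 by exact: le_trans (ler_norm _) norm_C4_density.
have pq0 : 0 <= (p * (1 - p)) ^+ 2 by exact: sqr_ge0.
have pq1 : (p * (1 - p)) ^+ 2 <= 1.
  move: p01 => /andP[p0 p1]; rewrite exprn_ile1 ?mulr_ile1 ?mulr_ge0//; lra.
have [few|many] := leqP (size (undup (endpoints es))) 3.
  have := norm_mean_prod_chi es; rewrite ler_norml => /andP[m1 _].
  apply: le_trans m1; rewrite mulr1.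
  have d01 (b : bool) : 0 <= (b%:R : R) <= 1 by rewrite ler0n lern1 leq_b1.
  have := d01 (doubled e0 e1 e2 e3); have := d01 (doubled e0 e2 e1 e3).
  have := d01 (doubled e0 e3 e1 e2).
  set x : R := (doubled e0 e1 e2 e3)%:R; set y : R := (doubled e0 e2 e1 e3)%:R.
  set z : R := (doubled e0 e3 e1 e2)%:R.
  move=> /andP[z0 z1] /andP[y0 y1] /andP[x0 x1].
  have : C4_density g p * (block_cycle q e0 e1 e2 e3)%:R <= 1.
    by case: block_cycle; rewrite ?mulr1 ?mulr0 ?ler01.
  have : (p * (1 - p)) ^+ 2 * (x + y + z) <= 3 by nra.
  lra.
rewrite mulr0 subr0.
(* On at least four vertices, two double edges are disjoint. *)
have disj a b c e : perm_eq [:: a; b; c; e] es -> a = b -> c = e ->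
    uniq [:: a.1; a.2; c.1; c.2].
  move=> pe ab ce; apply: leq_size_uniq (undup_uniq (endpoints es)) _ _ => //.
  move=> x; rewrite mem_undup mem_endpoints -(perm_has _ pe) /= -ab -ce /touches !inE.
  by rewrite orbF !(eq_sym x) !orbA; case: (_ == x); case: (_ == x); case: (_ == x); case: (_ == x).
have double a b c e : perm_eq [:: a; b; c; e] es ->
    [&& a == b, c == e, (a.1 < a.2)%N & (c.1 < c.2)%N] ->
    mean P (fun w => \prod_(e <- es) chi e w) = (p * (1 - p)) ^+ 2.
  move=> pe /and4P[/eqP ab /eqP ce a12 c12].
  rewrite -(mean_double_edges a12 c12 (disj _ _ _ _ pe ab ce)).
  apply: eq_mean => w; rewrite -(perm_big _ pe)/= !big_cons big_nil -ab -ce; ring.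
have neq a b c e : perm_eq [:: a; b; c; e] es ->
    [&& a == b, c == e, (a.1 < a.2)%N & (c.1 < c.2)%N] -> a != c.
  move=> pe /and4P[/eqP ab /eqP ce _ _]; apply/eqP => ac.
  have := disj _ _ _ _ pe ab ce; rewrite ac /= !inE !eqxx ?orbT.
  by [].
have p1 : perm_eq [:: e0; e1; e2; e3] es by [].
have p2 : perm_eq [:: e0; e2; e1; e3] es.
  by rewrite /es perm_cons -cat1s -[[:: e1; e2; e3]]/([:: e1; e2] ++ [:: e3])
    -[_ ++ [:: e1; e3]]/([:: e2; e1] ++ [:: e3]) perm_cat2r (perm_catC [:: e2] [:: e1]).
have p3 : perm_eq [:: e0; e3; e1; e2] es.
  by rewrite /es perm_cons (perm_catC [:: e3] [:: e1; e2]).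
rewrite /doubled.
case D1: [&& e0 == e1, _, _ & _].
  have n1 := neq _ _ _ _ p1 D1; rewrite (double _ _ _ _ p1 D1).
  case/and4P: D1 => /eqP d01 /eqP d23 o0 o2.
  have -> : [&& e0 == e2, e1 == e3, (e0.1 < e0.2)%N & (e1.1 < e1.2)%N] = false.
    by rewrite (negbTE n1).
  have -> : [&& e0 == e3, e1 == e2, (e0.1 < e0.2)%N & (e1.1 < e1.2)%N] = false.
    by rewrite -d01 (negbTE n1) andbF.
  have -> : block_cycle q e0 e1 e2 e3 = false.
    apply/negP => /andP[h1 /andP[h2 /andP[/eqP h3 _]]].
    by move: h1 h2; rewrite -h3 -d01 ltnNge => /negbTE ->.
  by rewrite /= !addr0 mulr1 mulr0 addr0.
case D2: [&& e0 == e2, _, _ & _].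
  have n2 := neq _ _ _ _ p2 D2; rewrite (double _ _ _ _ p2 D2).
  case/and4P: D2 => /eqP d02 /eqP d13 o0 o1.
  have -> : [&& e0 == e3, e1 == e2, (e0.1 < e0.2)%N & (e1.1 < e1.2)%N] = false.
    by rewrite -d13 (negbTE n2).
  have -> : block_cycle q e0 e1 e2 e3 = false.
    apply/negP => /and5P[h1 h2 h3 h4 /andP[/eqP h5 _]].
    by move: h1 h4; rewrite -h5 -d02 => h1 /andP[h4 _]; clear -h1 h4; lia.
  by rewrite /= addr0 add0r mulr1 mulr0 addr0.
case D3: [&& e0 == e3, _, _ & _].
  rewrite (double _ _ _ _ p3 D3).
  case/and4P: D3 => /eqP d03 /eqP d12 o0 o1.
  have -> : block_cycle q e0 e1 e2 e3 = false.
    apply/negP => /and5P[h1 h2 h3 h4 /and4P[_ h6 _ /eqP h8]].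
    by move: h2 h6; rewrite -h8 -d03 => /andP[_ h2] h6; clear -h2 h6; lia.
  by rewrite /= !add0r mulr1 mulr0 addr0.
rewrite /= !addr0 mulr0 add0r.
have [bc|_] := boolP (block_cycle q e0 e1 e2 e3).
  rewrite mulr1; move: bc => /and5P[h1 /andP[h2 h2'] /eqP h3 /andP[h4 h4']].
  move=> /and4P[/eqP h5 h6 /eqP h7 /eqP h8].
  have u : uniq [:: e0.1; e0.2; e1.2; e2.2].
    by rewrite /= !inE -!val_eqE/=; clear -h1 h2 h2' h4 h4' h6; lia.
  have lt01 : (e0.1 < e0.2)%N by clear -h1 h2; lia.
  have lt02 : (e0.2 < e1.2)%N by clear -h2' h4; lia.
  have lt03 : (e1.2 < e2.2)%N by clear -h4' h6; lia.
  have lt04 : (e0.1 < e2.2)%N by clear -h1 h6; lia.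
  rewrite -(mean_cycle u) le_eqVlt; apply/orP; left; apply/eqP/eq_mean => w.
  rewrite /es !big_cons big_nil mulr1 /chi h3 h5 h7 h8 lt01 lt02 lt03 lt04 !mulrA.
  by rewrite (xiC _ _ _ _ e2.2).
rewrite mulr0.
have [/and3P[les nes oes]|nlnp] := boolP [&& loopless es, no_pendant es &
    all (fun e : 'I_n * 'I_n => (e.1 < e.2)%N) es]; last first.
  move: nlnp; rewrite andbA negb_and => /orP[np|]; first by rewrite mean_prod_pendant.
  move=> /allPn[e ees e12]; rewrite -(mean_cst P 0).
  apply: le_mean => [||w]; [exact: bfun_cst|exact: bfun_prod_chi|].
  by rewrite (big_rem e)//= /chi (negbTE e12) mul0r.
have ord e : e \in es -> (e.1 < e.2)%N by move=> ees; exact: (allP oes).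
have sameE e e' : e \in es -> e' \in es -> same_edge e e' -> e = e'.
  move=> /ord o /ord o' /orP[/eqP//|/eqP ee]; move: o o'; rewrite ee/= => o o'; clear -o o'; lia.
have i0 : e0 \in es by rewrite inE eqxx.
have i1 : e1 \in es by rewrite !inE eqxx orbT.
have i2 : e2 \in es by rewrite !inE eqxx !orbT.
have i3 : e3 \in es by rewrite !inE eqxx !orbT.
have o0 := ord _ i0; have o1 := ord _ i1; have o2 := ord _ i2; have o3 := ord _ i3.
have [[s s']|[s s']|[s s']|[a [b [c [e [u F]]]]]] := four_edges_shape les nes many.
- by move: D1; rewrite (sameE _ _ i0 i1 s) (sameE _ _ i2 i3 s') !eqxx o1 o3.
- by move: D2; rewrite (sameE _ _ i0 i2 s) (sameE _ _ i1 i3 s') !eqxx o2 o3.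
- by move: D3; rewrite (sameE _ _ i0 i3 s) (sameE _ _ i1 i2 s') !eqxx o3 o2.
apply: (le_trans C0); rewrite -(mean_cycle u) le_eqVlt; apply/orP; left.
apply/eqP/eq_mean => w.
rewrite /es !big_cons big_nil mulr1 /chi o0 o1 o2 o3 !mulrA.
by apply/esym/(F _ (fun x y : 'I_n => xi x y w)) => x y; rewrite xiC.
Qed.

Definition quadruple n (e0 e1 e2 e3 : 'I_n * 'I_n) : {ffun 'I_4 -> 'I_n * 'I_n} :=
  [ffun l : 'I_4 => nth e0 [:: e0; e1; e2; e3] l].

Lemma codom_quadruple n (f : {ffun 'I_4 -> 'I_n * 'I_n}) :
  codom f = [:: f (inord 0); f (inord 1); f (inord 2); f (inord 3)].
Proof.
rewrite /codom /image_mem/= enum_ordSl/= !enum_ordSl/= enum_ord0/=.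
by do !(congr (f _ :: _); first by apply: val_inj; rewrite /= inordK).
Qed.

Lemma quadrupleE n (e0 e1 e2 e3 : 'I_n * 'I_n) :
  [/\ quadruple e0 e1 e2 e3 (inord 0) = e0, quadruple e0 e1 e2 e3 (inord 1) = e1,
      quadruple e0 e1 e2 e3 (inord 2) = e2 & quadruple e0 e1 e2 e3 (inord 3) = e3].
Proof. by rewrite !ffunE !inordK. Qed.

Definition quad_pred n (Q : 'I_n * 'I_n -> 'I_n * 'I_n -> 'I_n * 'I_n -> 'I_n * 'I_n -> bool) :=
  [set f : {ffun 'I_4 -> 'I_n * 'I_n} |
     Q (f (inord 0)) (f (inord 1)) (f (inord 2)) (f (inord 3))]%SET.

Lemma card_doubled n (s : 'I_n * 'I_n -> 'I_n * 'I_n -> {ffun 'I_4 -> 'I_n * 'I_n})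
    (Q : 'I_n * 'I_n -> 'I_n * 'I_n -> 'I_n * 'I_n -> 'I_n * 'I_n -> bool) :
  (forall a b c e, s a b = s c e -> a = c /\ b = e) ->
  (forall a b : 'I_n * 'I_n, (a.1 < a.2)%N -> (b.1 < b.2)%N -> s a b \in quad_pred Q) ->
  (#|ordered_pairs n| * #|ordered_pairs n| <= #|quad_pred Q|)%N.
Proof.
move=> si sQ; rewrite -cardsX.
rewrite -(card_imset _ (f := fun z => s z.1 z.2)); last first.
  by move=> [a b] [c e] /si [/= -> ->].
apply/subset_leq_card/fintype.subsetP => f /imsetP[[a b]].
by rewrite !inE/= => /andP[a12 b12] ->; have := sQ a b a12 b12; rewrite inE.
Qed.

Lemma card_block_cycle q :
  (q ^ 4 <= #|quad_pred (@block_cycle (4 * q) q)|)%N.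
Proof.
pose v k (i : 'I_q) : nat := (k * q + i)%N.
have vlt k (i : 'I_q) : (k < 4)%N -> (v k i < 4 * q)%N.
  by move=> k4; rewrite /v; have := ltn_ord i; nia.
pose V k (k4 : (k < 4)%N) i : 'I_(4 * q) := Ordinal (vlt k i k4).
pose s (z : ('I_q * 'I_q) * ('I_q * 'I_q)) :=
  let i := V 0 isT z.1.1 in let j := V 1 isT z.1.2 in
  let k := V 2 isT z.2.1 in let l := V 3 isT z.2.2 in
  quadruple (i, j) (j, k) (k, l) (i, l).
have si : injective s.
  move=> [[i j] [k l]] [[i' j'] [k' l']] /ffunP ss.
  have := ss (inord 0); have := ss (inord 2); rewrite !ffunE !inordK//=.
  by move=> [/addnI/val_inj -> /addnI/val_inj ->] [/addnI/val_inj -> /addnI/val_inj ->].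
have -> : (q ^ 4 = #|[set: ('I_q * 'I_q) * ('I_q * 'I_q)]%SET|)%N.
  by rewrite cardsT !card_prod !card_ord !expnS expn0; lia.
rewrite -(card_imset _ si); apply/subset_leq_card/fintype.subsetP => f.
move=> /imsetP[[[i j] [k l]] _ ->]; rewrite inE /s/=.
have [-> -> -> ->] := quadrupleE (V 0 isT i, V 1 isT j) (V 1 isT j, V 2 isT k)
   (V 2 isT k, V 3 isT l) (V 0 isT i, V 3 isT l).
rewrite /block_cycle/= /v !eqxx/=.
have := ltn_ord i; have := ltn_ord j; have := ltn_ord k; clear; move: (nat_of_ord i) (nat_of_ord j) (nat_of_ord k) (nat_of_ord l); lia.
Qed.

Lemma fourth_moment_lower q : (0 < q)%N ->
  (p * (1 - p)) ^+ 2 * (3 * #|ordered_pairs (4 * q)|%:R ^+ 2) +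
  C4_density g p * q%:R ^+ 4 - (5 * (9 ^ 4 * (4 * q) ^ 3))%:R <=
  mean P (fun w => centred_count (4 * q) w ^+ 4).
Proof.
move=> q0; set n := (4 * q)%N; have n0 : (0 < n)%N by rewrite /n; lia.
rewrite (mean_centred_countX p mg gC g01 X U).
pose D1 := quad_pred (@doubled n).
pose D2 := quad_pred (fun e0 e1 e2 e3 => @doubled n e0 e2 e1 e3).
pose D3 := quad_pred (fun e0 e1 e2 e3 => @doubled n e0 e3 e1 e2).
pose B := quad_pred (@block_cycle n q).
pose F := [set f : {ffun 'I_4 -> 'I_n * 'I_n} |
  (size (undup (endpoints (codom f))) <= 3)%N]%SET.
have ind (A : {set {ffun 'I_4 -> 'I_n * 'I_n}}) : (#|A|%:R : R) = \sum_f (f \in A)%:R.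
  rewrite -sum1_card natr_sum big_mkcond/=; apply: eq_bigr => f _; by case: (f \in A).
apply: (@le_trans _ _ ((p * (1 - p)) ^+ 2 * (#|D1|%:R + #|D2|%:R + #|D3|%:R) +
   C4_density g p * #|B|%:R - 5 * #|F|%:R)).
  have F9 : (#|F| <= 9 ^ 4 * n ^ 3)%N by exact: (@card_few_vertices n 4 3).
  have c1 : (#|ordered_pairs n| * #|ordered_pairs n| <= #|D1|)%N.
    apply: (@card_doubled n (fun a b => quadruple a a b b)) => [a b c e /ffunP ss|a b a12 b12].
      by have := ss (inord 0); have := ss (inord 2); rewrite !ffunE !inordK.
    rewrite inE; have [-> -> -> ->] := quadrupleE a a b b.
    by rewrite /doubled !eqxx a12 b12.
  have c2 : (#|ordered_pairs n| * #|ordered_pairs n| <= #|D2|)%N.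
    apply: (@card_doubled n (fun a b => quadruple a b a b)) => [a b c e /ffunP ss|a b a12 b12].
      by have := ss (inord 0); have := ss (inord 1); rewrite !ffunE !inordK.
    rewrite inE; have [-> -> -> ->] := quadrupleE a b a b.
    by rewrite /doubled !eqxx a12 b12.
  have c3 : (#|ordered_pairs n| * #|ordered_pairs n| <= #|D3|)%N.
    apply: (@card_doubled n (fun a b => quadruple a b b a)) => [a b c e /ffunP ss|a b a12 b12].
      by have := ss (inord 0); have := ss (inord 1); rewrite !ffunE !inordK.
    rewrite inE; have [-> -> -> ->] := quadrupleE a b b a.
    by rewrite /doubled !eqxx a12 b12.
  apply: lerB; last by rewrite natrM ler_wpM2l// ler_nat.
  apply: lerD.
    apply: ler_wpM2l; first exact: sqr_ge0.
    have -> : 3 * #|ordered_pairs n|%:R ^+ 2 =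
      #|ordered_pairs n|%:R ^+ 2 + #|ordered_pairs n|%:R ^+ 2 + #|ordered_pairs n|%:R ^+ 2 :> R by ring.
    by rewrite expr2 -natrM !lerD// ler_nat.
  apply: ler_wpM2l; first exact: C4_density_ge0.
  by rewrite -natrX ler_nat; exact: card_block_cycle.
rewrite !ind -!big_split/= !mulr_sumr -big_split/= -sumrB; apply: ler_sum => f _.
have h := @fourth_moment_pointwise n q (f (inord 0)) (f (inord 1)) (f (inord 2)) (f (inord 3)).
by rewrite -codom_quadruple in h; apply: le_trans h; rewrite !inE.
Qed.

End fourth_moment.

(** * Singular graphons are regular *)

Section regular.
Context {R : realType}.

Lemma int01_mean (F F' : R -> R) : bfun F' -> (forall x, 0 <= x <= 1 -> F x = F' x) ->
  \int[lebesgue_measure]_(x in `[0, 1]) F x = mean unif F'.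
Proof.
move=> bF' FF'; rewrite mean_unif//; apply: eq_Rintegral => x.
by rewrite inE/= in_itv/=; exact: FF'.
Qed.

(** The kernel outside the unit square is irrelevant; it is set to zero there. *)
Definition clip (g : R * R -> R) (z : R * R) : R :=
  if (0 <= z.1 <= 1) && (0 <= z.2 <= 1) then g z else 0.

Variable g : R * R -> R.
Hypothesis hg : graph_function g.

Lemma clipE x y : 0 <= x <= 1 -> 0 <= y <= 1 -> clip g (x, y) = g (x, y).
Proof. by move=> hx hy; rewrite /clip/= hx hy. Qed.

Lemma clipC x y : clip g (x, y) = clip g (y, x).
Proof.
rewrite /clip/= andbC; case: ifP => // /andP[hy hx].
exact: graphfun_sym hg _ _ hx hy.
Qed.

Lemma clip01 z : 0 <= clip g z <= 1.
Proof.
rewrite /clip; case: z => x y /=; case: ifP => [/andP[hx hy]|_].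
  exact: graphfun_range hg _ _ hx hy.
by rewrite lexx ler01.
Qed.

Lemma measurable_clip : measurable_fun setT (clip g).
Proof.
have -> : clip g = fun z => g z * \1_(`[0, 1]%classic `*` `[0, 1]%classic) z.
  apply/funext => -[x y]; rewrite /clip indicE/= in_setX/= !mem_setE !in_itv/=.
  by case: ifP => _; rewrite ?mulr1 ?mulr0.
apply: measurable_funM; first exact: graphfun_measurable hg.
by apply: measurable_indic; exact: measurableX.
Qed.

Lemma bfun_clip : bfun (clip g).
Proof.
split; first exact: measurable_clip.
by exists 1 => z; have /andP[g0 g1] := clip01 z; rewrite ger0_norm.
Qed.

Definition deg (x : R) : R := mean unif (fun y => clip g (x, y)).

Lemma bfun_deg : bfun deg.
Proof. exact: (bfun_meanl unif unif bfun_clip). Qed.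

Lemma K2_pairs (e : 'I_2 * 'I_2) : (e.1 < e.2)%N && K2 e.1 e.2 = (e == (ord0, ord_max)).
Proof.
by case: e => -[[|[|//]] i] [[|[|//]] j].
Qed.

Lemma edge_density_deg : graphon_density K2 g = mean unif deg.
Proof.
rewrite /graphon_density/=; apply: int01_mean; first exact: bfun_deg.
move=> x hx; apply: int01_mean; first exact: bfun_sectionl bfun_clip.
move=> y hy; rewrite (eq_bigl (pred1 (ord0, ord_max))); last exact: K2_pairs.
by rewrite big_pred1_eq clipE// !(tnth_nth 0).
Qed.

Lemma two_edges_prod (m : nat) (f1 f2 : 'I_2 -> 'I_m) (a0 b0 a1 b1 : 'I_m)
    (h : 'I_m * 'I_m -> R) :
  (a0 < b0)%N -> (a1 < b1)%N -> (a0, b0) != (a1, b1) ->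
  f1 ord0 = a0 -> f1 ord_max = b0 ->
  (f2 ord0 = a1 /\ f2 ord_max = b1) \/ (f2 ord0 = b1 /\ f2 ord_max = a1) ->
  \prod_(e : 'I_m * 'I_m | (e.1 < e.2)%N && union_rel K2 K2 f1 f2 e.1 e.2) h e =
  h (a0, b0) * h (a1, b1).
Proof.
move=> ab0 ab1 ne f1a f1b f2ab.
have ex (f : 'I_2 -> 'I_m) u v :
    [exists a, exists b, [&& K2 a b, f a == u & f b == v]] =
    ((f ord0 == u) && (f ord_max == v)) || ((f ord_max == u) && (f ord0 == v)).
  apply/idP/idP.
    case/existsP => a /existsP[b]; case: a b => -[|[|//]] i [[|[|//]] j] //= /andP[fa fb].
      by apply/orP; left; rewrite -(eqP fa) -(eqP fb); apply/andP; split; apply/eqP; congr f; apply: val_inj.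
    by apply/orP; right; rewrite -(eqP fa) -(eqP fb); apply/andP; split; apply/eqP; congr f; apply: val_inj.
  by case/orP => H; apply/existsP; [exists ord0|exists ord_max]; apply/existsP;
    [exists ord_max|exists ord0]; rewrite H.
rewrite (bigD1 (a0, b0))/=; last by rewrite ab0 /union_rel ex f1a f1b !eqxx.
congr (_ * _); rewrite (bigD1 (a1, b1))/=; last first.
  by rewrite ab1 eq_sym ne /union_rel !ex; case: f2ab => -[-> ->]; rewrite !eqxx ?orbT.
rewrite big1 ?mulr1// => -[u v] /=.
rewrite /union_rel !ex f1a f1b -!pair_eqE /pair_eq/= => /andP[/andP[/andP[uv]]].
by case: f2ab => -[-> ->]; move=> H n1 n2; move: H n1 n2 uv ab0 ab1; rewrite -!val_eqE/=; lia.
Qed.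

Lemma union_K2_density :
  graphon_density (graph_disjoint_union K2 K2) g = mean unif deg ^+ 2.
Proof.
pose o k : 'I_(2 + 2) := inord k.
have prodE (x y z t : R) : 0 <= x <= 1 -> 0 <= y <= 1 -> 0 <= z <= 1 -> 0 <= t <= 1 ->
    \prod_(e : 'I_4 * 'I_4 | (e.1 < e.2)%N && graph_disjoint_union K2 K2 e.1 e.2)
      g (tnth [tuple x; y; z; t] e.1, tnth [tuple x; y; z; t] e.2) =
    clip g (x, y) * clip g (z, t).
  move=> hx hy hz ht.
  rewrite (@two_edges_prod 4 _ _ (o 0) (o 1) (o 2) (o 3) (fun e : 'I_4 * 'I_4 =>
    g (tnth [tuple x; y; z; t] e.1, tnth [tuple x; y; z; t] e.2))).
  - by rewrite !clipE// !(tnth_nth 0)/= !inordK.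
  - by rewrite !inordK.
  - by rewrite !inordK.
  - by rewrite -pair_eqE /pair_eq/= -!val_eqE/= !inordK.
  - by apply: val_inj; rewrite /= inordK.
  - by apply: val_inj; rewrite /= inordK.
  - by left; split; apply: val_inj; rewrite /= inordK.
have bs x : bfun (fun y => clip g (x, y)) by exact: bfun_sectionl bfun_clip.
transitivity (mean unif (fun x => mean unif (fun y =>
    clip g (x, y) * mean unif deg))); last first.
  rewrite expr2 -meanZ; last exact: bfun_deg.
  apply: eq_mean => x; transitivity (mean unif deg * mean unif (fun y => clip g (x, y))) => //.
  by rewrite -meanZ//; apply: eq_mean => y; rewrite mulrC.
have bxy : bfun (fun z => clip g z * mean unif deg) := bfunM bfun_clip (bfun_cst _).
rewrite /graphon_density/=; apply: int01_mean; first exact: (bfun_meanl unif unif bxy).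
move=> x hx; apply: int01_mean; first exact: (bfun_sectionl x bxy).
move=> y hy; rewrite -meanZ; last exact: bfun_deg.
apply: int01_mean; first by apply: bfunM (bfun_cst _) bfun_deg.
move=> z hz; rewrite -meanZ//; apply: int01_mean; first by apply: bfunM (bfun_cst _) _.
by move=> t ht; rewrite -prodE.
Qed.

Lemma bowtie_K2_density (i1 i2 : 'I_2) :
  graphon_density (graph_bowtie K2 K2 i1 i2) g = mean unif (fun x => deg x ^+ 2).
Proof.
pose o k : 'I_(2 + 1) := inord k.
pose c : 'I_3 := lshift 1 i1.
have prodE (x y z : R) : 0 <= x <= 1 -> 0 <= y <= 1 -> 0 <= z <= 1 ->
    \prod_(e : 'I_3 * 'I_3 | (e.1 < e.2)%N && graph_bowtie K2 K2 i1 i2 e.1 e.2)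
      g (tnth [tuple x; y; z] e.1, tnth [tuple x; y; z] e.2) =
    clip g (x, y) * clip g (if i1 == ord0 then x else y, z).
  move=> hx hy hz.
  rewrite (@two_edges_prod 3 _ _ (o 0) (o 1) c (o 2) (fun e : 'I_3 * 'I_3 =>
    g (tnth [tuple x; y; z] e.1, tnth [tuple x; y; z] e.2))).
  - rewrite !clipE//; last by case: ifP.
    rewrite !(tnth_nth 0)/= !inordK//; congr (_ * g (_, _)).
    by case: i1 {c} => -[|[|//]].
  - by rewrite !inordK.
  - by rewrite /c/= inordK//; case: i1 {c} => -[|[|//]].
  - by rewrite -pair_eqE /pair_eq/= -!val_eqE/= !inordK// andbF.
  - by apply: val_inj; rewrite /= inordK.
  - by apply: val_inj; rewrite /= inordK.
  have io (i j : 'I_2) : j != i -> identify_vertex i1 i j = o 2 :> 'I_3.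
    move=> ij; rewrite /identify_vertex; case: unliftP => [k _|jj].
      by apply: val_inj; rewrite /= inordK// ord1.
    by rewrite jj eqxx in ij.
  have ii (i : 'I_2) : identify_vertex i1 i i = c by rewrite /identify_vertex unlift_none.
  have [->|->] : i2 = ord0 \/ i2 = ord_max.
    by case: i2 => -[|[|//]] k; [left|right]; apply: val_inj.
  - by left; rewrite ii io.
  - by right; rewrite ii io.
have bs x : bfun (fun y => clip g (x, y)) by exact: bfun_sectionl bfun_clip.
have bsel (x y : R) : bfun (fun z => clip g (if i1 == ord0 then x else y, z)).
  by case: (i1 == ord0).
have bfst : bfun (fun z : R * R => deg z.1) by exact: (bfun_comp bfun_deg).
have bsnd : bfun (fun z : R * R => deg z.2) by exact: (bfun_comp bfun_deg).
have bxy : bfun (fun z : R * R => clip g z * (if i1 == ord0 then deg z.1 else deg z.2)).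
  by apply: bfunM bfun_clip _; case: (i1 == ord0).
transitivity (mean unif (fun x => mean unif (fun y =>
    clip g (x, y) * (if i1 == ord0 then deg x else deg y)))).
  rewrite /graphon_density/=; apply: int01_mean; first exact: (bfun_meanl unif unif bxy).
  move=> x hx; apply: int01_mean; first exact: (bfun_sectionl x bxy).
  move=> y hy; have -> : (if i1 == ord0 then deg x else deg y) =
    mean unif (fun z => clip g (if i1 == ord0 then x else y, z)) by case: ifP.
  rewrite -meanZ//; apply: int01_mean; first by apply: bfunM (bfun_cst _) _.
  by move=> z hz; rewrite -prodE.
case: (i1 == ord0).
  apply: eq_mean => x; rewrite expr2.
  transitivity (deg x * mean unif (fun y => clip g (x, y))) => //.
  by rewrite -meanZ//; apply: eq_mean => y; rewrite mulrC.
rewrite (mean_swap unif unif (bfunM bfun_clip bsnd)).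
apply: eq_mean => y /=; under eq_mean do rewrite clipC mulrC.
by rewrite meanZ.
Qed.

Hypothesis hsing : singular_graphon g.

Lemma singular_regular :
  mean unif (fun x => (deg x - mean unif deg) ^+ 2) = 0.
Proof.
have := hsing K2 K2 (isT : (0 < 2)%N) (isT : (0 < 2)%N).
rewrite union_K2_density.
under eq_bigr do under eq_bigr do rewrite bowtie_K2_density.
rewrite !sumr_const !card_ord => h.
have {}h : mean unif deg ^+ 2 = mean unif (fun x => deg x ^+ 2).
  by rewrite h -mulrnA -[X in _ * X]mulr_natl mulKf// pnatr_eq0.
have bd := bfun_deg; have bd2 := bfunX 2 bd.
set c := mean unif deg in h *.
transitivity (mean unif (fun x => deg x ^+ 2 - (2 * c * deg x - c ^+ 2))).
  by apply: eq_mean => x; ring.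
have b1 : bfun (fun x => 2 * c * deg x) by exact: bfunM (bfun_cst _) bd.
rewrite meanB//; last by apply: bfunB (bfun_cst _).
rewrite meanB//; last exact: bfun_cst.
by rewrite meanZ// mean_cst -h -/c; ring.
Qed.

Lemma edge_density01 : 0 <= mean unif deg <= 1.
Proof.
have d01 x : 0 <= deg x <= 1.
  have bs : bfun (fun y => clip g (x, y)) by exact: bfun_sectionl bfun_clip.
  apply/andP; split.
    by apply: mean_ge0 => y; have /andP[] := clip01 (x, y).
  rewrite -(mean_cst unif 1); apply: le_mean => //; first exact: bfun_cst.
  by move=> y; have /andP[] := clip01 (x, y).
apply/andP; split; first by apply: mean_ge0 => x; have /andP[] := d01 x.
rewrite -(mean_cst unif 1); apply: le_mean => //; [exact: bfun_deg|exact: bfun_cst|].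
by move=> x; have /andP[] := d01 x.
Qed.

End regular.

(** * Edge fluctuations *)

Lemma continuous_bfun (R : realType) (f : R -> R) :
  continuous f -> bounded_fun f -> bfun f.
Proof.
move=> cf [M [_ Mf]]; split; first exact: continuous_measurable_fun.
by exists (M + 1) => x; apply: Mf => //; rewrite ltrDl.
Qed.

(** Two bounded functions that agree on an event of probability one have the
same mean. *)
Lemma eq_mean_on {d : measure_display} {T : measurableType d} {R : realType}
    (P : probability T R) (N : set T) (f h : T -> R) :
  measurable N -> P N = 0%E -> bfun f -> bfun h ->
  (forall w, ~ N w -> f w = h w) -> mean P f = mean P h.
Proof.
move=> mN N0 bf bh fh; apply/eqP; rewrite -subr_eq0 -meanB//.
have b1 : bfun (\1_N : T -> R) := bfun_indic mN.
have m0 : mean P (fun w => \1_N w ^+ 2) = 0.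
  transitivity (mean P \1_N); last by rewrite mean_indic// N0.
  by apply: eq_mean => w; rewrite indicE; case: (w \in N); rewrite ?expr1n ?expr0n.
rewrite -[X in _ == X](mean_sqr0_mul b1 (bfunB bf bh) m0); apply/eqP/eq_mean => w.
rewrite indicE; have [wN|wN] := boolP (w \in N); first by rewrite mul1r.
by rewrite fh ?subrr ?mulr0// => Nw; rewrite mem_set in wN.
Qed.

Lemma card_hom_K2 n (G : sgraph n) :
  #|hom_set K2 G| = (2 * #|[set e : 'I_n * 'I_n | (e.1 < e.2)%N && G e.1 e.2]%SET|)%N.
Proof.
pose A := [set e : 'I_n * 'I_n | (e.1 < e.2)%N && G e.1 e.2]%SET.
pose B := [set e : 'I_n * 'I_n | (e.2 < e.1)%N && G e.1 e.2]%SET.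
have -> : #|hom_set K2 G| = #|(A :|: B)%SET|.
  rewrite -(card_imset (hom_set K2 G) (f := fun f : {ffun 'I_2 -> 'I_n} => (f ord0, f ord_max))); last first.
    move=> f h [f0 f1]; apply/ffunP => i; case: (unliftP ord0 i) => [j|] ->//.
    by rewrite ord1 (_ : lift _ _ = ord_max)//; apply: val_inj.
  apply: eq_card => -[u v]; apply/imsetP/idP => [[f]|].
    rewrite inE => /forallP/(_ ord0)/forallP/(_ ord_max)/= Guv [-> ->].
    rewrite !inE/= Guv !andbT; case: ltngtP => // /val_inj uv.
    by rewrite uv edge_irr in Guv.
  rewrite !inE/= => uv; have Guv : G u v by case/orP: uv => /andP[].
  exists [ffun i => if i == ord0 then u else v]; last by rewrite !ffunE.
  rewrite inE; apply/forallP => i; apply/forallP => j; apply/implyP => ij.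
  rewrite !ffunE; move: ij; case: i => -[|[|//]] i; case: j => -[|[|//]] j //= _;
    first [exact: Guv|by rewrite edge_sym].
have -> : #|(A :|: B)%SET| = (#|A| + #|B|)%N.
  rewrite cardsU (_ : (A :&: B = finset.set0)%SET) ?cards0 ?subn0//.
  by apply/setP => -[u v]; rewrite !inE/=; case: ltngtP => _; rewrite ?andbF.
have -> : #|B| = #|A|; last by rewrite mul2n addnn.
rewrite -(card_imset A (f := fun e => (e.2, e.1))); last by move=> [i j] [k l] [-> ->].
apply: eq_card => -[u v]; apply/idP/imsetP => [|[[a b]]].
  by rewrite inE/= => /andP[uv Guv]; exists (v, u) => //; rewrite inE/= uv edge_sym.
by rewrite !inE/= => /andP[ab Gab] [-> ->]; rewrite ab edge_sym.
Qed.

Lemma density_K2 (R : realType) n (G : sgraph n) :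
  graph_density R K2 G =
  2 / n%:R ^+ 2 * \sum_(e : 'I_n * 'I_n) ((e.1 < e.2)%N && G e.1 e.2)%:R.
Proof.
rewrite /graph_density card_hom_K2 natrM natrX mulrAC; congr (_ * _).
rewrite -sum1_card natr_sum big_mkcond/=.
by apply: eq_bigr => e _; rewrite inE; case: (_ && _).
Qed.

Section fluctuation.
Context {d : measure_display} {T : measurableType d} {R : realType}
  {P : probability T R}.
Variable g : R * R -> R.
Hypothesis hg : graph_function g.
Hypothesis hsing : singular_graphon g.
Variables (X : nat -> {RV P >-> R}) (U : nat -> nat -> {RV P >-> R}).
Hypothesis hXU : iid_uniform01 X U.

Local Notation gc := (clip g).
Local Notation p := (mean unif (deg g)).
Local Notation S n := (centred_count gc p X U n).

Definition sample_density (h : R * R -> R) n (w : T) : R :=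
  graph_density R K2 (W_random_graph h X U n w).

Lemma bfun_sample_density h n : measurable_fun setT h -> bfun (sample_density h n).
Proof.
move=> mh.
apply: (@eq_bfun _ _ _ (fun w => 2 / n%:R ^+ 2 * \sum_(e : 'I_n * 'I_n)
   ((e.1 < e.2)%N && W_random_graph h X U n w e.1 e.2)%:R)).
  by move=> w; rewrite -density_K2.
apply: bfunM (bfun_cst _) _; apply: bfun_sum => e _.
rewrite /= /W_random_rel; case: (e.1 < e.2)%N; last exact: bfun_cst.
case: (e.1 != e.2); last exact: bfun_cst.
set A := [set w | U (minn e.1 e.2) (maxn e.1 e.2) w <=
  h (X (minn e.1 e.2) w, X (maxn e.1 e.2) w)].
have mA : measurable A.
  rewrite -[A]setTI; apply: measurable_fun_ler => //.
  by apply: measurableT_comp => //; apply: measurable_fun_pair.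
by apply: eq_bfun (bfun_indic mA) => w; rewrite indicE mem_setE.
Qed.

Definition outside : set T := \bigcup_i (X i @^-1` (~` `[0, 1])).

Lemma measurable_outside : measurable outside.
Proof.
apply: bigcupT_measurable => i; rewrite -[X in measurable X]setTI.
by apply: measurable_funPT => //; exact: measurableC.
Qed.

Lemma outside0 : P outside = 0%E.
Proof.
apply: measure_negligible; first exact: measurable_outside.
apply: negligible_bigcup => i; exists (X i @^-1` (~` `[0, 1])); split => //.
  rewrite -[X in measurable X]setTI.
  by apply: measurable_funPT => //; exact: measurableC.
have [_ /(_ (inl i)) /= hu] := hXU.
rewrite -[LHS]/(distribution P (X i) (~` `[0, 1])) hu; last exact: measurableC.
by rewrite /uniform_prob integral_uniform_pdf setIC setICr integral_set0.
Qed.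

Lemma sample_density_clip n w : ~ outside w -> sample_density g n w = sample_density gc n w.
Proof.
move=> ow; rewrite /sample_density !density_K2; congr (_ * _).
apply: eq_bigr => e _; rewrite /= /W_random_rel.
have X01 i : 0 <= X i w <= 1.
  apply/negPn/negP => Xi; apply: ow; exists i => //=; apply/negP.
  by rewrite in_itv.
by rewrite clipE.
Qed.

Lemma sample_densityE n w : sample_density gc n w =
  2 / n%:R ^+ 2 * (S n w + p * #|ordered_pairs n|%:R).
Proof.
rewrite /sample_density density_K2; congr (_ * _).
rewrite /centred_count -sum1_card natr_sum mulr_sumr [X in _ = _ + X]big_mkcond/=.
rewrite -[RHS]big_split/=.
apply: eq_bigr => e _; rewrite inE /chi; case: ifP => e12 /=; last by rewrite addr0.
by rewrite /xi ifF ?ltn_eqF// mulr1 subrK /W_random_rel /edge.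
Qed.

Lemma fluctuationE n w : ~ outside w ->
  edge_fluctuation g X U n w = 2 / n%:R * S n w.
Proof.
move=> ow; rewrite /edge_fluctuation -/(sample_density g n w) sample_density_clip//.
have gcC := clipC hg; have gc01 := clip01 hg; have mgc := measurable_clip hg.
have bg := bfun_sample_density n (graphfun_measurable hg).
have bgc := bfun_sample_density n mgc.
rewrite (_ : (fun w => _) = sample_density g n)// expectationE//=.
rewrite (eq_mean_on measurable_outside outside0 bg bgc); last first.
  by move=> w' ow'; exact: sample_density_clip.
have bS := bfun_centred_count p mgc gcC gc01 X U n.
have -> : mean P (sample_density gc n) = 2 / n%:R ^+ 2 * (p * #|ordered_pairs n|%:R).
  transitivity (mean P (fun w => 2 / n%:R ^+ 2 * (S n w + p * #|ordered_pairs n|%:R))).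
    by apply: eq_mean => w'; exact: sample_densityE.
  rewrite meanZ; last by apply: bfunD bS (bfun_cst _).
  rewrite meanD//; last exact: bfun_cst.
  by rewrite mean_cst (mean_centred_count mgc gcC gc01 (singular_regular hg hsing)
    (edge_density01 hg) hXU) add0r.
rewrite sample_densityE -mulrBr addrK; have [->|n0] := eqVneq n 0%N.
  by rewrite invr0 mulr0 !mul0r.
by field; rewrite pnatr_eq0.
Qed.

Lemma fluctuation_limit (d' : measure_display) (T' : measurableType d')
    (P' : probability T' R) (Y : {RV P' >-> R}) :
  cvg_in_distribution P P' (edge_fluctuation g X U) Y ->
  forall f : R -> R, continuous f -> bounded_fun f ->
  mean P (fun w => f (2 / n%:R * S n w)) @[n --> \oo] --> mean P' (fun w => f (Y w)).
Proof.
move=> hY f cf bf; have bbf := continuous_bfun cf bf.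
have gcC := clipC hg; have gc01 := clip01 hg; have mgc := measurable_clip hg.
have bS n := bfun_centred_count p mgc gcC gc01 X U n.
have bfl n : bfun (edge_fluctuation g X U n).
  apply: bfunM (bfun_cst _) _; apply: bfunB (bfun_cst _).
  exact: bfun_sample_density (graphfun_measurable hg).
have := hY f cf bf; rewrite expectationE; last first.
  by apply: (bfun_comp bbf); exact: measurable_funPT.
move=> /fine_cvg /=; apply: cvg_trans; apply: near_eq_cvg; near=> n.
have b1 : bfun (f \o edge_fluctuation g X U n) by have [m _] := bfl n; exact: (bfun_comp bbf).
rewrite /= expectationE//=; apply: (eq_mean_on measurable_outside outside0) => //.
  by have [m _] := bfunM (bfun_cst (2 / n%:R)) (bS n); exact: (bfun_comp bbf).
by move=> w ow; rewrite /= fluctuationE.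
Unshelve. all: by end_near. Qed.

End fluctuation.

(** * Taylor remainders *)

Section taylor.
Context {R : realType}.
Implicit Types f : R -> R.

Lemma mvt_bound f (df : R -> R) (a x B : R) :
  (forall y, `|y - a| <= `|x - a| -> is_derive y 1 f (df y)) ->
  (forall y, `|y - a| <= `|x - a| -> `|df y| <= B) ->
  `|f x - f a| <= B * `|x - a|.
Proof.
move=> fdf dfB.
have B0 : 0 <= B by apply: le_trans (dfB a _) => //; rewrite subrr normr0.
have cont u v : (forall y, u <= y <= v -> `|y - a| <= `|x - a|) ->
    {within `[u, v], continuous f}.
  move=> uv; apply: derivable_within_continuous => y; rewrite in_itv/= => /uv ya.
  by have [] := fdf y ya.
have [xa|ax|->] := ltgtP x a; last by rewrite !subrr !normr0 mulr0.
- have H y : x <= y <= a -> `|y - a| <= `|x - a|.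
    move=> /andP[xy ya]; rewrite (distrC y) (distrC x) !ger0_norm ?subr_ge0//; last exact: ltW.
    by rewrite lerB.
  have [y||z] := MVT xa (f := f) (df := df).
  + by rewrite in_itv/= => /andP[xy ya]; apply: fdf; apply: H; rewrite !ltW.
  + exact: cont.
  + rewrite in_itv/= => /andP[xz za] fE.
    rewrite distrC fE normrM (distrC a); apply: ler_wpM2r => //.
    by apply: dfB; apply: H; rewrite !ltW.
- have H y : a <= y <= x -> `|y - a| <= `|x - a|.
    move=> /andP[xy ya]; rewrite !ger0_norm ?subr_ge0//; last exact: ltW.
    by rewrite lerB.
  have [y||z] := MVT ax (f := f) (df := df).
  + by rewrite in_itv/= => /andP[xy ya]; apply: fdf; apply: H; rewrite !ltW.
  + exact: cont.
  + rewrite in_itv/= => /andP[xz za] fE.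
    rewrite fE normrM; apply: ler_wpM2r => //.
    by apply: dfB; apply: H; rewrite !ltW.
Qed.

Lemma expR_remainder n (x : R) :
  `|expR x - \sum_(k < n) x ^+ k / k`!%:R| <= `|x| ^+ n * expR `|x|.
Proof.
elim: n x => [|n ih] x.
  by rewrite big_ord0 subr0 expr0 mul1r ger0_norm ?expR_ge0// ler_expR ler_norm.
pose f (y : R) := expR y - \sum_(k < n.+1) y ^+ k / k`!%:R.
pose df (y : R) := expR y - \sum_(k < n) y ^+ k / k`!%:R.
have f0 : f 0 = 0.
  rewrite /f expR0 big_ord_recl/= expr0 fact0 divr1 big1 ?addr0 ?subrr// => i _.
  by rewrite /= expr0n/= mul0r.
have fdf (y : R) : is_derive y 1 f (df y).
  pose p : {poly R} := \poly_(k < n.+1) (k`!%:R)^-1.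
  have fE : f = expR - horner p.
    apply/funext => z; rewrite /f/= -[RHS]/(expR z - p.[z]) /p horner_poly; congr (_ - _).
    by apply: eq_bigr => k _; rewrite mulrC.
  rewrite fE /df; apply: is_derive_eq; congr (_ - _).
  rewrite (@horner_coef_wide _ n).
    apply: eq_bigr => k _; rewrite coef_deriv coef_poly ltnS ltn_ord factS natrM invfM.
    by rewrite -[_ *+ k.+1]mulr_natl mulVKf ?pnatr_eq0// mulrC.
  by apply/leq_sizeP => j nj; rewrite coef_deriv coef_poly ltnS ltnNge nj mul0rn.
have := @mvt_bound f df 0 x (`|x| ^+ n * expR `|x|) (fun y _ => fdf y).
rewrite f0 !subr0; rewrite exprSr -mulrA (mulrC `|x|) mulrA; apply.
move=> y; rewrite subr0 => yx; apply: (le_trans (ih y)).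
by rewrite ler_pM ?exprn_ge0 ?expR_ge0 ?ler_expR// lerXn2r// nnegrE.
Qed.

(** f is of order k at the origin. *)
Definition order0 (k : nat) f := exists K e : R, [/\ 0 < e, 0 <= K &
  forall t, `|t| <= e -> `|f t| <= K * `|t| ^+ k].

Lemma order0_ext k f h : (exists2 e : R, 0 < e & forall t, `|t| <= e -> f t = h t) ->
  order0 k f -> order0 k h.
Proof.
move=> [a a0 fh] [K [e [e0 K0 H]]]; exists K, (Num.min a e); split => //.
  by rewrite lt_min a0.
by move=> t; rewrite le_min => /andP[ta te]; rewrite -fh// H.
Qed.

Lemma order0D k f h : order0 k f -> order0 k h -> order0 k (fun t => f t + h t).
Proof.
move=> [K [e [e0 K0 H]]] [K' [e' [e0' K0' H']]].
exists (K + K'), (Num.min e e'); split; [by rewrite lt_min e0|exact: addr_ge0|].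
move=> t; rewrite le_min => /andP[te te']; rewrite mulrDl (le_trans (ler_normD _ _))//.
by rewrite lerD ?H ?H'.
Qed.

Lemma order0M k l f h : order0 k f -> order0 l h -> order0 (k + l) (fun t => f t * h t).
Proof.
move=> [K [e [e0 K0 H]]] [K' [e' [e0' K0' H']]].
exists (K * K'), (Num.min e e'); split; [by rewrite lt_min e0|exact: mulr_ge0|].
move=> t; rewrite le_min => /andP[te te']; rewrite normrM exprD mulrACA.
by rewrite ler_pM ?H ?H'.
Qed.

Lemma order0_mono k (a : R) : order0 k (fun t => a * t ^+ k).
Proof. by exists `|a|, 1; split => // t _; rewrite normrM normrX. Qed.

Lemma order0_le k l f : (k <= l)%N -> order0 l f -> order0 k f.
Proof.
move=> kl [K [e [e0 K0 H]]]; exists K, (Num.min e 1); split => //.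
  by rewrite lt_min e0/=.
move=> t; rewrite le_min => /andP[te t1]; apply: le_trans (H t te) _.
by rewrite ler_wpM2l// ler_wiXn2l.
Qed.

Lemma order0_cst (a : R) : order0 0 (fun=> a).
Proof. by exists `|a|, 1; split => // t _; rewrite expr0 mulr1. Qed.

Lemma order0_eq0 k (a : R) : order0 k.+1 (fun t => a * t ^+ k) -> a = 0.
Proof.
move=> [K [e [e0 K0 H]]]; apply/eqP; rewrite -normr_eq0 eq_le normr_ge0 andbT.
apply/ler_addgt0Pl => u u0; rewrite addr0.
pose t := Num.min e (u / (K + 1)).
have t0 : 0 < t by rewrite lt_min e0 divr_gt0// ltr_wpDl.
have te : `|t| <= e by rewrite gtr0_norm// /t ge_min lexx.
have := H t te; rewrite normrM normrX exprSr mulrCA mulrC (gtr0_norm t0).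
rewrite ler_pM2l ?exprn_gt0// => aK; apply: (le_trans aK).
have tu : t <= u / (K + 1) by rewrite /t ge_min lexx orbT.
apply: (le_trans (ler_wpM2l K0 tu)).
by rewrite mulrCA ger_pMr// ler_pdivrMr ?ltr_wpDl// mul1r lerDl.
Qed.

Lemma order0_expR j k f : (0 < j)%N -> order0 j f ->
  order0 (j * k) (fun t => expR (f t) - \sum_(i < k) f t ^+ i / i`!%:R).
Proof.
move=> j0 fj; have [K1 [e1 [e10 K10 H1]]] := order0_le (leq0n j) fj.
have [K [e [e0 K0 H]]] := fj.
exists (K ^+ k * expR K1), (Num.min e e1); split.
- by rewrite lt_min e0.
- by rewrite mulr_ge0 ?exprn_ge0 ?expR_ge0.
move=> t; rewrite le_min => /andP[te te1]; apply: (le_trans (expR_remainder k (f t))).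
rewrite mulrAC; apply: ler_pM; rewrite ?exprn_ge0 ?expR_ge0//.
  by rewrite exprM -exprMn lerXn2r ?nnegrE ?H// mulr_ge0 ?exprn_ge0.
by rewrite ler_expR (le_trans (H1 t te1))// expr0 mulr1.
Qed.

(** The tail of a convergent power series, compared with a geometric series. *)
Lemma order0_pseries (c : nat -> R) (L : R -> R) n :
  (exists2 e : R, 0 < e & forall t, `|t| <= e -> pseries c t @ \oo --> L t) ->
  order0 n (fun t => L t - \sum_(k < n) c k * t ^+ k).
Proof.
move=> [e e0 cL].
have : cvgn (pseries c e).
  by apply/cvg_ex; exists (L e); apply: cL; rewrite ger0_norm// ltW.
move/cvg_series_cvg_0 => c0; have : cvgn (fun i => c i * e ^+ i) by apply/cvg_ex; exists 0.
move=> /cvg_has_ub[B /ubP/= HB].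
have cB i : `|c i| * e ^+ i <= B.
  have : `|c i * e ^+ i| <= B by apply: HB; exists i.
  by rewrite normrM normrX (gtr0_norm e0).
have B0 : 0 <= B by apply: le_trans (cB 0%N); rewrite expr0 mulr1.
exists (2 * B / e ^+ n), (e / 2); split; first by rewrite divr_gt0.
  by rewrite divr_ge0 ?exprn_ge0 ?mulr_ge0// ltW.
move=> t te.
have te' : `|t| <= e by apply: (le_trans te); rewrite ler_pdivrMr// ler_peMr ?ler1n// ltW.
pose r := `|t| / e.
have r0 : 0 <= r by rewrite divr_ge0// ltW.
have r12 : r <= 2^-1 by rewrite ler_pdivrMr// mulrC.
have tail m : `|pseries c t (n + m)%N - \sum_(k < n) c k * t ^+ k| <= B * (r ^+ n * (2 - 2 * r ^+ m)).
  elim: m => [|m ih].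
    rewrite addn0 /pseries /series/= big_mkord subrr normr0 expr0 mulr1 subrr.
    by rewrite mulr0 mulr0.
  rewrite addnS /pseries /series/= big_nat_recr//= -addrA addrCA addrC.
  apply: (le_trans (ler_normD _ _)).
  apply: (@le_trans _ _ (B * (r ^+ n * (2 - 2 * r ^+ m)) + B * r ^+ (n + m))).
    apply: lerD; first exact: ih.
    rewrite normrM normrX /r expr_div_n mulrA ler_pdivlMr ?exprn_gt0// mulrAC.
    by apply: ler_wpM2r; rewrite ?exprn_ge0.
  rewrite -mulrDr ler_wpM2l// exprD -mulrDr ler_wpM2l ?exprn_ge0// exprS.
  have : r ^+ m >= 0 by exact: exprn_ge0.
  by move: (r ^+ m) => s s0; nra.
have lim : `|L t - \sum_(k < n) c k * t ^+ k| <= 2 * B * r ^+ n.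
  have cv : (pseries c t (n + m)%N - \sum_(k < n) c k * t ^+ k) @[m --> \oo] -->
      L t - \sum_(k < n) c k * t ^+ k.
    apply: cvgB; last exact: cvg_cst.
    by apply: (cvg_comp _ _ _ (cL t te')); exact: cvg_addnl.
  apply: (cvgr_to_le (cvg_norm cv)); apply: nearW => m; apply: (le_trans (tail m)).
  rewrite (mulrC 2 B) -mulrA ler_wpM2l// mulrC ler_wpM2r ?exprn_ge0//.
  by rewrite gerDl oppr_le0 mulr_ge0 ?exprn_ge0.
by move: lim; rewrite /r expr_div_n mulrA mulrAC.
Qed.

Lemma fourth_cumulant_identity (M : R -> R) (c : nat -> R) (m2 m3 m4 : R) :
  order0 5 (fun t => M t - (1 + m2 / 2 * t ^+ 2 + m3 / 6 * t ^+ 3 + m4 / 24 * t ^+ 4)) ->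
  (exists2 e : R, 0 < e & forall t, `|t| <= e -> pseries c t @ \oo --> ln (M t)) ->
  (forall t, 0 < M t) -> M 0 = 1 ->
  m4 = 24 * c 4%N + 3 * m2 ^+ 2.
Proof.
move=> hM hc M0 M1; pose L t := ln (M t).
have ML t : expR (L t) = M t by rewrite lnK// posrE.
have oL n : order0 n (fun t => L t - \sum_(k < n) c k * t ^+ k).
  exact: order0_pseries.
have exp2 (x : R) : \sum_(i < 2) x ^+ i / i`!%:R = 1 + x.
  by rewrite !big_ord_recl big_ord0/= /bump/= !factS fact0; field.
have exp3 (x : R) : \sum_(i < 3) x ^+ i / i`!%:R = 1 + x + x ^+ 2 / 2.
  by rewrite !big_ord_recl big_ord0/= /bump/= !factS fact0; field.
have c0 : c 0%N = 0.
  have [K [e [e0 K0 H]]] := oL 1%N.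
  have := H 0; rewrite normr0 => /(_ (ltW e0)).
  by rewrite /L M1 ln1 big_ord1 expr0 mulr1 expr1 mulr0 sub0r normrN normr_le0 => /eqP.
have oM n : (n <= 2)%N -> order0 n (fun t => M t - 1).
  move=> n2; apply: (order0_le n2).
  apply: (order0_ext (f := fun t => (M t - (1 + m2 / 2 * t ^+ 2 + m3 / 6 * t ^+ 3 + m4 / 24 * t ^+ 4))
      + (m2 / 2 * t ^+ 2 + (m3 / 6 * t ^+ 3 + m4 / 24 * t ^+ 4)))).
    by exists 1 => // t _; ring.
  apply: order0D; first exact: order0_le hM.
  apply: order0D; first exact: order0_mono.
  by apply: order0D; apply: (@order0_le 2 _ _ _ (order0_mono _ _)).
have oL1 : order0 1 L.
  apply: (order0_ext (f := fun t => (L t - \sum_(k < 1) c k * t ^+ k))); last exact: oL.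
  by exists 1 => // t _; rewrite big_ord1 c0 mul0r subr0.
have c1 : c 1%N = 0.
  apply: (@order0_eq0 1).
  apply: (order0_ext (f := fun t => (M t - 1) +
    ((-1) * t ^+ 0 * (expR (L t) - \sum_(i < 2) L t ^+ i / i`!%:R) +
     (-1) * t ^+ 0 * (L t - \sum_(k < 2) c k * t ^+ k)))).
    by exists 1 => // t _; rewrite ML exp2 !big_ord_recl !big_ord0 c0/= /bump/=; ring.
  apply: order0D; first exact: oM.
  apply: order0D; apply: (@order0M 0 2); try exact: order0_mono; last exact: oL.
  exact: (@order0_expR 1 2).
have oL2 : order0 2 L.
  apply: (order0_ext (f := fun t => (L t - \sum_(k < 2) c k * t ^+ k))); last exact: oL.
  by exists 1 => // t _; rewrite !big_ord_recl !big_ord0 c0 c1/=; ring.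
pose r t := L t - \sum_(k < 5) c k * t ^+ k.
have rE t : r t = L t - (c 2%N * t ^+ 2 + c 3%N * t ^+ 3 + c 4%N * t ^+ 4).
  by rewrite /r !big_ord_recl big_ord0/= /bump/= c0 c1; ring.
(* The square of the logarithm, up to order five. *)
have oL2sq : order0 5 (fun t => L t ^+ 2 - c 2%N ^+ 2 * t ^+ 4).
  have o3 : order0 3 (fun t => L t - c 2%N * t ^+ 2).
    apply: (order0_ext (f := fun t => L t - \sum_(k < 3) c k * t ^+ k)); last exact: oL.
    by exists 1 => // t _; rewrite !big_ord_recl big_ord0/= /bump/= c0 c1; ring.
  apply: (order0_ext (f := fun t => (L t - c 2%N * t ^+ 2) * (L t + c 2%N * t ^+ 2))).
    by exists 1 => // t _; ring.
  by apply: (@order0M 3 2) => //; apply: order0D => //; exact: order0_mono.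
pose a2 := c 2%N - m2 / 2; pose a3 := c 3%N - m3 / 6.
pose a4 := c 4%N + c 2%N ^+ 2 / 2 - m4 / 24.
have key : order0 5 (fun t => a2 * t ^+ 2 + a3 * t ^+ 3 + a4 * t ^+ 4).
  apply: (order0_ext (f := fun t =>
    (M t - (1 + m2 / 2 * t ^+ 2 + m3 / 6 * t ^+ 3 + m4 / 24 * t ^+ 4)) +
    ((-1) * t ^+ 0 * (expR (L t) - \sum_(i < 3) L t ^+ i / i`!%:R) +
     ((-1) * t ^+ 0 * r t + (-1 / 2) * t ^+ 0 * (L t ^+ 2 - c 2%N ^+ 2 * t ^+ 4))))).
    by exists 1 => // t _; rewrite ML exp3 rE /a2 /a3 /a4; field.
  apply: order0D => //; apply: order0D; last apply: order0D.
  - apply: (@order0M 0 5); first exact: order0_mono.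
    by apply: (@order0_le _ 6) => //; exact: (@order0_expR 2 3).
  - by apply: (@order0M 0 5); [exact: order0_mono|exact: oL].
  - by apply: (@order0M 0 5) => //; exact: order0_mono.
have a20 : a2 = 0.
  apply: (@order0_eq0 2).
  apply: (order0_ext (f := fun t => (a2 * t ^+ 2 + a3 * t ^+ 3 + a4 * t ^+ 4) +
    (- a3 * t ^+ 3 + - a4 * t ^+ 4))).
    by exists 1 => // t _; ring.
  apply: order0D; first exact: order0_le key.
  by apply: order0D; [exact: order0_mono|exact: (@order0_le 3 _ _ _ (order0_mono _ _))].
have a30 : a3 = 0.
  apply: (@order0_eq0 3).
  apply: (order0_ext (f := fun t => (a2 * t ^+ 2 + a3 * t ^+ 3 + a4 * t ^+ 4) + - a4 * t ^+ 4)).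
    by exists 1 => // t _; rewrite a20; ring.
  by apply: order0D; [exact: order0_le key|exact: order0_mono].
have a40 : a4 = 0.
  apply: (@order0_eq0 4); apply: (order0_ext _ key).
  by exists 1 => // t _; rewrite a20 a30; ring.
have -> : m4 = 24 * (m4 / 24) by field.
have -> : m4 / 24 = c 4%N + c 2%N ^+ 2 / 2 by apply/eqP; rewrite -subr_eq0 -opprB oppr_eq0 -/a4 a40.
have -> : c 2%N = m2 / 2 by apply/eqP; rewrite -subr_eq0 -/a2 a20.
by field.
Qed.

End taylor.

(** * Moments of a limit law *)

Section integrable_mean.
Context {d : measure_display} {T : measurableType d} {R : realType}.
Variable P : probability T R.
Implicit Types f h : T -> R.

Definition has_mean f := P.-integrable setT (EFin \o f).

Lemma has_mean_measurable f : has_mean f -> measurable_fun setT f.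
Proof. by move=> /measurable_int/measurable_EFinP. Qed.

Lemma has_mean_bfun f : bfun f -> has_mean f.
Proof. exact: bfun_integrable. Qed.

Lemma has_meanD f h : has_mean f -> has_mean h -> has_mean (fun w => f w + h w).
Proof. by move=> sf sh; exact: (integrableD measurableT sf sh). Qed.

Lemma has_meanZ (k : R) f : has_mean f -> has_mean (fun w => k * f w).
Proof. by move=> sf; exact: (integrableZl measurableT k sf). Qed.

Lemma has_meanB f h : has_mean f -> has_mean h -> has_mean (fun w => f w - h w).
Proof. by move=> sf sh; exact: (integrableB measurableT sf sh). Qed.

Lemma le_has_mean f h : measurable_fun setT f -> has_mean h ->
  (forall w, `|f w| <= h w) -> has_mean f.
Proof.
move=> mf sh fh; apply: (le_integrable measurableT) sh => //.
  exact/measurable_EFinP.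
by move=> w _ /=; rewrite lee_fin (le_trans (fh w))// ler_norm.
Qed.

Lemma norm_mean_le_mean f h : has_mean f -> has_mean h ->
  (forall w, `|f w| <= h w) -> `|mean P f| <= mean P h.
Proof.
move=> sf sh fh; apply: le_trans (le_normr_Rintegral measurableT sf) _.
by apply: le_Rintegral => //; exact: (integrable_norm sf).
Qed.

Lemma has_mean_meanD f h : has_mean f -> has_mean h ->
  mean P (fun w => f w + h w) = mean P f + mean P h.
Proof. by move=> sf sh; rewrite /mean RintegralD. Qed.

Lemma has_mean_meanB f h : has_mean f -> has_mean h ->
  mean P (fun w => f w - h w) = mean P f - mean P h.
Proof. by move=> sf sh; rewrite /mean RintegralB. Qed.

Lemma has_mean_meanZ (k : R) f : has_mean f -> mean P (fun w => k * f w) = k * mean P f.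
Proof. by move=> sf; rewrite /mean RintegralZl. Qed.

End integrable_mean.

Section exponential_moments.
Context {d : measure_display} {T : measurableType d} {R : realType}
  {P : probability T R}.
Variable Y : {RV P >-> R}.
Local Notation mgf t := (fine ('M_P Y t)%E).

Lemma mgfE t : mgf t = mean P (fun w => expR (t * Y w)).
Proof.
rewrite /mmt_gen_fun unlock /mean /Rintegral; congr fine.
by apply: eq_integral => w _ /=; rewrite mulrC.
Qed.

Lemma measurable_expRM (t : R) : measurable_fun setT (fun w => expR (t * Y w)).
Proof.
by apply: measurableT_comp => //; apply: measurable_funM => //; exact: measurable_funPT.
Qed.

Lemma mgf_has_mean t : ('M_P Y t)%E \is a fin_num ->
  has_mean P (fun w => expR (t * Y w)).
Proof.
rewrite /mmt_gen_fun unlock => fY; apply/integrableP; split.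
  by apply/measurable_EFinP; exact: measurable_expRM.
rewrite (eq_integral (fun w => ((expR \o t \o* Y) w)%:E)); last first.
  by move=> w _ /=; rewrite ger0_norm ?expR_ge0// mulrC.
by move: fY; rewrite ge0_fin_numE// integral_ge0// => w _; rewrite lee_fin expR_ge0.
Qed.

Variable e : R.
Hypothesis e0 : 0 < e.
Hypothesis finY : forall t, `|t| <= e -> ('M_P Y t)%E \is a fin_num.

Lemma has_mean_expR t : `|t| <= e -> has_mean P (fun w => expR (t * Y w)).
Proof. by move=> /finY/mgf_has_mean. Qed.

Lemma has_mean_pow_exp k (s : R) : 0 <= s < e ->
  has_mean P (fun w => `|Y w| ^+ k * expR (s * `|Y w|)).
Proof.
move=> /andP[s0 se]; pose u := e - s; have u0 : 0 < u by rewrite subr_gt0.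
pose C := k`!%:R / u ^+ k.
have C0 : 0 <= C by rewrite divr_ge0 ?exprn_ge0 ?ltW.
have hb : has_mean P (fun w => C * (expR (e * Y w) + expR (- e * Y w))).
  apply: has_meanZ; apply: has_meanD; apply: has_mean_expR.
    by rewrite gtr0_norm.
  by rewrite normrN gtr0_norm.
apply: le_has_mean hb _.
  apply: measurable_funM; first by apply: measurable_funX; exact: measurableT_comp.
  apply: measurableT_comp => //; apply: measurable_funM => //.
  exact: measurableT_comp.
move=> w; rewrite ger0_norm ?mulr_ge0 ?exprn_ge0 ?expR_ge0//.
have h1 : `|Y w| ^+ k <= C * expR (u * `|Y w|).
  rewrite /C mulrAC ler_pdivlMr ?exprn_gt0// -exprMn mulrC.
  case: k {C C0} => [|k].
    by rewrite expr0 fact0 mul1r -expR0 ler_expR mulr_ge0// ltW.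
  have uY : 0 <= u * `|Y w| by rewrite mulr_ge0// ltW.
  have h := expR_ge1Dxn k uY.
  rewrite -ler_pdivrMl ?ltr0n ?fact_gt0//.
  by apply: (le_trans _ h); rewrite [_^-1 * _]mulrC; lra.
apply: (@le_trans _ _ (C * expR (u * `|Y w|) * expR (s * `|Y w|))).
  by rewrite ler_wpM2r ?expR_ge0.
rewrite -mulrA -expRD -mulrDl subrK ler_wpM2l//.
by case: (ler0P (Y w)) => _; rewrite ?mulrN ?mulNr ?lerDr ?lerDl expR_ge0.
Qed.

Lemma has_mean_pow k : has_mean P (fun w => Y w ^+ k).
Proof.
have h : has_mean P (fun w => `|Y w| ^+ k * expR (0 * `|Y w|)).
  by apply: has_mean_pow_exp; rewrite lexx.
apply: le_has_mean h _; first by apply: measurable_funX; exact: measurable_funPT.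
by move=> w; rewrite mul0r expR0 mulr1 normrX.
Qed.

Lemma mgf_expansion n :
  order0 n (fun t => mgf t - \sum_(k < n) mean P (fun w => Y w ^+ k) / k`!%:R * t ^+ k).
Proof.
have e2 : 0 <= e / 2 < e by rewrite ltr_pdivrMr// ltr_pMr// ltr1n andbT divr_ge0// ltW.
exists (mean P (fun w => `|Y w| ^+ n * expR (e / 2 * `|Y w|))), (e / 2); split.
- by rewrite divr_gt0.
- by apply: mean_ge0 => w; rewrite mulr_ge0 ?exprn_ge0 ?expR_ge0.
move=> t te.
have te' : `|t| <= e by apply: (le_trans te); have /andP[_ /ltW] := e2.
have hs k : has_mean P (fun w => (k`!%:R)^-1 * t ^+ k * Y w ^+ k).
  by apply: has_meanZ; exact: has_mean_pow.
have hsum m : has_mean P (fun w => \sum_(k < m) (k`!%:R)^-1 * t ^+ k * Y w ^+ k) /\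
    mean P (fun w => \sum_(k < m) (k`!%:R)^-1 * t ^+ k * Y w ^+ k) =
    \sum_(k < m) mean P (fun w => Y w ^+ k) / k`!%:R * t ^+ k.
  elim: m => [|m [ih1 ih2]].
    rewrite big_ord0; have -> : (fun w => \sum_(k < 0) (k`!%:R)^-1 * t ^+ k * Y w ^+ k) = cst 0.
      by apply/funext => w; rewrite big_ord0.
    split; [exact: has_mean_bfun (bfun_cst 0)|exact: mean_cst].
  have -> : (fun w => \sum_(k < m.+1) (k`!%:R)^-1 * t ^+ k * Y w ^+ k) =
     (fun w => \sum_(k < m) (k`!%:R)^-1 * t ^+ k * Y w ^+ k + (m`!%:R)^-1 * t ^+ m * Y w ^+ m).
    by apply/funext => w; rewrite big_ord_recr.
  split; first exact: has_meanD.
  rewrite big_ord_recr/= -ih2 has_mean_meanD//; congr (_ + _).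
  by rewrite has_mean_meanZ; [ring|exact: has_mean_pow].
have [h1 h2] := hsum n.
rewrite mgfE -h2 -has_mean_meanB//; last exact: has_mean_expR.
rewrite mulrC -has_mean_meanZ; last exact: has_mean_pow_exp.
apply: norm_mean_le_mean.
- by apply: has_meanB => //; exact: has_mean_expR.
- by apply: has_meanZ; exact: has_mean_pow_exp.
move=> w; have := expR_remainder n (t * Y w).
have -> : \sum_(k < n) (t * Y w) ^+ k / k`!%:R = \sum_(k < n) (k`!%:R)^-1 * t ^+ k * Y w ^+ k.
  by apply: eq_bigr => k _; rewrite exprMn; ring.
move=> h; apply: (le_trans h); rewrite normrM exprMn -[leLHS]mulrA.
by rewrite !ler_wpM2l ?exprn_ge0// ler_expR ler_wpM2r.
Qed.

End exponential_moments.

Section moment_convergence.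
Context {d d' : measure_display} {T : measurableType d} {T' : measurableType d'}
  {R : realType} {P : probability T R} {P' : probability T' R}.
Variables (Z : nat -> T -> R) (Y : {RV P' >-> R}) (C : R).
Hypothesis bZ : forall n, bfun (Z n).
Hypothesis ZC : forall n, mean P (fun w => Z n w ^+ 6) <= C.
Hypothesis Y6 : forall k, has_mean P' (fun w => Y w ^+ k).
Hypothesis ZY : forall f : R -> R, continuous f -> bounded_fun f ->
  mean P (fun w => f (Z n w)) @[n --> \oo] --> mean P' (fun w => f (Y w)).

Definition truncate (M y : R) := Num.max (- M) (Num.min M y).

Lemma truncate_id M y : `|y| <= M -> truncate M y = y.
Proof.
rewrite ler_norml /truncate => /andP[y1 y2].
by rewrite (min_idPr y2) (max_idPr y1).
Qed.

Lemma norm_truncate M y : 0 <= M -> `|truncate M y| <= M /\ `|truncate M y| <= `|y|.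
Proof.
move=> M0; rewrite /truncate; have [My|yM] := lerP M y.
  have -> : Num.max (- M) M = M by apply/max_idPr; lra.
  by rewrite ger0_norm//; split => //; rewrite ger0_norm; lra.
have [My|My] := lerP (- M) y.
  by split => //; rewrite ler_norml; apply/andP; split; lra.
by rewrite normrN ger0_norm//; split => //; rewrite ltr0_norm; lra.
Qed.

Lemma continuous_truncate M j : continuous (fun y => truncate M y ^+ j).
Proof.
move=> y; apply: (@continuous_comp _ _ _ (truncate M) (fun z => z ^+ j)); last exact: exprn_continuous.
apply: continuous_max; first exact: cst_continuous.
by apply: continuous_min; [exact: cst_continuous|].
Qed.

Lemma truncate_error M j y : 1 <= M -> (j <= 4)%N ->
  `|y ^+ j - truncate M y ^+ j| <= 2 / M ^+ 2 * y ^+ 6.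
Proof.
move=> M1 j4; have M0 : 0 < M by lra.
have y60 : 0 <= y ^+ 6 by rewrite (exprM y 3 2) sqr_ge0.
have [yM|My] := leP `|y| M.
  by rewrite truncate_id// subrr normr0 mulr_ge0// divr_ge0// exprn_ge0// ltW.
have [_ ty] := norm_truncate y (ltW M0).
have y1 : 1 <= `|y| by exact: le_trans M1 (ltW My).
have h4 : `|y| ^+ j <= `|y| ^+ 4 by rewrite ler_weXn2l.
have h6 : `|y| ^+ 4 <= y ^+ 6 / M ^+ 2.
  rewrite ler_pdivlMr ?exprn_gt0// -[y ^+ 6]ger0_norm// normrX (exprD _ 4 2).
  by rewrite ler_wpM2l ?exprn_ge0// lerXn2r ?nnegrE// ltW.
apply: (le_trans (ler_normB _ _)); rewrite !normrX.
have ht : `|truncate M y| ^+ j <= `|y| ^+ j by rewrite lerXn2r ?nnegrE.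
have : `|y| ^+ j <= y ^+ 6 / M ^+ 2 by exact: le_trans h6.
by move: ht; rewrite -mulrA (mulrC (M ^- 2)) => h1' h2; lra.
Qed.

(** Convergence in law together with a bound on a higher moment gives the
convergence of the lower moments. *)
Lemma moment_cvg j : (j <= 4)%N ->
  mean P (fun w => Z n w ^+ j) @[n --> \oo] --> mean P' (fun w => Y w ^+ j).
Proof.
move=> j4; pose D := Num.max C 0 + Num.max (mean P' (fun w => Y w ^+ 6)) 0.
have D0 : 0 <= D by rewrite addr_ge0// le_max lexx orbT.
apply/cvgrPdist_le => eps eps0.
have [M [M1 DM]] : exists M : R, 1 <= M /\ 2 / M ^+ 2 * D <= eps / 2.
  exists (1 + 4 * D / eps); have h : 0 <= 4 * D / eps by rewrite divr_ge0 ?mulr_ge0// ltW.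
  split; first by rewrite lerDl.
  set M := 1 + _; have M1 : 1 <= M by rewrite lerDl.
  rewrite mulrAC ler_pdivrMr ?exprn_gt0//; last by lra.
  have : 4 * D <= eps * M by rewrite (_ : eps * M = eps + 4 * D); [lra|rewrite /M; field; rewrite gt_eqF].
  have : M <= M ^+ 2 by rewrite expr2 ler_peMl; lra.
  nra.
pose f y := truncate M y ^+ j.
have bf : bounded_fun f.
  exists (M ^+ j); split=> [|N MN x _ /=]; first exact: num_real.
  rewrite (le_trans _ (ltW MN))// normrX lerXn2r ?nnegrE//; first by lra.
  by have [] := norm_truncate x (_ : 0 <= M); lra.
have cf : continuous f by exact: continuous_truncate.
have bbf := continuous_bfun cf bf.
have bfY : bfun (fun w => f (Y w)) by apply: (bfun_comp bbf); exact: measurable_funPT.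
have bfZ n : bfun (fun w => f (Z n w)) by have [m _] := bZ n; exact: (bfun_comp bbf).
have eY : `|mean P' (fun w => Y w ^+ j) - mean P' (fun w => f (Y w))| <=
    2 / M ^+ 2 * Num.max (mean P' (fun w => Y w ^+ 6)) 0.
  have hfY := has_mean_bfun P' bfY.
  rewrite -has_mean_meanB//; apply: (@le_trans _ _ (mean P' (fun w => 2 / M ^+ 2 * Y w ^+ 6))).
    apply: norm_mean_le_mean; [exact: has_meanB|exact: has_meanZ|].
    by move=> w; exact: truncate_error.
  rewrite has_mean_meanZ// ler_wpM2l// ?le_max ?lexx//.
  by rewrite divr_ge0// exprn_ge0//; lra.
have eZ n : `|mean P (fun w => Z n w ^+ j) - mean P (fun w => f (Z n w))| <=
    2 / M ^+ 2 * Num.max C 0.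
  have hZ k : has_mean P (fun w => Z n w ^+ k) by apply: has_mean_bfun; exact: bfunX.
  have hfZ := has_mean_bfun P (bfZ n).
  rewrite -has_mean_meanB//; apply: (@le_trans _ _ (mean P (fun w => 2 / M ^+ 2 * Z n w ^+ 6))).
    apply: norm_mean_le_mean; [exact: has_meanB|exact: has_meanZ|].
    by move=> w; exact: truncate_error.
  rewrite has_mean_meanZ// ler_wpM2l//; last by rewrite le_max ZC.
  by rewrite divr_ge0// exprn_ge0//; lra.
have e2 : 0 < eps / 2 by rewrite divr_gt0.
have /cvgrPdist_le/(_ _ e2) := ZY cf bf; apply: filterS => n.
move: eY (eZ n) DM; rewrite /D mulrDr.
set a := mean P' _; set b := mean P' _; set c := mean P _; set g := mean P _.
move=> h1 h2 h3 h4.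
have -> : a - c = (a - b) + (b - g) - (c - g) by ring.
apply: (le_trans (ler_normB _ _)); apply: le_trans (lerD (ler_normD _ _) h2) _.
by move: h1 h3 h4; lra.
Qed.

End moment_convergence.

(** * A vanishing fourth cumulant forces a vanishing four-cycle density *)

Section cumulant.
Context {d d' : measure_display} {T : measurableType d} {T' : measurableType d'}
  {R : realType} {P : probability T R} {P' : probability T' R}.
Variable g : R * R -> R.
Hypothesis hg : graph_function g.
Hypothesis hsing : singular_graphon g.
Variables (X : nat -> {RV P >-> R}) (U : nat -> nat -> {RV P >-> R}).
Hypothesis hXU : iid_uniform01 X U.
Variable Y : {RV P' >-> R}.
Hypothesis hY : cvg_in_distribution P P' (edge_fluctuation g X U) Y.

Local Notation gc := (clip g).
Local Notation p := (mean unif (deg g)).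
Local Notation v := (p * (1 - p)).

Let gcC := clipC hg.
Let gc01 := clip01 hg.
Let mgc := measurable_clip hg.
Let greg := singular_regular hg hsing.
Let p01 := edge_density01 hg.

Definition fluct n (w : T) : R := 2 / n%:R * centred_count gc p X U n w.

Lemma bfun_fluct n : bfun (fluct n).
Proof. by apply: bfunM (bfun_cst _) _; exact: bfun_centred_count. Qed.

Lemma mean_fluctX n k : mean P (fun w => fluct n w ^+ k) =
  (2 / n%:R) ^+ k * mean P (fun w => centred_count gc p X U n w ^+ k).
Proof.
rewrite -meanZ; last by apply: bfunX; exact: bfun_centred_count.
by apply: eq_mean => w; rewrite /fluct exprMn.
Qed.

Lemma mean_fluct6 : exists C : R, forall n, mean P (fun w => fluct n w ^+ 6) <= C.
Proof.
have [K HK] : exists K : nat, forall n,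
    `|mean P (fun w => centred_count gc p X U n.+1 w ^+ 6)| <= (K * n.+1 ^ 6)%:R.
  by exists ((6 * 6) ^ 6)%N => n; apply: norm_moment_le.
exists (2 ^+ 6 * K%:R) => n; rewrite mean_fluctX; case: n => [|n].
  by rewrite invr0 mulr0 expr0n/= mul0r mulr_ge0 ?exprn_ge0 ?ler0n.
have {HK} := le_trans (ler_norm _) (HK n).
rewrite natrM natrX; move: (mean P _) K%:R => x k h.
rewrite expr_div_n mulrAC ler_pdivrMr ?exprn_gt0 ?ltr0n// -[leRHS]mulrA.
by apply: ler_wpM2l; first exact: exprn_ge0.
Qed.

Lemma fluct_moment_cvg : (forall k, has_mean P' (fun w => Y w ^+ k)) ->
  forall j, (j <= 4)%N ->
  mean P (fun w => fluct n w ^+ j) @[n --> \oo] --> mean P' (fun w => Y w ^+ j).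
Proof.
move=> Yk j j4; have [C HC] := mean_fluct6; apply: (moment_cvg _ HC) j4 => //.
- exact: bfun_fluct.
- exact: fluctuation_limit.
Qed.

Lemma ordered_pairsE n : 4 / n.+1%:R ^+ 2 * #|ordered_pairs n.+1|%:R =
  2 * (1 - harmonic n) :> R.
Proof.
have /(congr1 (fun k => k%:R : R)) := card_ordered_pairs n.+1.
rewrite natrD !natrM /harmonic => h.
have n0 : n.+1%:R != 0 :> R by rewrite pnatr_eq0.
have -> : #|ordered_pairs n.+1|%:R = (n.+1%:R * n.+1%:R - n.+1%:R) / 2 :> R.
  by rewrite -h addrK mulrC mulKf.
by rewrite /=; field.
Qed.

Hypothesis Yk : forall k, has_mean P' (fun w => Y w ^+ k).

Lemma limit_moment1 : mean P' (fun w => Y w ^+ 1) = 0.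
Proof.
apply: (cvg_unique _ (fluct_moment_cvg Yk (isT : (1 <= 4)%N))) => //.
rewrite (_ : (fun n => _) = fun=> 0); first exact: cvg_cst.
apply/funext => n; rewrite mean_fluctX expr1.
under eq_mean do rewrite expr1.
by rewrite (mean_centred_count mgc gcC gc01 greg p01 hXU) mulr0.
Qed.

Lemma limit_moment2 : mean P' (fun w => Y w ^+ 2) = 2 * v.
Proof.
have := fluct_moment_cvg Yk (isT : (2 <= 4)%N).
rewrite -(cvg_shiftS (fun n => mean P (fun w => fluct n w ^+ 2))) => h.
apply: (cvg_unique _ h) => //.
rewrite (_ : (fun n => _) = fun n => 2 * (1 - harmonic n) * v); last first.
  apply/funext => n; rewrite mean_fluctX (mean_centred_count2 mgc gcC gc01 greg p01 hXU).
  by rewrite -ordered_pairsE expr_div_n; ring.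
have : 2 * (1 - harmonic n) * v @[n --> \oo] --> 2 * (1 - 0) * v.
  apply: cvgM; last exact: cvg_cst.
  apply: cvgM; first exact: cvg_cst.
  by apply: cvgB; [exact: cvg_cst|exact: cvg_harmonic].
by rewrite subr0 mulr1.
Qed.

Lemma limit_moment4 : 12 * v ^+ 2 + C4_density gc p / 16 <= mean P' (fun w => Y w ^+ 4).
Proof.
have h4 := fluct_moment_cvg Yk (isT : (4 <= 4)%N).
have h : mean P (fun w => fluct (4 * n.+1) w ^+ 4) @[n --> \oo] --> mean P' (fun w => Y w ^+ 4).
  apply: (cvg_comp (fun n => (4 * n.+1)%N) _ _ h4).
  move=> A [N _ NA]; exists N => // n /= Nn; apply: NA => /=; lia.
have [K hl] : exists K : nat, forall n,
    v ^+ 2 * (3 * #|ordered_pairs (4 * n.+1)|%:R ^+ 2) + C4_density gc p * n.+1%:R ^+ 4 -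
    (K * n.+1 ^ 3)%:R <= mean P (fun w => centred_count gc p X U (4 * n.+1) w ^+ 4).
  have := fun n => fourth_moment_lower mgc gcC gc01 greg p01 hXU (ltn0Sn n).
  move: (9 ^ 4)%N => a; move: 5%N => b hab.
  exists (b * (a * 4 ^ 3))%N => n.
  have -> : (b * (a * 4 ^ 3) * n.+1 ^ 3 = b * (a * (4 * n.+1) ^ 3))%N by rewrite expnMn !mulnA.
  exact: hab.
pose b n : R := 12 * (1 - harmonic n / 4) ^+ 2 * v ^+ 2 + C4_density gc p / 16 - K%:R / 16 * harmonic n.
apply: (@ler_cvg_to _ _ _ _ b _ _ _ _ h); last first.
  apply: nearW => n; rewrite mean_fluctX.
  have {}hl := hl n; set m := (4 * n.+1)%N in hl *.
  have m0 : (2 / m%:R) ^+ 4 >= 0 :> R by rewrite exprn_ge0// divr_ge0.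
  apply: le_trans (ler_wpM2l m0 hl); rewrite le_eqVlt; apply/orP; left; apply/eqP.
  have nE : harmonic n / 4 = m%:R^-1 :> R by rewrite /m natrM invfM mulrC.
  have mE : m%:R = 4 * n.+1%:R :> R by rewrite /m natrM.
  have mm : m.-1.+1 = m by rewrite prednK.
  have := ordered_pairsE m.-1; rewrite /harmonic/= mm => hp.
  have NE : #|ordered_pairs m|%:R = m%:R ^+ 2 / 2 * (1 - m%:R^-1) :> R.
    have m1 : m%:R != 0 :> R by rewrite pnatr_eq0 -lt0n /m.
    have -> : #|ordered_pairs m|%:R = m%:R ^+ 2 / 4 * (4 / m%:R ^+ 2 * #|ordered_pairs m|%:R) :> R.
      by field.
    by rewrite hp; field.
  rewrite /b nE natrM natrX NE mE /harmonic/=.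
  have x0 : n.+1%:R != 0 :> R by rewrite pnatr_eq0.
  by move: n.+1%:R K%:R x0 => x k x0; field.
have -> : 12 * v ^+ 2 + C4_density gc p / 16 =
  12 * (1 - 0 / 4) ^+ 2 * v ^+ 2 + C4_density gc p / 16 - K%:R / 16 * 0 by field.
apply: cvgB; last by apply: cvgM; [exact: cvg_cst|exact: cvg_harmonic].
apply: cvgD; last exact: cvg_cst.
apply: cvgM; last exact: cvg_cst.
apply: cvgM; first exact: cvg_cst.
have c1 : 1 - harmonic n / 4 @[n --> \oo] --> (1 - 0 / 4 : R).
  by apply: cvgB; [exact: cvg_cst|apply: cvgM; [exact: cvg_harmonic|exact: cvg_cst]].
by rewrite expr2; under eq_fun do rewrite expr2; exact: cvgM.
Qed.

End cumulant.

Lemma cumulant_C4 {d d' : measure_display} {T : measurableType d}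
    {T' : measurableType d'} {R : realType} {P : probability T R}
    {P' : probability T' R} (g : R * R -> R) (X : nat -> {RV P >-> R})
    (U : nat -> nat -> {RV P >-> R}) (Y : {RV P' >-> R}) :
  graph_function g -> singular_graphon g -> iid_uniform01 X U ->
  cvg_in_distribution P P' (edge_fluctuation g X U) Y ->
  has_cumulant P' Y 4 0 -> C4_density (clip g) (mean unif (deg g)) = 0.
Proof.
move=> hg hsing hXU hY [c [cY c4]].
have [e e0 He] : exists2 e : R, 0 < e & forall t, `|t| <= e ->
    ('M_P' Y t)%E \is a fin_num /\ pseries c t @ \oo --> ln (fine ('M_P' Y t)%E).
  have [e /= e0 He] := cY; exists (e / 2); first by rewrite divr_gt0.
  move=> t te; apply: He; rewrite /= sub0r normrN (le_lt_trans te)//.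
  by rewrite ltr_pdivrMr// ltr_pMr// ltr1n.
have finY t : `|t| <= e -> ('M_P' Y t)%E \is a fin_num by move=> /He[].
have Yk k := has_mean_pow e0 finY k.
have m1 := limit_moment1 hg hsing hXU hY Yk.
have m2 := limit_moment2 hg hsing hXU hY Yk.
have m4 := limit_moment4 hg hsing hXU hY Yk.
pose M t := if `|t| <= e then fine ('M_P' Y t)%E else 1.
have id := @fourth_cumulant_identity R M c (mean P' (fun w => Y w ^+ 2))
  (mean P' (fun w => Y w ^+ 3)) (mean P' (fun w => Y w ^+ 4)).
have {}id : mean P' (fun w => Y w ^+ 4) =
    24 * c 4%N + 3 * mean P' (fun w => Y w ^+ 2) ^+ 2.
  apply: id.
  - apply: order0_ext (mgf_expansion e0 finY 5); exists e => // t te.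
    rewrite /M te !big_ord_recl big_ord0/= /bump/= m1 !factS fact0.
    under [X in _ - (X / _ * _ + _)]eq_mean do rewrite expr0.
    by rewrite mean_cst; field.
  - by exists e => // t te; rewrite /M te; have [] := He t te.
  - move=> t; rewrite /M; case: ifP => // te; rewrite mgfE.
    apply: (@lt_le_trans _ _ 1) => //.
    have h1 : mean P' (fun w => 1 + t * Y w ^+ 1) = 1.
      rewrite has_mean_meanD; last by apply: has_meanZ; exact: Yk.
        by rewrite mean_cst has_mean_meanZ// m1 mulr0 addr0.
      exact: has_mean_bfun (bfun_cst 1).
    rewrite -h1; apply: le_Rintegral => //.
    + apply: has_meanD; first exact: has_mean_bfun (bfun_cst 1).
      by apply: has_meanZ; exact: Yk.
    + exact: has_mean_expR te.
    + by move=> w _; rewrite expr1; exact: expR_ge1Dx.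
  - rewrite /M normr0 (ltW e0) mgfE -[RHS](mean_cst P' 1).
    by apply: eq_mean => w; rewrite mul0r expR0.
have c40 : c 4%N = 0.
  by apply/eqP; move/eqP: c4; rewrite eq_sym mulf_eq0 pnatr_eq0 (gtn_eqF (fact_gt0 4)).
move: m4; rewrite id c40 m2 mulr0 add0r.
have C0 : 0 <= C4_density (clip g) (mean unif (deg g)) by exact: C4_density_ge0.
move: (_ * (1 - _)) => v h; apply/eqP; rewrite eq_le C0 andbT.
by move: h; lra.
Qed.

(** * The cut norm of a centred kernel *)

Section rectangles.
Context {R : realType}.
Local Notation mu := (@lebesgue_measure R).

Lemma lebesgue_mean (k : R -> R) : bfun k -> (forall x, ~ (0 <= x <= 1) -> k x = 0) ->
  (\int[mu]_x (k x)%:E = (mean unif k)%:E)%E.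
Proof.
move=> bk k0; rewrite mean_unif// /Rintegral fineK; last first.
  apply: integrable_fin_num => //.
  have [mk [M kM]] := bk; apply: measurable_bounded_integrable => //=.
  - by rewrite lebesgue_measure_itv/= lte_fin ltr01 ltry.
  - exact: measurable_funTS.
  by exists M; split=> [|N MN x _ /=]; [exact: num_real|rewrite (le_trans (kM x))// ltW].
rewrite [RHS]integral_mkcond; apply: eq_integral => x _.
rewrite patchE; case: ifPn => // x01; rewrite k0// => hx.
by move: x01; rewrite mem_setE in_itv/= hx.
Qed.

Lemma rectangle_mean (G G' : R * R -> R) (S S' : set R) : bfun G' ->
  (forall x y, 0 <= x <= 1 -> 0 <= y <= 1 -> G (x, y) = G' (x, y)) ->
  measurable S -> measurable S' -> S `<=` `[0, 1] -> S' `<=` `[0, 1] ->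
  (\int[(mu \x mu)%E]_(z in S `*` S') (G z)%:E =
   (mean unif (fun x => mean unif (fun y => G' (x, y) * (\1_S x * \1_S' y))))%:E)%E.
Proof.
move=> bG' GG' mS mS' S01 S'01.
pose K (z : R * R) : R := G' z * (\1_S z.1 * \1_S' z.2).
have bK : bfun K.
  apply: bfunM => //; apply: bfunM; first exact: (bfun_comp (bfun_indic mS)).
  exact: (bfun_comp (bfun_indic mS')).
transitivity (\int[(mu \x mu)%E]_z (K z)%:E)%E.
  rewrite integral_mkcond; apply: eq_integral => -[x y] _.
  rewrite patchE; have [xy|xy] := boolP ((x, y) \in S `*` S').
    rewrite inE in xy; have [xS yS] := xy; rewrite /K !indicE !mem_set// !mulr1 GG'//.
      by have := S01 _ xS; rewrite /= in_itv.
    by have := S'01 _ yS; rewrite /= in_itv.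
  rewrite /K !indicE -natrM mulnb /=.
  have [/andP[xS yS]|_] := boolP ((x \in S) && (y \in S')); last by rewrite mulr0.
  by move: xy; rewrite in_setX xS yS.
have iK : (mu \x mu)%E.-integrable setT (EFin \o K).
  have mQ : measurable ((`[0, 1] : set R) `*` (`[0, 1] : set R)) by exact: measurableX.
  have : (mu \x mu)%E.-integrable (`[0, 1] `*` `[0, 1]) (EFin \o K).
    have [mK [M KM]] := bK; apply: measurable_bounded_integrable => //=.
    - have l1 : mu `[0, 1] = 1%E.
        by rewrite lebesgue_measure_itv/= lte_fin ltr01 oppr0 adde0.
      have E : (mu \x mu)%E (`[0%R, 1%R] `*` `[0%R, 1%R]) = (mu `[0%R, 1%R] * mu `[0%R, 1%R])%E.
        exact: product_measure1E.
      have E1 : (mu \x mu)%E (`[0%R, 1%R] `*` `[0%R, 1%R]) = 1%E.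
        by rewrite E l1 mule1.
      exact: (eq_ind_r (fun x => x < +oo)%E (ltry 1) E1).
    - exact: measurable_funTS.
    by exists M; split=> [|N MN x _ /=]; [exact: num_real|rewrite (le_trans (KM x))// ltW].
  move=> /(@integrable_mkcond _ _ R (mu \x mu)%E _ (EFin \o K) mQ).1.
  congr (_.-integrable _ _).
  apply/funext => -[x y]; rewrite patchE; case: ifPn => // xy.
  rewrite /= /K !indicE -natrM mulnb /=.
  have [/andP[]|_] := boolP ((x \in S) && (y \in S')); last by rewrite mulr0.
  rewrite !inE => /S01 x01 /S'01 y01.
  by move: xy; rewrite in_setX !mem_set.
rewrite -(integral12_prod_meas1 iK).
have bKx x : bfun (fun y => K (x, y)) by exact: bfun_sectionl bK.
have inner x : (\int[mu]_y (K (x, y))%:E = (mean unif (fun y => K (x, y)))%:E)%E.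
  apply: lebesgue_mean => // y y01; rewrite /K/= !indicE.
  have -> : (y \in S') = false.
    by apply/negP; rewrite inE => /S'01; rewrite /= in_itv.
  by rewrite !mulr0.
rewrite /fubini_F; under eq_integral do rewrite /= inner.
rewrite lebesgue_mean//; first exact: (bfun_meanl unif unif bK).
move=> x x01; rewrite -[RHS](mean_cst unif 0); apply: eq_mean => y; rewrite /K/= !indicE.
have -> : (x \in S) = false.
  by apply/negP; rewrite inE => /S01; rewrite /= in_itv.
by rewrite mul0r mulr0.
Qed.

End rectangles.

Lemma mean_prod {d1 d2 : measure_display} {T1 : measurableType d1}
    {T2 : measurableType d2} {R : realType} (P1 : probability T1 R)
    (P2 : probability T2 R) (F : T1 * T2 -> R) : bfun F ->
  mean (P1 \x P2)%E F = mean P1 (fun x => mean P2 (fun y => F (x, y))).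
Proof. by move=> bF; apply: EFin_inj; rewrite meanE// mean_fubini1. Qed.

Section cut_norm.
Context {R : realType}.
Variable g : R * R -> R.
Hypothesis hg : graph_function g.
Variable p : R.
Local Notation gc := (clip g).
Local Notation h := (fun z => clip g z - p).

Definition rect_mean (S S' : set R) : R :=
  mean unif (fun x => mean unif (fun y => h (x, y) * (\1_S x * \1_S' y))).

Lemma bfun_h : bfun h.
Proof. by apply: bfunB (bfun_cst _); exact: bfun_clip. Qed.

(** The square of the kernel operator is the codegree kernel, so the operator
itself vanishes as soon as the four-cycle density does. *)
Lemma C4_zero_rect (S S' : set R) : measurable S -> measurable S' ->
  C4_density gc p = 0 -> rect_mean S S' = 0.
Proof.
move=> mS mS' C0.
have gc01 := clip01 hg; have mgc := measurable_clip hg.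
have bS : bfun (\1_S : R -> R) := bfun_indic mS.
have bS' : bfun (\1_S' : R -> R) := bfun_indic mS'.
have bcd := bfun_codegree p mgc gc01.
pose pm := (unif \x unif)%E : probability (R * R)%type R.
have cd0 : mean pm (fun z => codegree gc p z ^+ 2) = 0.
  by rewrite /pm mean_prod//; exact: bfunX.
have bss : bfun (fun z : R * R => \1_S z.1 * \1_S z.2 : R).
  by apply: bfunM; exact: (bfun_comp bS).
have cdss := mean_sqr0_mul bcd bss cd0.
pose F y := mean unif (fun x => h (x, y) * \1_S x).
have bhS : bfun (fun z : R * R => h z * \1_S z.1).
  by apply: bfunM bfun_h _; exact: (bfun_comp bS).
have bF : bfun F by exact: (bfun_meanr unif unif bhS).
have bhSy y : bfun (fun x => h (x, y) * \1_S x) by exact: (bfun_sectionr y bhS).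
have F0 : mean unif (fun y => F y ^+ 2) = 0.
  pose K (z : R * (R * R)) : R :=
    (h (z.2.1, z.1) * \1_S z.2.1) * (h (z.2.2, z.1) * \1_S z.2.2).
  have bK : bfun K.
    apply: bfunM.
      by apply: (bfun_comp bhS (h := fun z : R * (R * R) => (z.2.1, z.1)));
        apply: measurable_fun_pair => //; apply: measurableT_comp.
    by apply: (bfun_comp bhS (h := fun z : R * (R * R) => (z.2.2, z.1)));
      apply: measurable_fun_pair => //; apply: measurableT_comp.
  transitivity (mean unif (fun y => mean pm (fun z => K (y, z)))).
    apply: eq_mean => y; rewrite /pm mean_prod; last exact: (bfun_sectionl y bK).
    rewrite expr2 mulrC -meanZ//; apply: eq_mean => x.
    by rewrite mulrC -meanZ.
  rewrite mean_swap// -[RHS]cdss; apply: eq_mean => -[x z].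
  rewrite /codegree/= mulrC -meanZ; last first.
    by apply: bfunM; exact: (bfun_sectionl _ bfun_h).
  by apply: eq_mean => y; rewrite /K/=; ring.
have bhSS : bfun (fun z : R * R => h z * (\1_S z.1 * \1_S' z.2)).
  apply: bfunM bfun_h _; apply: bfunM; first exact: (bfun_comp bS).
  exact: (bfun_comp bS').
rewrite /rect_mean (mean_swap unif unif bhSS) -[RHS](mean_sqr0_mul bF bS' F0).
apply: eq_mean => y /=; rewrite mulrC -meanZ//.
by apply: eq_mean => x; ring.
Qed.

Lemma cut_norm_diff_ge0 (g1 g2 : R * R -> R) : (0 <= cut_norm_diff g1 g2)%E.
Proof.
apply: ereal_sup_ubound; exists set0, set0; split => //.
by rewrite setX0 integral_set0 abse0.
Qed.

Lemma rect0_same_graphon :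
  (forall S S', measurable S -> measurable S' -> rect_mean S S' = 0) ->
  same_graphon g (cst p).
Proof.
move=> r0; apply/eqP; rewrite /same_graphon eq_le; apply/andP; split; last first.
  by apply: le_ereal_inf_tmp => _ [s _ ->]; exact: cut_norm_diff_ge0.
have id_mpb : measure_preserving_bij (id : R -> R).
  split => [||A mA A01].
  - by split => [x //|x y _ _ //|x hx]; exists x.
  - exact: measurable_id.
  - by rewrite preimage_id setIidr.
apply: (@le_trans _ _ (cut_norm_diff (fun z => g (z.1, z.2)) (cst p))).
  by apply: ereal_inf_lbound; exists id.
apply: ge_ereal_sup => _ [S [S' [mS mS' S01 S'01 ->]]].
rewrite (@rectangle_mean _ _ h S S' bfun_h)//.
  by rewrite -/(rect_mean S S') r0// abse0.
by move=> x y hx hy; rewrite /= clipE.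
Qed.

Lemma unifE (A : set R) : measurable A -> unif A = lebesgue_measure (A `&` `[0, 1]).
Proof.
move=> mA; rewrite /unif /= /distribution /pushforward /uniform_prob integral_uniform_pdf.
rewrite (eq_integral (cst 1%E)) ?integral_cst ?mul1e//.
  by apply: measurableI.
move=> x; rewrite inE => -[_ /=]; rewrite in_itv/= => x01.
by rewrite /uniform_pdf x01 subr0 invr1.
Qed.

Lemma same_graphon_rect0 (S S' : set R) : measurable S -> measurable S' ->
  same_graphon g (cst p) -> rect_mean S S' = 0.
Proof.
move=> mS mS' gp; apply/eqP; rewrite -normr_eq0 eq_le normr_ge0 andbT -lee_fin.
rewrite -[leRHS]/(0%E) -gp; apply: le_ereal_inf_tmp => _ [s [sb ms sp] ->].
have s01 x : 0 <= x <= 1 -> 0 <= s x <= 1.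
  by move=> hx; have [+ _ _] := sb => /(_ x); rewrite /= !in_itv/=; exact.
pose s' := s \_ `[0, 1]%classic.
have s'E x : 0 <= x <= 1 -> s' x = s x.
  by move=> hx; rewrite /s' patchE mem_set//= in_itv.
have ms' : measurable_fun setT s' by apply/(measurable_restrictT _ _).1.
have s'unif A : measurable A -> unif (s' @^-1` A) = unif A.
  move=> mA; have mA' : measurable (s' @^-1` A) by rewrite -[X in measurable X]setTI; exact: ms'.
  rewrite !unifE// -(sp (A `&` `[0, 1])); [|exact: measurableI|by move=> x []].
  congr (lebesgue_measure _); apply/seteqP; split=> x /=; rewrite !in_itv/=.
    by move=> [xA hx]; move: xA; rewrite s'E// => xA; split => //; split => //; exact: s01.
  by move=> [hx [xA _]]; rewrite s'E.
have mean_s (k : R -> R) : bfun k -> mean unif (fun x => k (s' x)) = mean unif k.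
  move=> bk; pose s'' : {mfun R >-> R} := HB.pack s' (isMeasurableFun.Build _ _ _ _ s' ms').
  rewrite -(mean_distribution unif s'' bk); apply: EFin_inj; rewrite !meanE//.
  by apply: eq_measure_integral => A mA _; exact: s'unif.
pose G (z : R * R) := h (s' z.1, s' z.2).
have bG : bfun G.
  apply: (bfun_comp bfun_h (h := fun z => (s' z.1, s' z.2))).
  by apply: measurable_fun_pair; apply: measurableT_comp.
pose S0 := `[0, 1] `&` s @^-1` S; pose S0' := `[0, 1] `&` s @^-1` S'.
have mS0 : measurable S0 by exact: ms.
have mS0' : measurable S0' by exact: ms.
apply: ereal_sup_ubound; exists S0, S0'; split => //; try by move=> x [].
rewrite (rectangle_mean (G' := G)) //; first last.
- by move=> x [].
- by move=> x [].
- by move=> x y hx hy; rewrite /G /= !s'E// clipE// s01.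
rewrite /=; congr (`|_|%R%:E).
have bSS : bfun (fun z : R * R => h z * (\1_S z.1 * \1_S' z.2)).
  apply: bfunM bfun_h _; apply: bfunM; first exact: (bfun_comp (bfun_indic mS)).
  exact: (bfun_comp (bfun_indic mS')).
have bGS : bfun (fun z : R * R => G z * (\1_S0 z.1 * \1_S0' z.2)).
  apply: bfunM bG _; apply: bfunM; first exact: (bfun_comp (bfun_indic mS0)).
  exact: (bfun_comp (bfun_indic mS0')).
rewrite /rect_mean -(mean_s _ (bfun_meanl unif unif bSS)).
apply: eq_mean_unif.
- by apply: (bfun_comp (bfun_meanl unif unif bSS)).
- exact: (bfun_meanl unif unif bGS).
move=> x hx; rewrite -(mean_s _ (bfun_sectionl (s' x) bSS)).
apply: eq_mean_unif.
- by apply: (bfun_comp (bfun_sectionl (s' x) bSS)).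
- exact: (bfun_sectionl x bGS).
move=> y hy; rewrite /G/=; congr (_ * (_ * _)).
  by rewrite !indicE /S0 in_setI mem_setE in_itv/= hx s'E.
by rewrite !indicE /S0' in_setI mem_setE in_itv/= hy s'E.
Qed.

End cut_norm.

Section density_measure.
Context {d : measure_display} {T : measurableType d} {R : realType}.
Variables (P : probability T R) (f : T -> R).
Hypothesis bf : bfun f.
Hypothesis f0 : forall x, 0 <= f x.

Definition density_measure (A : set T) : \bar R := (\int[P]_(x in A) (f x)%:E)%E.

Let density0 : density_measure set0 = 0%E.
Proof. by rewrite /density_measure integral_set0. Qed.

Let density_ge0 A : (0 <= density_measure A)%E.
Proof. by apply: integral_ge0 => x _; rewrite lee_fin. Qed.

Let density_sigma_additive : semi_sigma_additive density_measure.
Proof.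
move=> /= F mF tF mUF; rewrite /density_measure; apply: cvg_toP.
  apply: ereal_nondecreasing_is_cvgn => m n mn.
  by apply: lee_sum_nneg_natr => // k _ _; exact: density_ge0.
have [mf _] := bf.
rewrite ge0_integral_bigcup//=.
- by apply: measurable_funTS; exact/measurable_EFinP.
- by move=> x _; rewrite lee_fin.
Qed.

HB.instance Definition _ := isMeasure.Build _ _ _ density_measure
  density0 density_ge0 density_sigma_additive.

Definition density : {measure set T -> \bar R} := density_measure.

Lemma densityE A : measurable A -> density A = (mean P (fun x => f x * \1_A x))%:E.
Proof.
move=> mA; rewrite meanE; last by apply: bfunM bf _; exact: bfun_indic.
rewrite /density/= /density_measure integral_mkcond; apply: eq_integral => x _.
by rewrite patchE indicE; case: ifP => _; rewrite ?mulr1 ?mulr0.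
Qed.

End density_measure.

Section kernel_constant.
Context {R : realType}.
Variable g : R * R -> R.
Hypothesis hg : graph_function g.
Variable p : R.
Hypothesis p01 : 0 <= p <= 1.
Local Notation h := (fun z => clip g z - p).

(** A kernel with zero integral over all rectangles vanishes almost everywhere:
the measure of density 1 + h agrees with the product measure on rectangles,
hence on all measurable sets. *)
Lemma rect0_kernel0 :
  (forall S S', measurable S -> measurable S' -> rect_mean g p S S' = 0) ->
  mean unif (fun x => mean unif (fun y => h (x, y) ^+ 2)) = 0.
Proof.
move=> r0; pose pm := (unif \x unif)%E : probability (R * R)%type R.
have bh : bfun h := bfun_h hg p.
have h1 z : -1 <= h z <= 1.
  by move: (clip01 hg z) p01 => /andP[? ?] /andP[? ?]; apply/andP; split; lra.
have b1h : bfun (fun z => 1 + h z) by apply: bfunD bh; exact: bfun_cst.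
have pos z : 0 <= 1 + h z by have /andP[+ _] := h1 z; lra.
pose m := density pm b1h pos.
have agree A : measurable A -> pm A = m A.
  apply: product_measure_unique => S S' mS mS'.
  have bi : bfun (fun z : R * R => \1_S z.1 * \1_S' z.2 : R).
    apply: bfunM; first exact: (bfun_comp (bfun_indic mS)).
    exact: (bfun_comp (bfun_indic mS')).
  rewrite [LHS](densityE pm b1h pos); last exact: measurableX.
  have -> : mean pm (fun z => (1 + h z) * \1_(S `*` S') z) =
      mean pm (fun z => \1_S z.1 * \1_S' z.2 + h z * (\1_S z.1 * \1_S' z.2)).
    by apply: eq_mean => -[x y]; rewrite !indicE in_setX/= -mulnb natrM; ring.
  rewrite meanD//; last exact: bfunM.
  have -> : mean pm (fun z => h z * (\1_S z.1 * \1_S' z.2)) = 0.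
    by rewrite /pm mean_prod; [exact: r0|exact: (bfunM bh bi)].
  rewrite addr0 /pm mean_prod//=.
  have bS : bfun (\1_S : R -> R) := bfun_indic mS.
  have bS' : bfun (\1_S' : R -> R) := bfun_indic mS'.
  under eq_mean do rewrite meanZ// mulrC.
  by rewrite meanZ// !mean_indic// EFinM !fineK ?fin_num_measure// muleC.
have int0 A : measurable A -> mean pm (fun z => h z * \1_A z) = 0.
  move=> mA; have b1A : bfun (\1_A : R * R -> R) := bfun_indic mA.
  have := agree A mA; rewrite [RHS](densityE pm b1h pos)//.
  have -> : mean pm (fun z => (1 + h z) * \1_A z) = mean pm \1_A + mean pm (fun z => h z * \1_A z).
    rewrite -meanD//; last exact: bfunM.
    by apply: eq_mean => z; ring.
  by rewrite mean_indic// => /(congr1 fine)/= => e; lra.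
have bh2 : bfun (fun z => h z ^+ 2) := bfunX 2 bh.
rewrite -(mean_prod unif unif bh2); apply/eqP; rewrite eq_le mean_ge0 ?andbT; last first.
  by move=> z; exact: sqr_ge0.
pose A := [set z : R * R | 0 <= h z].
have mA : measurable A.
  by rewrite -[A]setTI; apply: measurable_fun_ler => //; have [] := bh.
have mcA : measurable (~` A) by exact: measurableC.
have bhA (B : set (R * R)) : measurable B -> bfun (fun z => h z * \1_B z).
  by move=> mB; apply: bfunM bh _; exact: bfun_indic.
rewrite -[leRHS](subrr 0) -{1}(int0 A mA) -(int0 _ mcA) -meanB; [|exact: bhA..].
apply: le_mean => //; first by apply: bfunB; exact: bhA.
move=> z; rewrite !indicE in_setC; have [zA|zA] := boolP (z \in A).
  rewrite /= mulr1 mulr0 subr0; move: zA; rewrite inE /A/= => z0.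
  by have /andP[_ z1] := h1 z; rewrite expr2 ler_piMr.
rewrite /= mulr1 mulr0 sub0r; have /negP := zA; rewrite inE /A/= => /negP; rewrite -ltNge => z0.
have /andP[z1 _] := h1 z; move: z0 z1; set u := clip g z - p => z0 z1.
nra.
Qed.

End kernel_constant.

(** * The heat kernel *)

Section pointwise_derivatives.
Context {R : realType}.
Implicit Types (f h : R -> R) (x a b : R).

(** A synonym of is_derive that instance resolution does not unfold, so that a
derivative can be computed by applying the rules below and then simplified. *)
Definition has_derive f x a := is_derive x 1 f a.

Lemma has_derive_eq f x a b : has_derive f x a -> a = b -> has_derive f x b.
Proof. by move=> fa <-. Qed.

Lemma has_derive_cst c x : has_derive (fun=> c) x 0.
Proof. exact: is_derive_cst. Qed.

Lemma has_derive_id x : has_derive (fun y => y) x 1.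
Proof. exact: is_derive_id. Qed.

Lemma has_deriveN f x a : has_derive f x a -> has_derive (fun y => - f y) x (- a).
Proof. by move=> fa; exact: is_deriveN. Qed.

Lemma has_deriveM f h x a b : has_derive f x a -> has_derive h x b ->
  has_derive (fun y => f y * h y) x (a * h x + f x * b).
Proof.
move=> fa hb; have : is_derive x 1 (f * h) (f x *: b + h x *: a) by exact: is_deriveM.
by move=> /is_derive_eq; apply; rewrite addrC /GRing.scale/= (mulrC (h x)).
Qed.

Lemma has_deriveB f h x a b : has_derive f x a -> has_derive h x b ->
  has_derive (fun y => f y - h y) x (a - b).
Proof. by move=> fa hb; exact: is_deriveB. Qed.

Lemma has_deriveD f h x a b : has_derive f x a -> has_derive h x b ->
  has_derive (fun y => f y + h y) x (a + b).
Proof. by move=> fa hb; exact: is_deriveD. Qed.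

Lemma has_deriveV f x a : f x != 0 -> has_derive f x a ->
  has_derive (fun y => (f y)^-1) x (- a / f x ^+ 2).
Proof.
move=> fx fa; have := is_deriveV fx fa.
by move=> /is_derive_eq; apply; rewrite /GRing.scale/= mulNr mulrC -mulNr.
Qed.

Lemma has_deriveexpR f x a : has_derive f x a ->
  has_derive (fun y => expR (f y)) x (a * expR (f x)).
Proof.
move=> fa; have := @is_derive1_comp R expR f x (expR (f x)) a _ fa.
by rewrite mulrC; apply.
Qed.

Lemma taylor2 f (f1 f2 : R -> R) a x K :
  (forall y, `|y - a| <= `|x - a| -> is_derive y 1 f (f1 y)) ->
  (forall y, `|y - a| <= `|x - a| -> is_derive y 1 f1 (f2 y)) ->
  (forall y, `|y - a| <= `|x - a| -> `|f2 y| <= K) ->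
  `|f x - f a - (x - a) * f1 a| <= K * `|x - a| ^+ 2.
Proof.
move=> d1 d2 b2.
have K0 : 0 <= K by apply: le_trans (b2 a _) => //; rewrite subrr normr0.
have := @mvt_bound R (fun y => f y - (y - a) * f1 a) (fun y => f1 y - f1 a) a x (K * `|x - a|).
rewrite subrr mul0r subr0 exprS expr1 mulrA.
have -> : f x - (x - a) * f1 a - f a = f x - f a - (x - a) * f1 a by ring.
apply.
- move=> y ya; apply: has_deriveB; first exact: d1.
  apply: is_derive_eq.
  by rewrite /GRing.scale/=; ring.
- move=> y ya; apply: (@le_trans _ _ (K * `|y - a|)); last exact: ler_wpM2l.
  apply: (@mvt_bound R f1 f2) => z za; [apply: d2|apply: b2]; exact: le_trans za ya.
Qed.

Lemma taylor3 f (f1 f2 f3 : R -> R) (a x K : R) :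
  (forall y : R, is_derive y 1 f (f1 y)) -> (forall y : R, is_derive y 1 f1 (f2 y)) ->
  (forall y : R, is_derive y 1 f2 (f3 y)) -> (forall y, `|f3 y| <= K) ->
  `|f x - f a - (x - a) * f1 a - (x - a) ^+ 2 / 2 * f2 a| <= K * `|x - a| ^+ 3.
Proof.
move=> d1 d2 d3 b3.
have K0 : 0 <= K by apply: le_trans (b3 a) => //.
have := @mvt_bound R (fun y => f y - (y - a) * f1 a - (y - a) * (y - a) * (f2 a / 2))
  (fun y => f1 y - f1 a - (y - a) * f2 a) a x (K * `|x - a| ^+ 2).
rewrite !subrr !mul0r !subr0 -(mulrA K) -exprSr.
have -> : f x - (x - a) * f1 a - (x - a) * (x - a) * (f2 a / 2) - f a =
  f x - f a - (x - a) * f1 a - (x - a) ^+ 2 / 2 * f2 a by field.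
have dB (y : R) : is_derive y 1 (fun y => y - a) (1 - 0).
  exact: is_deriveB.
apply.
- move=> y ya; apply: is_derive_eq.
  by rewrite /GRing.scale/=; field.
- move=> y ya; apply: (@le_trans _ _ (K * `|y - a| ^+ 2)).
    by apply: (taylor2 (f2 := f3)).
  by rewrite ler_wpM2l// lerXn2r// nnegrE.
Qed.

End pointwise_derivatives.

Section heat.
Context {R : realType}.

(** The density at x of the centred normal law of variance v, times the square
root of twice pi. *)
Definition heat (v x : R) : R := expR (- ln v / 2 - x ^+ 2 / (2 * v)).

Definition heat1 (v x : R) : R := - x / v * heat v x.
Definition heat2 (v x : R) : R := (x * x / v ^+ 2 - v^-1) * heat v x.
Definition heat3 (v x : R) : R := (3 * x / v ^+ 2 - x ^+ 3 / v ^+ 3) * heat v x.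

Definition heat_vv (v x : R) : R :=
  ((x ^+ 2 / (2 * v ^+ 2) - (2 * v)^-1) ^+ 2 - x ^+ 2 / v ^+ 3 + (2 * v ^+ 2)^-1) * heat v x.

Lemma has_derive_heat (v x : R) : 0 < v -> has_derive (heat v) x (heat1 v x).
Proof.
move=> v0; apply: has_derive_eq.
  apply: has_deriveexpR; apply: has_deriveB; first exact: has_derive_cst.
  apply: has_deriveM; last exact: has_derive_cst.
  by apply: has_deriveM; exact: has_derive_id.
by rewrite /heat1 /heat; field; rewrite gt_eqF.
Qed.

Lemma has_derive_heat1 (v x : R) : 0 < v -> has_derive (heat1 v) x (heat2 v x).
Proof.
move=> v0; apply: has_derive_eq.
  apply: has_deriveM; last exact: has_derive_heat.
  apply: has_deriveM; last exact: has_derive_cst.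
  by apply: has_deriveN; exact: has_derive_id.
by rewrite /heat2 /heat1; field; rewrite gt_eqF.
Qed.

Lemma has_derive_heat2 (v x : R) : 0 < v -> has_derive (heat2 v) x (heat3 v x).
Proof.
move=> v0; apply: has_derive_eq.
  apply: has_deriveM; last exact: has_derive_heat.
  apply: has_deriveB; last exact: has_derive_cst.
  apply: has_deriveM; last exact: has_derive_cst.
  by apply: has_deriveM; exact: has_derive_id.
by rewrite /heat3 /heat1; field; rewrite gt_eqF.
Qed.

(** The heat equation. *)
Lemma has_derive_heat_v (v x : R) : 0 < v -> has_derive (heat ^~ x) v (heat2 v x / 2).
Proof.
move=> v0; apply: has_derive_eq.
  apply: has_deriveexpR; apply: has_deriveB.
    apply: has_deriveM; last exact: has_derive_cst.
    by apply: has_deriveN; exact: is_derive1_ln.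
  apply: has_deriveM; first exact: has_derive_cst.
  apply: has_deriveV; first by rewrite mulf_neq0// gt_eqF.
  apply: has_deriveM; [exact: has_derive_cst|exact: has_derive_id].
by rewrite /heat2 /heat; field; rewrite gt_eqF.
Qed.

Lemma has_derive_heat2_v (v x : R) : 0 < v ->
  has_derive (fun v => heat2 v x / 2) v (heat_vv v x).
Proof.
move=> v0; apply: has_derive_eq.
  apply: has_deriveM; last exact: has_derive_cst.
  apply: has_deriveM; last exact: has_derive_heat_v.
  apply: has_deriveB.
    apply: has_deriveM; first exact: has_derive_cst.
    apply: has_deriveV; first by rewrite expf_neq0// gt_eqF.
    by apply: has_deriveM; exact: has_derive_id.
  by apply: has_deriveV; [rewrite gt_eqF|exact: has_derive_id].
by rewrite /heat2 /heat_vv; field; rewrite gt_eqF.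
Qed.

Lemma heat_gt0 (v x : R) : 0 < heat v x. Proof. exact: expR_gt0. Qed.

Lemma heat_ge0 (v x : R) : 0 <= heat v x. Proof. exact: expR_ge0. Qed.

Lemma heat_decay (t v x : R) : 0 < t <= v ->
  (1 + x ^+ 2 / v) ^+ 2 * heat v x <= 16 * expR (- ln t / 2).
Proof.
move=> /andP[t0 tv]; have v0 := lt_le_trans t0 tv.
set u := x ^+ 2 / v.
have u0 : 0 <= u by rewrite divr_ge0 ?sqr_ge0// ltW.
have hE : heat v x = expR (- ln v / 2) * (expR (- (u / 4)) ^+ 2).
  rewrite /heat expRD -expRM_natl; congr (_ * expR _).
  by rewrite /u; field; rewrite gt_eqF.
have h1 : (1 + u) * expR (- (u / 4)) <= 4.
  rewrite expRN ler_pdivrMr ?expR_gt0//.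
  by have := expR_ge1Dx (u / 4); lra.
have -> : (1 + u) ^+ 2 * heat v x = ((1 + u) * expR (- (u / 4))) ^+ 2 * expR (- ln v / 2).
  by rewrite hE exprMn; ring.
apply: ler_pM; rewrite ?expR_ge0 ?sqr_ge0//.
  have -> : 16 = 4 ^+ 2 :> R by ring.
  by rewrite lerXn2r// nnegrE// mulr_ge0 ?expR_ge0//; lra.
rewrite ler_expR; have : ln t <= ln v by rewrite ler_ln// posrE.
lra.
Qed.

Lemma heat_le (t v x : R) : 0 < t <= v -> heat v x <= 16 * expR (- ln t / 2).
Proof.
move=> tv; have /andP[t0 tv'] := tv; have v0 := lt_le_trans t0 tv'.
apply: le_trans (heat_decay x tv); rewrite ler_peMl ?heat_ge0//.
by rewrite exprn_ege1// lerDl divr_ge0 ?sqr_ge0// ltW.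
Qed.

Lemma heat3_le (t v x : R) : 0 < t <= v ->
  `|heat3 v x| <= 2 * (t^-1 + 1) * t^-1 * (16 * expR (- ln t / 2)).
Proof.
move=> tv; have /andP[t0 tv'] := tv; have v0 := lt_le_trans t0 tv'.
set u := x ^+ 2 / v.
have u0 : 0 <= u by rewrite divr_ge0 ?sqr_ge0// ltW.
have w0 : 0 < v^-1 by rewrite invr_gt0.
have wt : v^-1 <= t^-1 by rewrite lef_pV2// posrE.
rewrite /heat3 normrM (ger0_norm (ltW (heat_gt0 _ _))).
apply: (@le_trans _ _ (2 * (t^-1 + 1) * t^-1 * ((1 + u) ^+ 2 * heat v x))); last first.
  rewrite ler_wpM2l ?heat_decay//; first by rewrite !mulr_ge0 ?addr_ge0//; lra.
rewrite mulrA ler_wpM2r ?heat_ge0//.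
have -> : 3 * x / v ^+ 2 - x ^+ 3 / v ^+ 3 = x / v * (v^-1 * (3 - u)).
  by rewrite /u; field; rewrite gt_eqF.
have xv : `|x / v| <= (v^-1 + u) / 2.
  have E : (v^-1 + u) / 2 = (1 + x ^+ 2) / 2 / v by rewrite /u; field; rewrite gt_eqF.
  rewrite E normrM (gtr0_norm w0) ler_wpM2r ?(ltW w0)//.
  have := sqr_ge0 (x - 1); have := sqr_ge0 (x + 1); rewrite sqrrB sqrrD => h1 h2.
  by rewrite ler_norml; apply/andP; split; lra.
apply: (@le_trans _ _ ((v^-1 + 1) * (1 + u) / 2 * (v^-1 * (3 * (1 + u))))).
  rewrite !normrM -(normrM x); apply: ler_pM; rewrite ?mulr_ge0//.
    by rewrite (le_trans xv)//; have := mulr_ge0 (ltW w0) u0; lra.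
  rewrite (gtr0_norm w0) ler_wpM2l ?(ltW w0)//.
  by rewrite ler_norml; apply/andP; split; lra.
have p0 : 0 <= (v^-1 + 1) * v^-1 by rewrite mulr_ge0 ?addr_ge0 ?(ltW w0).
have : (v^-1 + 1) * v^-1 <= (t^-1 + 1) * t^-1 by rewrite ler_pM//; lra.
move: (v^-1 + 1) w0 p0 => w1 w0 p0; move: (t^-1 + 1) => t1 h.
have -> : w1 * (1 + u) / 2 * (v^-1 * (3 * (1 + u))) = (3 / 2 * (w1 * v^-1)) * (1 + u) ^+ 2 by field; rewrite gt_eqF.
by rewrite ler_wpM2r ?sqr_ge0//; lra.
Qed.

Lemma heat_vv_le (t v x : R) : 0 < t <= v ->
  `|heat_vv v x| <= t^-1 ^+ 2 * (16 * expR (- ln t / 2)).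
Proof.
move=> tv; have /andP[t0 tv'] := tv; have v0 := lt_le_trans t0 tv'.
set u := x ^+ 2 / v.
have u0 : 0 <= u by rewrite divr_ge0 ?sqr_ge0// ltW.
have w0 : 0 < v^-1 by rewrite invr_gt0.
have wt : v^-1 <= t^-1 by rewrite lef_pV2// posrE.
rewrite /heat_vv normrM (ger0_norm (ltW (heat_gt0 _ _))).
apply: (@le_trans _ _ (t^-1 ^+ 2 * ((1 + u) ^+ 2 * heat v x))); last first.
  by rewrite ler_wpM2l ?heat_decay ?sqr_ge0.
rewrite (mulrA (t^-1 ^+ 2)) ler_wpM2r ?heat_ge0//.
have -> : (x ^+ 2 / (2 * v ^+ 2) - (2 * v)^-1) ^+ 2 - x ^+ 2 / v ^+ 3 + (2 * v ^+ 2)^-1 =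
  v^-1 ^+ 2 * ((u - 1) ^+ 2 / 4 - u + 1 / 2).
  by rewrite /u; field; rewrite gt_eqF.
rewrite normrM ger0_norm ?sqr_ge0//; apply: ler_pM; rewrite ?sqr_ge0//.
  by rewrite lerXn2r// nnegrE ltW// (lt_le_trans w0).
rewrite ler_norml; have := sqr_ge0 u; rewrite !expr2 => uu; apply/andP; split; lra.
Qed.

End heat.

Section heat_step.
Context {R : realType}.

Lemma continuous_heat (v : R) : 0 < v -> continuous (heat v).
Proof.
move=> v0 x; apply: differentiable_continuous; apply/derivable1_diffP.
by have [] := has_derive_heat x v0.
Qed.

Lemma bfun_heat (v : R) : 0 < v -> bfun (heat v).
Proof.
move=> v0; split; first by apply: continuous_measurable_fun; exact: continuous_heat.
exists (16 * expR (- ln v / 2)) => x; rewrite ger0_norm ?heat_ge0//.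
by apply: heat_le; rewrite v0/=.
Qed.

(** One step of the random walk agrees to third order with the heat flow run
for the variance of the step. *)
Lemma heat_step (t0 : R) : 0 < t0 -> exists2 K, 0 <= K &
  forall (p a t x : R), 0 <= p <= 1 -> 0 < a <= 1 -> a ^+ 2 <= t0 / 2 -> t0 <= t ->
  `|(p * heat t (x + a * (1 - p)) + (1 - p) * heat t (x - a * p))
    - heat (t + a ^+ 2 * (p * (1 - p))) x| <= K * a ^+ 3.
Proof.
move=> t00.
have [K3 K30 K3P] : exists2 K3, 0 <= K3 & forall v x, t0 <= v -> `|heat3 v x| <= K3.
  eexists; last by move=> v x tv; apply: (@heat3_le _ t0); rewrite t00.
  by apply: le_trans (heat3_le 0 (_ : 0 < t0 <= t0)); rewrite ?t00/=.
have th : 0 < t0 / 2 by rewrite divr_gt0.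
have [Kv Kv0 KvP] : exists2 Kv, 0 <= Kv & forall v x, t0 / 2 <= v -> `|heat_vv v x| <= Kv.
  eexists; last by move=> v x tv; apply: (@heat_vv_le _ (t0 / 2)); rewrite th.
  by apply: le_trans (heat_vv_le 0 (_ : 0 < t0 / 2 <= t0 / 2)); rewrite ?th/=.
exists (K3 + Kv); first exact: addr_ge0.
move=> p a t x p01 a01 a2 t0t; have t_gt0 := lt_le_trans t00 t0t.
have /andP[p0 p1] := p01; have /andP[a0 a1] := a01.
have [q qE] : exists q, q = 1 - p by exists (1 - p).
have q0 : 0 <= q by lra.
have q1 : q <= 1 by lra.
rewrite -!qE.
have pq : 0 <= p * q <= 1 by apply/andP; split; [exact: mulr_ge0|exact: mulr_ile1].
set dl := a ^+ 2 * (p * q).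
have dl0 : 0 <= dl by rewrite mulr_ge0 ?sqr_ge0//; case/andP: pq.
have dla : dl <= a ^+ 2 by rewrite ler_piMr ?sqr_ge0//; case/andP: pq.
have tay y : `|heat t y - heat t x - (y - x) * heat1 t x - (y - x) ^+ 2 / 2 * heat2 t x|
    <= K3 * `|y - x| ^+ 3.
  exact: (@taylor3 R (heat t) (heat1 t) (heat2 t) (heat3 t) x y K3
    (fun z => has_derive_heat z t_gt0) (fun z => has_derive_heat1 z t_gt0)
    (fun z => has_derive_heat2 z t_gt0) (fun z => K3P t z t0t)).
have tv : `|heat (t + dl) x - heat t x - dl * (heat2 t x / 2)| <= Kv * dl ^+ 2.
  have E : t + dl - t = dl by rewrite addrAC subrr add0r.
  have near y : `|y - t| <= `|t + dl - t| -> t0 / 2 <= y.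
    rewrite E (ger0_norm dl0) ler_norml => /andP[y1 _].
    by clear - y1 dla a2 t0t; lra.
  have y_gt0 y : `|y - t| <= `|t + dl - t| -> 0 < y by move=> /near; exact: lt_le_trans.
  have := @taylor2 R (heat ^~ x) (fun v => heat2 v x / 2) (heat_vv ^~ x) t (t + dl) Kv
    (fun y ty => has_derive_heat_v x (y_gt0 y ty)) (fun y ty => has_derive_heat2_v x (y_gt0 y ty))
    (fun y ty => KvP y x (near y ty)).
  by rewrite E (ger0_norm dl0).
have {tay} [t1 t2] := (tay (x + a * q), tay (x - a * p)).
have h1 : `|a * q| ^+ 3 <= a ^+ 3.
  rewrite lerXn2r ?nnegrE ?(ltW a0)//.
  by rewrite ger0_norm ?mulr_ge0 ?(ltW a0)// ler_piMr ?(ltW a0)//; lra.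
have h2 : `|- (a * p)| ^+ 3 <= a ^+ 3.
  rewrite lerXn2r ?nnegrE ?(ltW a0)//.
  by rewrite normrN ger0_norm ?mulr_ge0 ?(ltW a0)// ler_piMr ?(ltW a0).
have h3 : dl ^+ 2 <= a ^+ 3.
  apply: (@le_trans _ _ ((a ^+ 2) ^+ 2)); first by rewrite lerXn2r ?nnegrE ?sqr_ge0.
  by rewrite -exprM ler_wiXn2l// ltW.
rewrite [x + _ - x]addrAC subrr add0r in t1.
rewrite [x - _ - x]addrAC subrr add0r in t2.
set A := heat t (x + a * q) in t1 *; set B := heat t (x - a * p) in t2 *.
set C := heat (t + dl) x in tv *.
move: A B C (heat t x) (heat1 t x) (heat2 t x) t1 t2 tv => A B C f f1 f2 t1 t2 tv.
have {}t1 := le_trans t1 (ler_wpM2l K30 h1).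
have {}t2 := le_trans t2 (ler_wpM2l K30 h2).
have {}tv := le_trans tv (ler_wpM2l Kv0 h3).
have -> : p * A + q * B - C = p * (A - f - a * q * f1 - (a * q) ^+ 2 / 2 * f2) +
   q * (B - f - (- (a * p)) * f1 - (- (a * p)) ^+ 2 / 2 * f2) - (C - f - dl * (f2 / 2)).
  by rewrite /dl qE; field.
apply: (le_trans (ler_normB _ _)); rewrite mulrDl lerD//.
apply: (le_trans (ler_normD _ _)); rewrite !normrM (ger0_norm p0) (ger0_norm q0).
have -> : K3 * a ^+ 3 = p * (K3 * a ^+ 3) + q * (K3 * a ^+ 3) by rewrite qE; ring.
by rewrite lerD// ler_wpM2l.
Qed.

End heat_step.

Section lindeberg.
Context {d : measure_display} {T : measurableType d} {R : realType}
  {P : probability T R}.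
Variables (g : R * R -> R) (p : R).
Hypothesis mg : measurable_fun setT g.
Hypothesis gC : forall x y, g (x, y) = g (y, x).
Hypothesis g01 : forall z, 0 <= g z <= 1.
Hypothesis p01 : 0 <= p <= 1.
Hypothesis h0 : mean unif (fun x => mean unif (fun y => (g (x, y) - p) ^+ 2)) = 0.
Variables (X : nat -> {RV P >-> R}) (U : nat -> nat -> {RV P >-> R}).
Hypothesis hXU : iid_uniform01 X U.

Lemma mean_hX2 i j : i != j -> mean P (fun w => hX g p X i j w ^+ 2) = 0.
Proof.
move=> ij; have ji : inl j != inl i :> nat + {ij : nat * nat | (ij.1 < ij.2)%N}.
  by apply/eqP => -[e]; rewrite e eqxx in ij.
have bh2 : bfun (fun z => (g z - p) ^+ 2) by apply: bfunX; apply: bfunB (bfun_cst _); exact: bfun_g.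
have bF : bfun (fun z : R * others (source X U) (inl j) => (g (X i z.2, z.1) - p) ^+ 2).
  apply: (bfun_comp bh2); apply: measurable_fun_pair; last exact: measurable_fst.
  by apply: (measurableT_comp (@measurable_X_without _ _ _ _ X U _ _ ji)); exact: measurable_snd.
rewrite (mean_vertex hXU bF).
by rewrite (mean_source hXU (inl i) (bfun_meanl unif unif bh2)).
Qed.

(** When the kernel is constant almost everywhere, an edge is a Bernoulli
variable independent of the rest. *)
Lemma mean_bernoulli_edge i j (a : R) (H : R -> R) (W : others (source X U) (edge_index i j) -> R) :
  i != j -> bfun H -> measurable_fun setT W ->
  mean P (fun w => H (W w + a * xi g p X U i j w)) =
  mean P (fun w => p * H (W w + a * (1 - p)) + (1 - p) * H (W w - a * p)).
Proof.
move=> ij bH mW; pose F (b : bool) w := H (W w + a * (b%:R - p)).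
have bF b : bfun (F b : others (source X U) (edge_index i j) -> R).
  by apply: (bfun_comp bH); apply: measurable_funD.
have bFT b : bfun (F b : T -> R) by exact: bfun_without.
have bh : bfun (hX g p X i j : T -> R) by exact: bfun_hX.
transitivity (mean P (fun w => F (edge g X U i j w) w)).
  by apply: eq_mean => w; rewrite /F /xi (negbTE ij).
rewrite (mean_edge mg gC g01 hXU ij bF).
apply/eqP; rewrite -subr_eq0; apply/eqP.
have FE (w : T) : p * H (W w + a * (1 - p)) + (1 - p) * H (W w - a * p) =
    p * F true w + (1 - p) * F false w.
  by rewrite /F/= sub0r mulrN.
under [X in _ - X]eq_mean do rewrite FE.
have bl : bfun (fun w : T => g (X i w, X j w) * F true w + (1 - g (X i w, X j w)) * F false w).
  have bgX : bfun (fun w => g (X i w, X j w)) by apply: bfun_gX => //; exact: measurable_funPT.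
  by apply: bfunD; apply: bfunM => //; apply: bfunB (bfun_cst _) _.
have br : bfun (fun w : T => p * F true w + (1 - p) * F false w).
  by apply: bfunD; apply: bfunM => //; exact: bfun_cst.
rewrite -(meanB P bl br).
transitivity (mean P (fun w => hX g p X i j w * (F true w - F false w))).
  by apply: eq_mean => w; rewrite /hX; ring.
by apply: mean_sqr0_mul => //; [exact: bfunB|exact: mean_hX2].
Qed.

Lemma lindeberg_bound (t0 : R) : 0 < t0 -> exists2 K, 0 <= K &
  forall n (a t x : R) (s : seq ('I_n * 'I_n)), uniq s -> (forall e, e \in s -> (e.1 < e.2)%N) ->
  0 < a <= 1 -> a ^+ 2 <= t0 / 2 -> t0 <= t ->
  `|mean P (fun w => heat t (x + a * \sum_(e <- s) chi g p X U e w))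
    - heat (t + a ^+ 2 * (p * (1 - p)) * (size s)%:R) x| <= K * a ^+ 3 * (size s)%:R.
Proof.
move=> t00; have [K K0 step] := heat_step t00; exists K => //.
move=> n a t x s; elim: s t => [|e s ih] t us os a01 a2 t0t.
  under eq_mean do rewrite big_nil mulr0 addr0.
  by rewrite mean_cst !mulr0 addr0 subrr normr0.
have /andP[a_gt0 a1] := a01; have /andP[p0 p1] := p01.
move: us; rewrite /= => /andP[es us].
have oe : (e.1 < e.2)%N by apply: os; rewrite mem_head.
have {}os : (forall e, e \in s -> (e.1 < e.2)%N) by move=> f fs; apply: os; rewrite in_cons fs orbT.
have ne : e.1 != e.2 :> nat by rewrite ltn_eqF.
pose W (w : T) := x + a * \sum_(f <- s) chi g p X U f w.
have mW : measurable_fun setT (W : others (source X U) (edge_index e.1 e.2) -> R).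
  have [] // : bfun (W : others (source X U) (edge_index e.1 e.2) -> R).
  apply: bfunD (bfun_cst _) _; apply: bfunM (bfun_cst _) _.
  rewrite (_ : (fun w => _) = (fun w => \sum_(f <- s | f \in s) chi g p X U f w)).
    apply: bfun_sum => f fs; rewrite /chi (os _ fs).
    have nf : f.1 != f.2 :> nat by rewrite ltn_eqF// os.
    apply: bfun_xi_without => //.
    + move=> _; apply: edge_index_neq => //.
      * by apply: contra es => /andP[/eqP e1 /eqP e2]; rewrite (_ : e = f) // [e]surjective_pairing [f]surjective_pairing (val_inj e1) (val_inj e2).
      * by apply/negP => /andP[/eqP e1 /eqP e2]; have := os _ fs; rewrite -e1 -e2 ltnNge ltnW.
    + exact: edge_index_inl.
    + exact: edge_index_inl.
  by apply/funext => w; rewrite -big_seq.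
have t_gt0 := lt_le_trans t00 t0t.
have E : mean P (fun w => heat t (x + a * \sum_(f <- e :: s) chi g p X U f w)) =
    mean P (fun w => p * heat t (W w + a * (1 - p)) + (1 - p) * heat t (W w - a * p)).
  rewrite -(mean_bernoulli_edge a ne (bfun_heat t_gt0) mW).
  by apply: eq_mean => w; rewrite big_cons {1}/chi oe /W; congr heat; ring.
set dl := a ^+ 2 * (p * (1 - p)) in ih *.
have dl0 : 0 <= dl by rewrite !mulr_ge0 ?subr_ge0 ?(ltW a_gt0).
have mWT : measurable_fun setT (W : T -> R).
  apply: measurable_funD => //; apply: measurable_funM => //.
  by apply: measurable_sum => f; have [] := bfun_chi p mg gC g01 X U f.
have bW v c : 0 < v -> bfun (fun w => heat v (W w + c)).
  move=> v0; apply: (bfun_comp (bfun_heat v0)); exact: measurable_funD.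
have bW0 v : 0 < v -> bfun (fun w => heat v (W w)).
  by move=> v0; apply: eq_bfun (bW v 0 v0) => w; rewrite addr0.
have tdl : t0 <= t + dl by lra.
have tdl0 : 0 < t + dl by lra.
have bl : bfun (fun w : T => p * heat t (W w + a * (1 - p)) + (1 - p) * heat t (W w - a * p)).
  by apply: bfunD; apply: bfunM (bfun_cst _) (bW _ _ t_gt0).
have h1 : `|mean P (fun w => heat t (x + a * \sum_(f <- e :: s) chi g p X U f w)) -
    mean P (fun w => heat (t + dl) (W w))| <= K * a ^+ 3.
  rewrite E -meanB//; last exact: bW0.
  apply: norm_mean_le; first by apply: bfunB => //; exact: bW0.
  by move=> w; exact: step.
have h2 := ih (t + dl) us os a01 a2 tdl.
have -> : t + dl * (size s).+1%:R = t + dl + dl * (size s)%:R by rewrite -natr1; ring.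
have -> : K * a ^+ 3 * (size s).+1%:R = K * a ^+ 3 + K * a ^+ 3 * (size s)%:R.
  by rewrite -natr1; ring.
by apply: le_trans (lerD h1 h2); apply: le_trans (ler_normD _ _); rewrite addrA subrK.
Qed.

End lindeberg.

Section heat_limit.
Context {d d' : measure_display} {T : measurableType d} {T' : measurableType d'}
  {R : realType} {P : probability T R} {P' : probability T' R}.
Variable g : R * R -> R.
Hypothesis hg : graph_function g.
Hypothesis hsing : singular_graphon g.
Variables (X : nat -> {RV P >-> R}) (U : nat -> nat -> {RV P >-> R}).
Hypothesis hXU : iid_uniform01 X U.
Variable Y : {RV P' >-> R}.
Hypothesis hY : cvg_in_distribution P P' (edge_fluctuation g X U) Y.
Local Notation p := (mean unif (deg g)).
Hypothesis h0 : mean unif (fun x => mean unif (fun y => (clip g (x, y) - p) ^+ 2)) = 0.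

Lemma mean_heat_limit (t x : R) : 0 < t ->
  mean P' (fun w => heat t (x + Y w)) = heat (t + 2 * (p * (1 - p))) x.
Proof.
move=> t0; have gcC := clipC hg; have gc01 := clip01 hg; have mgc := measurable_clip hg.
have p01 := edge_density01 hg; have /andP[p0 p1] := p01.
set v := p * (1 - p); have v0 : 0 <= v by rewrite mulr_ge0 ?subr_ge0.
pose f y := heat t (x + y).
have cf : continuous f.
  move=> y; apply: (@continuous_comp _ _ _ (fun y => x + y) (heat t)); last exact: continuous_heat.
  by apply: cvgD; [exact: cvg_cst|exact: cvg_id].
have bf : bounded_fun f.
  exists (16 * expR (- ln t / 2)); split; first by rewrite num_real.
  move=> M hM y _; rewrite /= ger0_norm ?heat_ge0//; apply: le_trans (ltW hM).
  by apply: heat_le; rewrite t0/=.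
have lim1 := fluctuation_limit hg hsing hXU hY cf bf.
pose N n := #|ordered_pairs n|.
pose a n : R := 2 / n%:R.
have SE n w : centred_count (clip g) p X U n w =
    \sum_(e <- enum (ordered_pairs n)) chi (clip g) p X U e w.
  rewrite /centred_count big_enum/= (bigID (mem (ordered_pairs n)))/= addrC big1 ?add0r// => e.
  by rewrite inE /chi => /negbTE ->.
have [K K0 HK] := lindeberg_bound mgc gcC gc01 p01 h0 hXU t0.
pose c n : R := heat (t + a n ^+ 2 * v * (N n)%:R) x.
have a_cvg : a n.+1 @[n --> \oo] --> 0.
  by rewrite -(mulr0 2); apply: cvgM; [exact: cvg_cst|exact: cvg_harmonic].
have aN n : a n.+1 ^+ 2 * (N n.+1)%:R = 2 * (1 - harmonic n) by rewrite -ordered_pairsE /a expr_div_n; congr (_ / _ * _); ring.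
have bound : \forall n \near \oo,
    `|mean P (fun w => f (a n.+1 * centred_count (clip g) p X U n.+1 w)) - c n.+1| <= 2 * K * a n.+1.
  have e0 : 0 < Num.min 1 (t / 2) by rewrite lt_min ltr01 divr_gt0.
  have [M _ HM] : \forall n \near \oo, a n.+1 <= Num.min 1 (t / 2).
    by apply: cvgr_le e0; exact: a_cvg.
  exists M => // n /HM; rewrite le_min => /andP[a1 at2].
  have a_gt0 : 0 < a n.+1 by rewrite divr_gt0.
  have := HK _ (a n.+1) t x (enum (ordered_pairs n.+1)) (enum_uniq _).
  rewrite -cardE -/(N n.+1).
  have -> : mean P (fun w => heat t (x + a n.+1 * \sum_(e <- enum (ordered_pairs n.+1)) chi (clip g) p X U e w)) =
     mean P (fun w => f (a n.+1 * centred_count (clip g) p X U n.+1 w)).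
    by apply: eq_mean => w; rewrite /f SE.
  move=> h; apply: (le_trans (h _ _ _ _)) => //.
  - by move=> e; rewrite mem_enum inE.
  - by rewrite a_gt0.
  - by apply: le_trans at2; rewrite expr2 ler_piMr// ltW.
  have -> : K * a n.+1 ^+ 3 * (N n.+1)%:R = K * a n.+1 * (a n.+1 ^+ 2 * (N n.+1)%:R) by ring.
  have -> : 2 * K * a n.+1 = K * a n.+1 * 2 by ring.
  rewrite aN; apply: ler_wpM2l; first by rewrite mulr_ge0// ltW.
  by have := @harmonic_ge0 R n; rewrite /harmonic; lra.
have c_cvg : c n.+1 @[n --> \oo] --> heat (t + 2 * v) x.
  have w0 : 0 < t + 2 * v by lra.
  have ch : {for (t + 2 * v), continuous (heat ^~ x)}.
    apply: differentiable_continuous; apply/derivable1_diffP.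
    by have [] := has_derive_heat_v x w0.
  have cv : t + a n.+1 ^+ 2 * v * (N n.+1)%:R @[n --> \oo] --> t + 2 * v.
    apply: cvgD; first exact: cvg_cst.
    under eq_fun do rewrite mulrAC aN.
    have ch2 : 2 * (1 - harmonic n) @[n --> \oo] --> (2 * (1 - 0) : R).
      by apply: cvgM; [exact: cvg_cst|apply: cvgB; [exact: cvg_cst|exact: cvg_harmonic]].
    by rewrite subr0 mulr1 in ch2; apply: cvgM ch2 _; exact: cvg_cst.
  exact: (cvg_comp _ _ cv ch).
have lim2 : mean P (fun w => f (a n.+1 * centred_count (clip g) p X U n.+1 w)) @[n --> \oo] -->
    heat (t + 2 * v) x.
  have dz : mean P (fun w => f (a n.+1 * centred_count (clip g) p X U n.+1 w)) - c n.+1 @[n --> \oo] --> 0.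
    apply/cvgr0Pnorm_le => e e0.
    have ca : 2 * K * a n.+1 @[n --> \oo] --> 2 * K * 0 by apply: cvgM a_cvg; exact: cvg_cst.
    rewrite mulr0 in ca; have {}ca : \forall n \near \oo, 2 * K * a n.+1 <= e by apply: cvgr_le e0; exact: ca.
    by apply: filterS2 bound ca => n; exact: le_trans.
  have dc := cvgD dz c_cvg; rewrite add0r in dc.
  suff <- : (fun n => mean P (fun w => f (a n.+1 * centred_count (clip g) p X U n.+1 w)) - c n.+1) \+
      (fun n => c n.+1) = (fun n => mean P (fun w => f (a n.+1 * centred_count (clip g) p X U n.+1 w))).
    exact: dc.
  by apply/funext => n /=; rewrite subrK.
apply: (cvg_unique _ _ lim2) => //.
by rewrite -cvg_shiftS in lim1.
Unshelve. all: by end_near. Qed.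

End heat_limit.

Section normal.
Context {R : realType}.
Local Notation mu := (@lebesgue_measure R).

Definition heat_mass : R := Num.sqrt (pi *+ 2).

Lemma heat_mass_gt0 : 0 < heat_mass.
Proof. by rewrite sqrtr_gt0 pmulrn_lgt0// pi_gt0. Qed.

Lemma normal_pdf_heat (m r x : R) : 0 < r ->
  normal_pdf m r x = heat_mass^-1 * heat (r ^+ 2) (x - m).
Proof.
move=> r0; rewrite normal_pdfE ?gt_eqF//.
have -> : normal_peak r = heat_mass^-1 * r^-1.
  rewrite /normal_peak /heat_mass -mulrnAr sqrtrM ?sqr_ge0// sqrtr_sqr gtr0_norm//.
  by rewrite invfM mulrC.
rewrite -mulrA; congr (_ * _); rewrite /normal_fun /heat expRD; congr (_ * _).
  rewrite -[in LHS](lnK r0) -expRN; congr expR.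
  by rewrite lnXn// mulr2n; field.
by congr expR; rewrite -mulr_natl mulNr.
Qed.

Lemma heatE (v z : R) : 0 < v -> heat v z = heat_mass * normal_pdf 0 (Num.sqrt v) z.
Proof.
move=> v0; rewrite normal_pdf_heat ?sqrtr_gt0// sqr_sqrtr ?(ltW v0)// subr0 mulrA.
by rewrite divff ?mul1r// gt_eqF// heat_mass_gt0.
Qed.

Lemma normal_probE (m r : R) (A : set R) : measurable A ->
  normal_prob m r A = (\int[mu]_x (normal_pdf m r x * \1_A x)%:E)%E.
Proof.
move=> mA; rewrite /normal_prob integral_mkcond; apply: eq_integral => x _.
by rewrite /patch indicE; case: ifP => _; rewrite /= ?mulr1 ?mulr0.
Qed.

Lemma normal_tail (m r e : R) (B : set R) : 0 < r -> 0 < e -> measurable B ->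
  (forall x, B x -> e <= `|x - m|) ->
  (normal_prob m r B <= (6 * r ^+ 2 / e ^+ 2)%:E)%E.
Proof.
move=> r0 e0 mB Be.
have r2 : 0 < 2 * r by rewrite mulr_gt0.
have c0 : 0 <= 6 * r ^+ 2 / e ^+ 2 by rewrite divr_ge0 ?sqr_ge0// mulr_ge0 ?sqr_ge0.
have pt x : B x -> normal_pdf m r x <= 6 * r ^+ 2 / e ^+ 2 * normal_pdf m (2 * r) x.
  move=> /Be ex; rewrite !normal_pdf_heat// mulrCA ler_wpM2l ?invr_ge0 ?(ltW heat_mass_gt0)//.
  have z2 : e ^+ 2 <= (x - m) ^+ 2 by rewrite -[leRHS]real_normK ?num_real// lerXn2r ?nnegrE ?(ltW e0).
  move: (x - m) z2 => z z2.
  have lnr : ln ((2 * r) ^+ 2) = 2 * ln 2 + 2 * ln r.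
    by rewrite lnXn// lnM ?posrE// mulr2n; ring.
  have lnr' : ln (r ^+ 2) = 2 * ln r by rewrite lnXn// mulr2n; ring.
  have -> : heat (r ^+ 2) z = 2 * expR (- (3 * z ^+ 2 / (8 * r ^+ 2))) * heat ((2 * r) ^+ 2) z.
    have E a b : 2 * expR a * expR b = expR (ln 2 + a + b) :> R by rewrite !expRD lnK ?posrE.
    rewrite /heat E lnr lnr'.
    by congr expR; field; rewrite gt_eqF.
  rewrite ler_wpM2r ?heat_ge0//.
  have u0 : 0 < 3 * e ^+ 2 / (8 * r ^+ 2) by rewrite divr_gt0 ?mulr_gt0 ?exprn_gt0.
  apply: (@le_trans _ _ (2 * (3 * e ^+ 2 / (8 * r ^+ 2))^-1)).
    rewrite ler_wpM2l// expRN lef_pV2 ?posrE ?expR_gt0//.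
    apply: (@le_trans _ _ (expR (3 * e ^+ 2 / (8 * r ^+ 2)))).
      by apply: le_trans (expR_ge1Dx _); rewrite lerDr.
    rewrite ler_expR; apply: ler_wpM2r; last exact: ler_wpM2l.
    by rewrite invr_ge0 mulr_ge0 ?sqr_ge0.
  have -> : 2 * (3 * e ^+ 2 / (8 * r ^+ 2))^-1 = 16 / 3 * (r ^+ 2 / e ^+ 2).
    by field; rewrite !gt_eqF.
  rewrite -(mulrA 6); apply: ler_wpM2r; last lra.
  by rewrite divr_ge0 ?sqr_ge0.
have mp s : measurable_fun setT (fun x : R => (normal_pdf m s x)%:E).
  by apply/measurable_EFinP; exact: measurable_normal_pdf.
apply: (@le_trans _ _ (\int[mu]_(x in B) ((6 * r ^+ 2 / e ^+ 2)%:E * (normal_pdf m (2 * r) x)%:E))%E).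
  apply: ge0_le_integral => //.
  - by move=> x _; rewrite lee_fin normal_pdf_ge0.
  - by apply: measurable_funTS; exact: mp.
  - by apply: measurable_funTS; apply: measurable_funeM; exact: mp.
rewrite ge0_integralZl//; last 2 first.
- by apply: measurable_funTS; exact: mp.
- by move=> x _; rewrite lee_fin normal_pdf_ge0.
rewrite -[leRHS]mule1; apply: lee_wpmul2l; first by rewrite lee_fin.
exact: (@probability_le1 _ _ _ (normal_prob m (2 * r)) B mB).
Qed.

End normal.

Section identification.
Context {d' : measure_display} {T' : measurableType d'} {R : realType}
  {P' : probability T' R}.
Variable Y : {RV P' >-> R}.
Variable s : R.
Hypothesis s0 : 0 < s.
Hypothesis Yheat : forall t x : R, 0 < t ->
  mean P' (fun w => heat t (x + Y w)) = heat (t + s ^+ 2) x.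
Local Notation mu := (@lebesgue_measure R).
Local Notation spread r := (Num.sqrt (r ^+ 2 + s ^+ 2)).

Let spread_gt0 r : 0 < spread r.
Proof. by rewrite sqrtr_gt0 ltr_wpDl ?sqr_ge0// exprn_gt0. Qed.

Let spread2 r : spread r ^+ 2 = r ^+ 2 + s ^+ 2.
Proof. by rewrite sqr_sqrtr// addr_ge0 ?sqr_ge0. Qed.

Let normal_pdfY r x w : 0 < r ->
  normal_pdf (Y w) r x = heat_mass^-1 * heat (r ^+ 2) (- x + Y w).
Proof. by move=> r0; rewrite normal_pdf_heat// /heat (_ : (x - _) ^+ 2 = (- x + Y w) ^+ 2)//; ring. Qed.

Let bfun_normal_pdfY r x : 0 < r -> bfun (fun w => normal_pdf (Y w) r x).
Proof.
move=> r0; apply: (@eq_bfun _ _ _ (fun w => heat_mass^-1 * heat (r ^+ 2) (- x + Y w))).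
  by move=> w; rewrite normal_pdfY.
apply: bfunM; first exact: bfun_cst.
by apply: (bfun_comp (bfun_heat (exprn_gt0 2 r0))); apply: measurable_funD.
Qed.

Lemma average_normal_pdf r x : 0 < r ->
  (\int[P']_w (normal_pdf (Y w) r x)%:E = (normal_pdf 0 (spread r) x)%:E)%E.
Proof.
move=> r0; have r20 : 0 < r ^+ 2 by rewrite exprn_gt0.
have bh : bfun (fun w => heat (r ^+ 2) (- x + Y w)).
  by apply: (bfun_comp (bfun_heat r20)); apply: measurable_funD.
transitivity (mean P' (fun w => heat_mass^-1 * heat (r ^+ 2) (- x + Y w)))%:E.
  rewrite meanE; last by apply: bfunM => //; exact: bfun_cst.
  by apply: eq_integral => w _; rewrite normal_pdfY.
rewrite meanZ// Yheat// normal_pdf_heat// spread2 subr0.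
by rewrite /heat sqrrN.
Qed.

Let measurable_pdfY r (A : set R) : 0 < r -> measurable A ->
  measurable_fun setT (fun z : T' * measurableTypeR R => (normal_pdf (Y z.1) r z.2 * \1_A z.2)%:E).
Proof.
move=> r0 mA; apply/measurable_EFinP; apply: measurable_funM; last first.
  by apply: (measurableT_comp (measurable_indic mA)); exact: measurable_snd.
rewrite (_ : (fun _ => _) = (fun z : T' * measurableTypeR R => heat_mass^-1 * heat (r ^+ 2) (- z.2 + Y z.1))); last first.
  by apply/funext => z; rewrite normal_pdfY.
apply: measurable_funM => //; have [mh _] := bfun_heat (exprn_gt0 2 r0).
apply: (measurableT_comp mh); apply: measurable_funD.
  by apply: measurable_funN; exact: measurable_snd.
by apply: measurableT_comp => //; exact: measurable_fst.
Qed.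

(** Smoothing the law of Y by a normal law of standard deviation r gives a
normal law. *)
Lemma average_normal_prob r (A : set R) : 0 < r -> measurable A ->
  (\int[P']_w normal_prob (Y w) r A = normal_prob 0 (spread r) A)%E.
Proof.
move=> r0 mA; rewrite normal_probE//.
under eq_integral do rewrite normal_probE//.
rewrite (fubini_tonelli _ (measurable_pdfY r0 mA)); last first.
  by move=> z; rewrite lee_fin mulr_ge0// ?normal_pdf_ge0.
apply: eq_integral => x _; rewrite /= EFinM -average_normal_pdf//.
rewrite -ge0_integralZr//; first last.
- by move=> w _; rewrite lee_fin normal_pdf_ge0.
- by apply/measurable_EFinP; have [] := bfun_normal_pdfY x r0.
Qed.

Lemma measurable_normal_probY r (A : set R) : 0 < r -> measurable A ->
  measurable_fun setT (fun w => normal_prob (Y w) r A).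
Proof.
move=> r0 mA.
rewrite (_ : (fun _ => _) = fubini_F mu (fun z : T' * measurableTypeR R => (normal_pdf (Y z.1) r z.2 * \1_A z.2)%:E)).
  apply: (measurable_fun_fubini_tonelli_F _ (measurable_pdfY r0 mA)) => z.
  by rewrite lee_fin mulr_ge0// normal_pdf_ge0.
by apply/funext => w; rewrite normal_probE.
Qed.

Lemma bound_normal_prob (A B : set R) (e : R) : measurable A -> measurable B -> 0 < e ->
  (forall x y, A y -> `|x - y| <= e -> B x) ->
  (P' (Y @^-1` A) <= normal_prob 0 (spread (e ^+ 2)) B + (6 * e ^+ 2)%:E)%E.
Proof.
move=> mA mB e0 AB; have e20 : 0 < e ^+ 2 by rewrite exprn_gt0.
have mYA : measurable (Y @^-1` A) by have := measurable_funPT Y measurableT A mA; rewrite setTI.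
have mp := measurable_normal_probY e20 mB.
have c0 : (0 <= (6 * e ^+ 2)%:E)%E by rewrite lee_fin mulr_ge0 ?sqr_ge0.
rewrite -(average_normal_prob e20 mB).
have -> : (6 * e ^+ 2)%:E = (\int[P']_w (6 * e ^+ 2)%:E)%E.
  by rewrite integral_cst//= [X in (_ * X)%E](_ : _ = 1%E) ?mule1//; exact: probability_setT.
rewrite -ge0_integralD//.
rewrite -[X in P' X]setIT -integral_indic//; apply: ge0_le_integral => //.
- by apply/measurable_EFinP; exact: measurable_indic.
- by apply: emeasurable_funD => //; exact: measurable_cst.
move=> w _; rewrite indicE; have [wA|wA] := boolP (w \in _); last first.
  by rewrite adde_ge0// measure_ge0.
have tail : (normal_prob (Y w) (e ^+ 2) (~` B) <= (6 * (e ^+ 2) ^+ 2 / e ^+ 2)%:E)%E.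
  apply: normal_tail => //; first exact: measurableC.
  move=> x nB; rewrite leNgt; apply/negP => xe; apply: nB.
  by apply: (AB x (Y w)); [move: wA; rewrite inE|exact: ltW].
have E : 6 * (e ^+ 2) ^+ 2 / e ^+ 2 = 6 * e ^+ 2 by field; rewrite gt_eqF.
have fB : normal_prob (Y w) (e ^+ 2) B \is a fin_num.
  by apply: (@fin_num_measure _ _ _ (normal_prob (Y w) (e ^+ 2))).
pose b := fine (normal_prob (Y w) (e ^+ 2) B).
have bE : normal_prob (Y w) (e ^+ 2) B = b%:E by rewrite fineK.
have h : normal_prob (Y w) (e ^+ 2) (~` B) = (1 - b)%:E.
  by rewrite EFinB -bE; exact: (@probability_setC _ _ _ (normal_prob (Y w) (e ^+ 2))).
by move: tail; rewrite E h bE -EFinD !lee_fin/=; lra.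
Qed.

Lemma normal_prob_cvg (A : set R) (A_ : nat -> set R) :
  measurable A -> (forall k, measurable (A_ k)) ->
  (forall x, \forall k \near \oo, \1_(A_ k) x = \1_A x :> R) ->
  normal_prob 0 (spread (harmonic k ^+ 2)) (A_ k) @[k --> \oo] --> normal_prob 0 s A.
Proof.
move=> mA mA_ AA; rewrite normal_probE//.
under eq_fun do rewrite normal_probE//.
pose S2 := 1 + s ^+ 2; have S20 : 0 < S2 by rewrite addr_gt0// exprn_gt0.
pose C := expR (ln S2 / 2 - ln (s ^+ 2) / 2).
have s20 : 0 < s ^+ 2 by rewrite exprn_gt0.
have h1 k : (harmonic k ^+ 2) ^+ 2 <= 1 :> R.
  by rewrite -exprM exprn_ile1 ?harmonic_ge0// /harmonic invf_le1 ?ltr0n// ler1n.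
have vk k : s ^+ 2 <= (harmonic k ^+ 2) ^+ 2 + s ^+ 2 <= S2.
  by rewrite lerDr sqr_ge0/= lerD2r h1.
have hcvg : (harmonic k ^+ 2) ^+ 2 + s ^+ 2 @[k --> \oo] --> (s ^+ 2 : R).
  have hh2 : (@harmonic R k ^+ 2) ^+ 2 @[k --> \oo] --> (0 : R).
    apply/cvgr0Pnorm_le => e e0; have he := @cvg_harmonic R.
    have e1 : 0 < Num.min 1 e by rewrite lt_min ltr01.
    have : \forall k \near \oo, `|@harmonic R k| <= Num.min 1 e by exact: cvgr0_norm_le he _ e1.
    apply: filterS => k; rewrite le_min => /andP[k1 ke]; rewrite !normrX -exprM.
    by apply: le_trans ke; rewrite -[leRHS]expr1; apply: ler_wiXn2l.
  have hh : (@harmonic R k ^+ 2) ^+ 2 + s ^+ 2 @[k --> \oo] --> 0 + s ^+ 2.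
    by apply: cvgD hh2 _; exact: cvg_cst.
  by rewrite add0r in hh; exact: hh.
have pdfE (v x : R) : 0 < v -> normal_pdf 0 v x = heat_mass^-1 * heat (v ^+ 2) x.
  by move=> v0; rewrite normal_pdf_heat// subr0.
apply: (@dominated_cvg _ _ _ mu setT _ _ _ (fun x => (C * normal_pdf 0 (Num.sqrt S2) x)%:E)) => //.
- move=> k; apply/measurable_EFinP; apply: measurable_funM; first exact: measurable_normal_pdf.
  exact: (measurable_indic (mA_ k)).
- move=> x _; apply: cvg_EFin; first by apply: nearW => k.
  rewrite [X in X @ _ --> _](_ : _ = fun k => normal_pdf 0 (spread (harmonic k ^+ 2)) x * \1_(A_ k) x); last by apply/funext.
  apply: cvgM; last by apply: cvg_near_cst.
  rewrite pdfE//; under eq_fun do rewrite pdfE// spread2.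
  apply: cvgM; first exact: cvg_cst.
  have ch : {for (s ^+ 2), continuous (heat ^~ x)}.
    apply: differentiable_continuous; apply/derivable1_diffP.
    by have [] := has_derive_heat_v x s20.
  exact: (cvg_comp _ _ hcvg ch).
- have := integrable_normal_pdf 0 (Num.sqrt S2) => /(@integrableZl _ _ _ mu setT measurableT C).
  by apply: eq_integrable => // x _; rewrite EFinM.
- move=> k x _; rewrite /= lee_fin normrM ger0_norm ?normal_pdf_ge0//.
  apply: (@le_trans _ _ (normal_pdf 0 (spread (harmonic k ^+ 2)) x)).
    by rewrite ler_piMr ?normal_pdf_ge0// indicE; case: (_ \in _); rewrite /= ?normr1 ?normr0.
  rewrite (pdfE _ _ (spread_gt0 _)) (pdfE (Num.sqrt S2)) ?sqrtr_gt0// spread2 sqr_sqrtr ?(ltW S20)// mulrCA ler_wpM2l ?invr_ge0 ?(ltW heat_mass_gt0)//.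
  rewrite /heat /C -expRD ler_expR; have /andP[v1 v2] := vk k.
  move: (_ + s ^+ 2) v1 v2 => v v1 v2; have v0 := lt_le_trans s20 v1.
  have l1 : ln (s ^+ 2) <= ln v by rewrite ler_ln.
  have l2 : x ^+ 2 / (2 * S2) <= x ^+ 2 / (2 * v).
    by rewrite ler_wpM2l ?sqr_ge0// lef_pV2 ?posrE ?mulr_gt0// ler_wpM2l.
  by rewrite mulNr; lra.
Qed.

Lemma closed_le_normal_prob (A : set R) (A_ : nat -> set R) :
  measurable A -> (forall k, measurable (A_ k)) ->
  (forall k x y, A y -> `|x - y| <= harmonic k -> A_ k x) ->
  (forall x, ~ A x -> \forall k \near \oo, ~ A_ k x) ->
  (P' (Y @^-1` A) <= normal_prob 0 s A)%E.
Proof.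
move=> mA mA_ AA nA.
have h0 k : 0 < harmonic k :> R by rewrite invr_gt0 ltr0n.
have AE x : \forall k \near \oo, \1_(A_ k) x = \1_A x :> R.
  have [xA|xA] := pselect (A x).
    apply: nearW => k; rewrite !indicE !mem_set//; apply: (AA k x x) => //.
    by rewrite subrr normr0 ltW.
  by apply: filterS (nA x xA) => k kx; rewrite !indicE !memNset.
have cv := normal_prob_cvg mA mA_ AE.
have cv6 : ((6 * harmonic k ^+ 2)%:E : \bar R) @[k --> \oo] --> 0%E.
  apply: cvg_EFin; first by apply: nearW.
  apply/cvgr0Pnorm_le => e e0.
  have e1 : 0 < Num.min 1 (e / 6) by rewrite lt_min ltr01/= divr_gt0.
  have : \forall k \near \oo, `|@harmonic R k| <= Num.min 1 (e / 6).
    by exact: cvgr0_norm_le (@cvg_harmonic R) _ e1.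
  apply: filterS => k; rewrite le_min => /andP[k1 ke].
  rewrite /= normrM normrX [`|6|]ger0_norm// -ler_pdivlMl// mulrC.
  by apply: le_trans ke; rewrite expr2 ler_piMr.
have cvD : (normal_prob 0 (spread (harmonic k ^+ 2)) (A_ k) + (6 * harmonic k ^+ 2)%:E)%E
    @[k --> \oo] --> (normal_prob 0 s A + 0)%E.
  by apply: cvgeD => //; rewrite fin_num_adde_defl.
rewrite -[leRHS]adde0; apply: (cvge_to_ge cvD).
apply: nearW => k; apply: bound_normal_prob => //; exact: AA.
Qed.

Lemma halfline_le_normal_prob (b : R) :
  (P' (Y @^-1` `[b, +oo[) <= normal_prob 0 s `[b, +oo[)%E /\
  (P' (Y @^-1` `]-oo, b]) <= normal_prob 0 s `]-oo, b])%E.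
Proof.
have hle (e x : R) : 0 < e -> \forall k \near \oo, @harmonic R k < e.
  by move=> e0; apply: cvgr_lt e0; exact: cvg_harmonic.
split.
- apply: (@closed_le_normal_prob _ (fun k => `[b - harmonic k, +oo[%classic)).
  + exact: measurable_itv.
  + by move=> k; exact: measurable_itv.
  + move=> k x y; move: (harmonic k) => e; rewrite /= !in_itv/= !andbT ler_distl => ? /andP[? ?]; lra.
  + move=> x; rewrite /= in_itv/= andbT => /negP; rewrite -ltNge => xb.
    have := hle (b - x) 0; rewrite subr_gt0 => /(_ xb); apply: filterS => k; rewrite /harmonic/= in_itv/= andbT.
    by move: (k.+1%:R^-1) => e kb; apply/negP; rewrite -ltNge; lra.
- apply: (@closed_le_normal_prob _ (fun k => `]-oo, b + harmonic k]%classic)).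
  + exact: measurable_itv.
  + by move=> k; exact: measurable_itv.
  + move=> k x y; move: (harmonic k) => e; rewrite /= !in_itv/= ler_distl => ? /andP[? ?]; lra.
  + move=> x; rewrite /= in_itv/= => /negP; rewrite -ltNge => xb.
    have := hle (x - b) 0; rewrite subr_gt0 => /(_ xb); apply: filterS => k; rewrite /harmonic/= in_itv/=.
    by move: (k.+1%:R^-1) => e kb; apply/negP; rewrite -ltNge; lra.
Qed.

Lemma halfline_normal_prob (b : R) :
  P' (Y @^-1` `[b, +oo[) = normal_prob 0 s `[b, +oo[.
Proof.
have [h1 h2] := halfline_le_normal_prob b.
apply/eqP; rewrite eq_le h1/=.
have mN (A : set R) : measurable A -> measurable (A : set (measurableTypeR R)) by [].
have b0 : normal_prob 0 s [set b] = 0%E.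
  have /null_content_dominatesP := @normal_prob_dominates R 0 s; apply.
    exact: measurable_set1.
  exact: lebesgue_measure_set1.
have mi : measurable (`]-oo, b[ : set R) by exact: measurable_itv.
have e1 : normal_prob 0 s `[b, +oo[ = (1 - normal_prob 0 s `]-oo, b[)%E.
  rewrite -(@probability_setC _ _ _ (normal_prob 0 s)) ?setCitvl//; exact: mN.
have e2 : P' (Y @^-1` `[b, +oo[) = (1 - P' (Y @^-1` `]-oo, b[))%E.
  rewrite -probability_setC; last by have := measurable_funPT Y measurableT _ mi; rewrite setTI.
  by rewrite preimage_setC setCitvl.
have e3 : normal_prob 0 s `]-oo, b] = normal_prob 0 s `]-oo, b[.
  have U : `]-oo, b]%classic = `]-oo, b[%classic `|` [set b].
    by rewrite setUitv1.
  have := @measureU0 _ _ _ (normal_prob 0 s) `]-oo, b[ [set b] (mN _ mi) (mN _ (measurable_set1 b)) b0.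
  by rewrite -U.
rewrite e1 e2; apply: leeB => //; rewrite -e3; apply: le_trans h2.
apply: le_measure; rewrite ?inE//.
- by have := measurable_funPT Y measurableT _ mi; rewrite setTI.
- by have := measurable_funPT Y measurableT _ (measurable_itv `]-oo, b]); rewrite setTI.
- by move=> w; rewrite /= !in_itv/=; exact: ltW.
Qed.

Lemma distribution_normal (A : set R) : measurable A ->
  distribution P' Y A = normal_prob 0 s A.
Proof.
move=> mA.
pose g n : set R := `[- n%:R, +oo[%classic.
have mG : (@ocitv R).-sigma.-measurable = <<s (@RGenCInfty.G R) >> by exact: RGenCInfty.measurableE.
have GI : setI_closed (@RGenCInfty.G R).
  move=> _ _ [x ->] [y ->]; exists (Num.max x y); apply/seteqP; split => z;
    by rewrite /= !in_itv/= !andbT ge_max => /andP.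
have Gg n : @RGenCInfty.G R (g n) by exists (- n%:R).
have gT : \bigcup_n g n = setT.
  apply/seteqP; split => // x _; exists (Num.bound `|x|) => //.
  by rewrite /g /= in_itv/= andbT lerNl (le_trans (ler_norm _))// normrN ltW// archi_boundP.
pose m1 : {measure set R -> \bar R} := distribution P' Y.
pose m2 : {measure set R -> \bar R} := distribution (normal_prob 0 s) (@to_R R).
apply: (@measure_unique _ R R _ g mG GI Gg gT m1 m2 _ _ A mA).
- by move=> _ [b ->]; exact: halfline_normal_prob.
- move=> n; apply: (@le_lt_trans _ _ 1%E); last exact: ltry.
  apply: (@probability_le1 _ _ _ (distribution P' Y)); exact: measurable_itv.
Qed.

End identification.

Section degenerate.
Context {d' : measure_display} {T' : measurableType d'} {R : realType}
  {P' : probability T' R}.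
Variable Y : {RV P' >-> R}.

(** A variable whose heat averages at the origin do not drop has no mass away
from the origin. *)
Lemma distribution_dirac0 : mean P' (fun w => heat 1 (0 + Y w)) = heat 1 0 ->
  forall A : set R, measurable A -> distribution P' Y A = \d_(0 : R) A.
Proof.
move=> h A mA.
pose f w : R := heat 1 0 - heat 1 (0 + Y w).
have f0 w : 0 <= f w.
  rewrite /f subr_ge0 /heat ler_expR lerD2l lerN2 add0r expr0n/= mul0r.
  by rewrite mulr_ge0 ?sqr_ge0.
have bh : bfun (fun w => heat 1 (0 + Y w)).
  by apply: (bfun_comp (bfun_heat ltr01)); apply: measurable_funD.
have bf : bfun f by apply: bfunB => //; exact: bfun_cst.
have mf : mean P' f = 0 by rewrite /f meanB ?mean_cst ?h ?subrr//; exact: bfun_cst.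
pose N : set T' := Y @^-1` (~` [set 0]).
have mN : measurable N.
  have := measurable_funPT Y measurableT _ (measurableC (measurable_set1 (0:R))).
  by rewrite setTI.
have N0 : P' N = 0%E.
  have : ae_eq P' setT (EFin \o f) (cst 0%E).
    have [mf' _] := bf.
    apply/ae_eq_integral_abs => //; first exact/measurable_EFinP.
    under eq_integral do rewrite /= ger0_norm//.
    by rewrite -meanE// mf.
  case=> B [mB PB NB]; apply: (@subset_measure0 _ _ _ P' N B) => // w Yw; apply: NB => /= hw.
  apply: Yw; have := EFin_inj (hw I); rewrite /f /heat add0r => /subr0_eq/expR_inj.
  rewrite expr0n/= mul0r subr0 ln1 mulr1 => /eqP; rewrite eq_sym subr_eq addrC -subr_eq subrr.
  by rewrite eq_sym mulf_eq0 invr_eq0 pnatr_eq0 orbF sqrf_eq0 => /eqP.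
have mYA : measurable (Y @^-1` A) by have := measurable_funPT Y measurableT A mA; rewrite setTI.
have E : mean P' (\1_(Y @^-1` A)) = mean P' (fun=> \1_A (0 : R)).
  apply: (eq_mean_on mN N0); [exact: bfun_indic|exact: bfun_cst|].
  move=> w /contrapT Yw; rewrite !indicE (_ : (w \in _) = (0 \in A))//.
  by apply/idP/idP; rewrite !inE /= Yw.
move: E; rewrite mean_indic// mean_cst => E.
rewrite /distribution /pushforward diracE -indicE -E fineK// fin_num_measure//.
Qed.

End degenerate.

Lemma constant_is_gaussian {d d' : measure_display} {T : measurableType d}
    {T' : measurableType d'} {R : realType} {P : probability T R}
    {P' : probability T' R} (g : R * R -> R) (X : nat -> {RV P >-> R})
    (U : nat -> nat -> {RV P >-> R}) (Y : {RV P' >-> R}) (p := mean unif (deg g)) :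
  graph_function g -> singular_graphon g -> iid_uniform01 X U ->
  cvg_in_distribution P P' (edge_fluctuation g X U) Y -> 0 < p ->
  mean unif (fun x => mean unif (fun y => (clip g (x, y) - p) ^+ 2)) = 0 ->
  is_gaussian Y.
Proof.
move=> hg hsing hXU hY p0 h0.
have heatY (t x : R) : 0 < t -> mean P' (fun w => heat t (x + Y w)) =
    heat (t + 2 * (p * (1 - p))) x by exact: (mean_heat_limit hg hsing hXU hY h0).
have /andP[_ p1] := edge_density01 hg; rewrite -/p in p1.
have [pE|p1'] := eqVneq p 1.
  left; exists 0; apply: distribution_dirac0.
  by rewrite heatY// pE subrr !mulr0 addr0.
have v0 : 0 < 2 * (p * (1 - p)) by rewrite !mulr_gt0// subr_gt0 lt_neqAle p1'.
right; exists 0, (Num.sqrt (2 * (p * (1 - p)))); split; first by rewrite sqrtr_gt0.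
move=> A mA; apply: distribution_normal => //; first by rewrite sqrtr_gt0.
by move=> t x t0; rewrite heatY// sqr_sqrtr// ltW.
Qed.

Section gaussian_cumulant.
Context {d : measure_display} {T : measurableType d} {R : realType}
  {P : probability T R}.
Variable Y : {RV P >-> R}.
Local Notation mu := (@lebesgue_measure R).

Lemma quadratic_log_cumulant (m v : R) :
  (forall t, 'M_P Y t = (expR (m * t + v * t ^+ 2))%:E) -> has_cumulant P Y 4 0.
Proof.
move=> MY; pose c (k : nat) : R := if k == 1%N then m else if k == 2%N then v else 0.
exists c; split; last by rewrite /c mulr0.
exists 1 => //= t _; rewrite MY; split => //.
rewrite /= expRK; apply: cvg_near_cst; exists 3%N => // n /= n3.
rewrite /pseries /series/= -(subnKC n3) big_mkord !big_ord_recl /= /bump/= big1.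
  by rewrite /c/= !add1n/= mul0r add0r addr0 expr1.
by move=> i _; rewrite /c /= !add1n/= mul0r.
Qed.

(** Averages under a normal law, by the layer-cake formula. *)
Lemma expectation_normal (m s : R) (h : R -> R) :
  (forall A : set R, measurable A -> distribution P Y A = normal_prob m s A) ->
  measurable_fun setT h -> (forall x, 0 <= h x) ->
  (\int[P]_w (h (Y w))%:E = \int[mu]_x (normal_pdf m s x * h x)%:E)%E.
Proof.
move=> YN mh h0; pose k (y u : R) : R := (0 <= u < h y)%R%:R.
have hE y : (h y)%:E = (\int[mu]_u (k y u)%:E)%E.
  have : (\int[mu]_u (\1_(`[0%R, h y[ : set R) u)%:E = (h y)%:E)%E.
    rewrite integral_indic//= setIT lebesgue_measure_itv/= lte_fin sube0.
    by have := h0 y; rewrite le_eqVlt => /orP[/eqP<-|->]//; rewrite ltxx.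
  by move=> <-; apply: eq_integral => u _; rewrite indicE mem_setE in_itv.
have mk d1 (T1 : measurableType d1) (f : T1 -> R) (z : T1 -> measurableTypeR R) :
    measurable_fun setT f -> measurable_fun setT z -> measurable_fun setT (fun w => k (f w) (z w)).
  move=> mf mz; have mB : measurable [set w | 0 <= z w < h (f w)].
    rewrite -[X in measurable X]setTI; apply: (@measurable_and _ _ setT (fun w => 0 <= z w) (fun w => z w < h (f w))) => //.
      by apply: measurable_fun_ler => //; exact: measurable_cst.
    by apply: measurable_fun_ltr => //; exact: measurableT_comp.
  by have [mm _] : bfun (fun w => k (f w) (z w) : R)
    by apply: eq_bfun (bfun_indic mB) => w; rewrite indicE mem_setE.
have k0 y u : 0 <= k y u by rewrite /k ler0n.
under eq_integral do rewrite hE.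
rewrite (fubini_tonelli (fun z : T * measurableTypeR R => (k (Y z.1) z.2)%:E)); first last.
- by move=> z; rewrite lee_fin.
- apply/measurable_EFinP.
  exact: (mk _ (T * measurableTypeR R)%type (Y \o fst) snd
    (measurableT_comp (measurable_funPT Y) measurable_fst) measurable_snd).
have mkx u : measurable [set x | 0 <= u < h x].
  rewrite -[X in measurable X]setTI; apply: (@measurable_and _ _ setT (fun w => 0 <= u) (fun w => u < h w)) => //.
  by apply: measurable_fun_ltr => //; exact: measurable_cst.
transitivity (\int[mu]_u \int[mu]_x (normal_pdf m s x * k x u)%:E)%E.
  apply: eq_integral => u _.
  have : distribution P Y [set x | 0 <= u < h x] = (\int[P]_w (k (Y w) u)%:E)%E.
    rewrite /distribution /pushforward -[X in P X]setIT -integral_indic//.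
      by apply: eq_integral => w _; rewrite indicE mem_setE.
    by have := measurable_funPT Y measurableT _ (mkx u); rewrite setTI.
  move=> <-; rewrite YN// normal_probE//.
  by apply: eq_integral => x _; rewrite indicE mem_setE.
rewrite (fubini_tonelli (fun z : measurableTypeR R * measurableTypeR R => (normal_pdf m s z.2 * k z.2 z.1)%:E)); first last.
- by move=> z; rewrite lee_fin mulr_ge0 ?normal_pdf_ge0.
- apply/measurable_EFinP; apply: measurable_funM.
    by apply: (measurableT_comp (measurable_normal_pdf m s)); exact: measurable_snd.
  exact: (mk _ (measurableTypeR R * measurableTypeR R)%type snd fst measurable_snd measurable_fst).
apply: eq_integral => x _; rewrite EFinM hE -ge0_integralZl//.
- by apply/measurable_EFinP; apply: (mk _ (measurableTypeR R) (cst (x : R)) id); [exact: measurable_cst|exact: measurable_id].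
- by move=> u _; rewrite lee_fin.
- by rewrite lee_fin normal_pdf_ge0.
Qed.

Lemma gaussian_cumulant4 : is_gaussian Y -> has_cumulant P Y 4 0.
Proof.
have mgfY t : 'M_P Y t = (\int[P]_w (expR (t * Y w))%:E)%E.
  by rewrite /mmt_gen_fun unlock; apply: eq_integral => w _; rewrite /= mulrC.
have me t : measurable_fun setT (fun y : R => expR (t * y)).
  by apply: measurableT_comp => //; apply: measurable_funM.
case=> [[m Ym]|[m [s [s0 YN]]]].
  apply: (@quadratic_log_cumulant m 0) => t; rewrite mgfY mul0r addr0.
  have mE : measurable_fun setT (fun y : R => (expR (t * y))%:E) by exact/measurable_EFinP.
  transitivity (\int[distribution P Y]_y (expR (t * y))%:E)%E.
    by rewrite ge0_integral_distribution// => y; rewrite lee_fin expR_ge0.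
  rewrite (eq_measure_integral (\d_m)); last by move=> A mA _; exact: Ym.
  by rewrite integral_dirac// diracT mul1e mulrC.
apply: (@quadratic_log_cumulant m (s ^+ 2 / 2)) => t; rewrite mgfY.
rewrite (expectation_normal YN (me t)); last by move=> x; exact: expR_ge0.
transitivity (\int[mu]_x ((expR (m * t + s ^+ 2 / 2 * t ^+ 2))%:E * (normal_pdf (m + s ^+ 2 * t) s x)%:E))%E.
  apply: eq_integral => x _; rewrite -EFinM !normal_pdf_heat//; congr EFin.
  rewrite mulrCA -[LHS]mulrA; congr (_ * _).
  by rewrite /heat -!expRD; congr expR; field; rewrite gt_eqF.
rewrite ge0_integralZl//.
- by rewrite integral_normal_pdf mule1.
- by apply/measurable_EFinP; exact: measurable_normal_pdf.
- by move=> x _; rewrite lee_fin normal_pdf_ge0.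
Qed.

End gaussian_cumulant.

(** * The equivalences *)

Theorem proposition41 (R : realType) (g : R * R -> R) (p : R)
  (hg : graph_function g) (hsing : singular_graphon g)
  (hp : p = graphon_density K2 g) (p_gt0 : 0 < p)
  (d : measure_display) (T : measurableType d) (P : probability T R)
  (X : nat -> {RV P >-> R}) (U : nat -> nat -> {RV P >-> R})
  (hXU : iid_uniform01 X U)
  (d' : measure_display) (T' : measurableType d') (P' : probability T' R)
  (Y : {RV P' >-> R})
  (hY : cvg_in_distribution P P' (edge_fluctuation g X U) Y) :
  (same_graphon g (cst p) <-> is_gaussian Y) /\
  (is_gaussian Y <-> has_cumulant P' Y 4 0).
Proof.
have pE : p = mean unif (deg g) by rewrite hp edge_density_deg.
have h12 : same_graphon g (cst p) -> is_gaussian Y.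
  move=> gp; apply: (constant_is_gaussian hg hsing hXU hY); rewrite -pE//.
  apply: (rect0_kernel0 hg); first by rewrite pE; exact: edge_density01.
  by move=> S S' mS mS'; exact: (same_graphon_rect0 hg).
have h23 := @gaussian_cumulant4 _ _ _ _ Y.
have h31 : has_cumulant P' Y 4 0 -> same_graphon g (cst p).
  move=> Y4; apply: (rect0_same_graphon hg) => S S' mS mS'.
  by apply: (C4_zero_rect hg) => //; rewrite pE; exact: (cumulant_C4 hg hsing hXU hY).
by split; split; [exact: h12|move=> /h23/h31|exact: h23|move=> /h31/h12].
Qed.
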